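(* Let $0<q\le p\le 1$, let $\overline{X}=(X_0,X_1)$ be a $p$-convex quasi-Banach lattice couple and let $X$ be an intermediate quasi-Banach lattice with respect to $\overline{X}$. Then the following conditions are equivalent: (a) $X$ is finitely $K(p,q)$-monotone with respect to $\overline X$; (b) $X$ is $K$-monotone with respect to $\overline{X}$ and $(p,q)$-convex; (c) $X$ is $K(p,q)$-monotone with respect to $\overline X$.
   Context: All spaces are real. A quasi-Banach lattice is a vector lattice with a complete quasi-norm such that $\|x\|\le\|y\|$ whenever $|x|\le|y|$. Elements $(\sum_{k=1}^n|x_k|^p)^{1/p}$ are defined by the homogeneous functional calculus. A quasi-Banach lattice $X$ is $(p,q)$-convex if for some $M$ and all finite families $\|(\sum_{k=1}^n|x_k|^p)^{1/p}\|_X\le M(\sum_{k=1}^n\|x_k\|_X^q)^{1/q}$; $p$-convex means $(p,p)$-convex. A quasi-Banach lattice couple $\overline{X}=(X_0,X_1)$ is a pair of quasi-Banach lattices both embedded into some Hausdorff topological vector lattice by continuous, interval preserving, injective lattice homomorphisms; it is $p$-convex if both $X_0,X_1$ are. $\Delta(\overline X)=X_0\cap X_1$ with quasi-norm $\max(\|x\|_{X_0},\|x\|_{X_1})$; $\Sigma(\overline X)=X_0+X_1$ with quasi-norm $\inf\{\|x_0\|_{X_0}+\|x_1\|_{X_1}:x=x_0+x_1\}$. $K(t,x;\overline{X})=\inf\{\|x_0\|_{X_0}+t\|x_1\|_{X_1}:x=x_0+x_1,\ x_i\in X_i\}$. A quasi-Banach lattice $X$ is intermediate if $\Delta(\overline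 X)\subset X\subset\Sigma(\overline X)$, the inclusions being continuous interval preserving lattice homomorphisms. $X$ is $K$-monotone with respect to $\overline X$ if $x\in X$, $y\in\Sigma(\overline X)$ and $K(t,y;\overline X)\le K(t,x;\overline X)$ for all $t>0$ imply $y\in X$. $X$ is $K(p,q)$-monotone with respect to $\overline X$ if there is $C>0$ such that whenever $x_i\in X$, $\sum_{i=1}^\infty\|x_i\|_X^q<\infty$, $x\in\Sigma(\overline X)$ and $K(t,x;\overline X)\le(\sum_{i=1}^\infty K(t,x_i;\overline X)^p)^{1/p}$ for all $t>0$, one has $x\in X$ and $\|x\|_X\le C(\sum_i\|x_i\|_X^q)^{1/q}$. $X$ is finitely $K(p,q)$-monotone if the same holds, with one constant $C$, for all finite sequences $\{x_i\}_{i=1}^n\subset X$, $n\in\mathbb{N}$. *)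

(* Defs.v *)
From HB Require Import structures.
From mathcomp Require Import all_boot all_order all_algebra.
From mathcomp Require Import all_classical all_reals all_analysis.

Set Implicit Arguments.
Unset Strict Implicit.
Unset Printing Implicit Defensive.

Import Order.TTheory GRing.Theory Num.Theory.
Import numFieldNormedType.Exports.

Local Open Scope classical_set_scope.
Local Open Scope ring_scope.

(* Join and meet are fields of the mixin because Hierarchy-Builder rejects a
   new join of Order.Lattice with Lmodule above Num.RealDomain. *)
HB.mixin Record isVectorLattice (R : numDomainType) V
    & Num.POrderedZmodule V & GRing.Lmodule R V := {
  vjoin : V -> V -> V ;
  vmeet : V -> V -> V ;
  vjoin_le : forall x y z : V, (vjoin x y <= z) = (x <= z) && (y <= z) ;
  vmeet_ge : forall x y z : V, (z <= vmeet x y) = (z <= x) && (z <= y) ;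
  vlerD2r : forall x y z : V, x <= y -> x + z <= y + z ;
  vlerZ : forall (a : R) (x y : V), 0 <= a -> x <= y -> a *: x <= a *: y
}.

#[short(type="vectorLatticeType")]
HB.structure Definition VectorLattice (R : numDomainType) :=
  {V of Num.POrderedZmodule V & GRing.Lmodule R V & isVectorLattice R V}.

Notation "x '`v`' y" := (vjoin x y)
  (at level 52, left associativity) : ring_scope.
Notation "x '`^`' y" := (vmeet x y)
  (at level 48, left associativity) : ring_scope.

Definition vabs (R : numDomainType) (V : vectorLatticeType R) (x : V) : V :=
  x `v` - x.

Definition solid (R : numDomainType) (V : vectorLatticeType R) (S : set V) :=
  forall x y : V, vabs x <= vabs y -> S y -> S x.

HB.mixin Record isLocallySolid (R : numDomainType) V
    & Topological V & VectorLattice R V := {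
  locally_solid : forall U : set V, nbhs (0 : V) U ->
    exists2 S : set V, nbhs (0 : V) S & solid S /\ S `<=` U
}.

#[short(type="topVectorLatticeType")]
HB.structure Definition TopVectorLattice (R : numDomainType) :=
  {V of TopologicalLmodule R V & VectorLattice R V & isLocallySolid R V}.

HB.mixin Record isQuasiBanachLattice (R : realType) V & VectorLattice R V := {
  qnorm : V -> R ;
  qnorm_ge0 : forall x, 0 <= qnorm x ;
  qnorm0_eq0 : forall x, qnorm x = 0 -> x = 0 ;
  qnormZ : forall (a : R) x, qnorm (a *: x) = `|a| * qnorm x ;
  qnormD : exists C : R, forall x y, qnorm (x + y) <= C * (qnorm x + qnorm y) ;
  qnorm_lattice : forall x y, vabs x <= vabs y -> qnorm x <= qnorm y ;
  qnorm_complete : forall u : nat -> V,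
    (forall e : R, 0 < e -> exists N : nat, forall m n : nat,
      (N <= m)%N -> (N <= n)%N -> qnorm (u m - u n) < e) ->
    exists l : V, (fun n => qnorm (u n - l)) @ \oo --> (0 : R)
}.

#[short(type="qBanachLatticeType")]
HB.structure Definition QBanachLattice (R : realType) :=
  {V of VectorLattice R V & isQuasiBanachLattice R V}.

(* The balls of a quasi-norm need not be open, but they generate the
   neighbourhood filters of its vector topology. *)
Definition qnbhs (R : realType) (V : zmodType) (N : V -> R) (x : V) :
    set_system V :=
  filter_from [set e : R | 0 < e] (fun e => [set y | N (y - x) < e]).

Section Morphisms.
Context {R : numDomainType} {V W : vectorLatticeType R}.
Implicit Type f : V -> W.

Definition lattice_homomorphism f :=
  [/\ linear f, {morph f : x y / x `v` y} & {morph f : x y / x `^` y}].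

Definition interval_preserving f :=
  forall x : V, 0 <= x ->
    f @` [set y | 0 <= y <= x] = [set z | 0 <= z <= f x].

End Morphisms.

Definition couple_embedding (R : realType) (X : qBanachLatticeType R)
    (E : topVectorLatticeType R) (f : X -> E) :=
  [/\ lattice_homomorphism f, interval_preserving f, injective f &
      forall x, f @ qnbhs qnorm x --> f x].

Section HomogeneousCalculus.
Context {R : realType} {X : qBanachLatticeType R} {n : nat}.

Definition homogeneous_cont (f : 'rV[R]_n -> R) :=
  continuous f /\ forall (a : R) v, 0 <= a -> f (a *: v) = a * f v.

Definition is_hom_calculus (x : 'I_n -> X) (Phi : ('rV[R]_n -> R) -> X) :=
  (forall k, Phi (fun v => v 0 k) = x k) /\
  (forall f g, homogeneous_cont f -> homogeneous_cont g ->
    [/\ forall a : R, Phi (fun v => a * f v + g v) = a *: Phi f + Phi g,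
        Phi (fun v => Num.max (f v) (g v)) = Phi f `v` Phi g &
        Phi (fun v => Num.min (f v) (g v)) = Phi f `^` Phi g]).

(* The lattice homomorphism of [is_hom_calculus] exists and is unique on
   [homogeneous_cont] in every quasi-Banach lattice; 0 is a default value
   for the other functions. *)
Definition hom_calculus (x : 'I_n -> X) (f : 'rV[R]_n -> R) : X :=
  xget 0 [set y | homogeneous_cont f /\
                  exists2 Phi, is_hom_calculus x Phi & Phi f = y].

Definition lp_sum (p : R) (x : 'I_n -> X) : X :=
  hom_calculus x (fun v => (\sum_(k < n) `|v 0 k| `^ p) `^ p^-1).

End HomogeneousCalculus.

Definition pq_convex (R : realType) (p q : R) (X : qBanachLatticeType R) :=
  exists M : R, forall (n : nat) (x : 'I_n -> X),
    qnorm (lp_sum p x) <= M * (\sum_(k < n) qnorm (x k) `^ q) `^ q^-1.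

Section VectorLatticeTheory.
Context {R : numDomainType} {V : vectorLatticeType R}.
Implicit Types x y z : V.

Lemma vlerD2rE x y z : (x + z <= y + z) = (x <= y).
Proof.
apply/idP/idP; last exact: vlerD2r.
by move=> /(vlerD2r _ _ (- z)); rewrite !addrK.
Qed.

Lemma vlerD2l x y z : (z + x <= z + y) = (x <= y).
Proof. by rewrite !(addrC z) vlerD2rE. Qed.

Lemma vlerBlDr x y z : (x - z <= y) = (x <= y + z).
Proof. by rewrite -(vlerD2rE (x - z) y z) subrK. Qed.

Lemma vlerBrDr x y z : (x <= y - z) = (x + z <= y).
Proof. by rewrite -(vlerD2rE x (y - z) z) subrK. Qed.

Lemma vsubr_ge0 x y : (0 <= y - x) = (x <= y).
Proof. by rewrite vlerBrDr add0r. Qed.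

Lemma vlerD x y z (t : V) : x <= y -> z <= t -> x + z <= y + t.
Proof.
move=> xy zt; apply: (le_trans (vlerD2r _ _ z xy)).
by rewrite (addrC y z) (addrC y t) vlerD2r.
Qed.

Lemma vler_joinl x y : x <= x `v` y.
Proof. by have := lexx (x `v` y); rewrite vjoin_le => /andP[]. Qed.

Lemma vler_joinr x y : y <= x `v` y.
Proof. by have := lexx (x `v` y); rewrite vjoin_le => /andP[]. Qed.

Lemma vmeet_lel x y : x `^` y <= x.
Proof. by have := lexx (x `^` y); rewrite vmeet_ge => /andP[]. Qed.

Lemma vmeet_ler x y : x `^` y <= y.
Proof. by have := lexx (x `^` y); rewrite vmeet_ge => /andP[]. Qed.

Lemma vjoin_pos x y : x `v` y = x + ((y - x) `v` 0).
Proof.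
rewrite addrC; apply/le_anti/andP; split.
  rewrite vjoin_le -(vlerBlDr y) vler_joinl andbT.
  by rewrite -(vlerBlDr x) subrr vler_joinr.
by rewrite -vlerBrDr vjoin_le vlerD2rE vler_joinr vsubr_ge0 vler_joinl.
Qed.

Lemma vmeet_pos x y : x `^` y = x - ((x - y) `v` 0).
Proof.
apply/le_anti/andP; split.
  rewrite vlerBrDr addrC -vlerBrDr vjoin_le vsubr_ge0 vmeet_lel andbT.
  by rewrite vlerBrDr addrAC vlerBlDr vlerD2l vmeet_ler.
rewrite vmeet_ge !vlerBlDr; apply/andP; split.
  by rewrite addrC -vlerBlDr subrr vler_joinr.
by rewrite addrC -vlerBlDr vler_joinl.
Qed.

End VectorLatticeTheory.

Record vsublattice (R : numDomainType) (E : vectorLatticeType R) :=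
  VSublattice {
    vsublattice_set :> {pred E} ;
    vsublattice_submod : submod_closed vsublattice_set ;
    vsublattice_meet : {in vsublattice_set &, forall x y : E,
                          x `^` y \in vsublattice_set} ;
    vsublattice_join : {in vsublattice_set &, forall x y : E,
                          x `v` y \in vsublattice_set} }.

Section SubVectorLattice.
Context {R : numDomainType} {E : vectorLatticeType R} (S : vsublattice E).

HB.instance Definition _ :=
  GRing.isSubmodClosed.Build R E (vsublattice_set S) (vsublattice_submod S).

Record sub_vlattice := SubVLattice {
  sub_vlattice_val :> E ; _ : sub_vlattice_val \in vsublattice_set S }.

HB.instance Definition _ := [isSub for sub_vlattice_val].
HB.instance Definition _ := [Choice of sub_vlattice by <:].
HB.instance Definition _ := [SubChoice_isSubLmodule of sub_vlattice by <:].
HB.instance Definition _ :=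
  [SubChoice_isSubPOrder of sub_vlattice by <: with ring_display].
Let sjoin (x y : sub_vlattice) :=
  SubVLattice (vsublattice_join (valP x) (valP y)).
Let smeet (x y : sub_vlattice) :=
  SubVLattice (vsublattice_meet (valP x) (valP y)).

Let sjoin_le x y z : (sjoin x y <= z) = (x <= z) && (y <= z).
Proof. by rewrite -!Order.le_val /= vjoin_le. Qed.

Let smeet_ge x y z : (z <= smeet x y) = (z <= x) && (z <= y).
Proof. by rewrite -!Order.le_val /= vmeet_ge. Qed.

Let slerD2r (x y z : sub_vlattice) : x <= y -> x + z <= y + z.
Proof. by rewrite -!Order.le_val !raddfD; exact: vlerD2r. Qed.

Let slerZ (a : R) (x y : sub_vlattice) : 0 <= a -> x <= y -> a *: x <= a *: y.
Proof. by rewrite -!Order.le_val !linearZ; exact: vlerZ. Qed.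

HB.instance Definition _ :=
  isVectorLattice.Build R sub_vlattice sjoin_le smeet_ge slerD2r slerZ.

End SubVectorLattice.

Record qb_couple (R : realType) := QBCouple {
  space0 : qBanachLatticeType R ;
  space1 : qBanachLatticeType R ;
  ambient : topVectorLatticeType R ;
  ambient_hausdorff : hausdorff_space ambient ;
  emb0 : space0 -> ambient ;
  emb1 : space1 -> ambient ;
  emb0P : couple_embedding emb0 ;
  emb1P : couple_embedding emb1
}.

Section LatticeHomomorphismTheory.
Context {R : numDomainType} {V W : vectorLatticeType R} {f : V -> W}.
Hypothesis fhom : lattice_homomorphism f.

Let flin : linear f. Proof. by case: fhom. Qed.

Lemma lhom0 : f 0 = 0.
Proof.
by have := flin (-1) 0 0; rewrite scaler0 addr0 scaleN1r addNr.
Qed.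

Lemma lhomD x y : f (x + y) = f x + f y.
Proof. by rewrite -[x]scale1r flin !scale1r. Qed.

Lemma lhomZ a x : f (a *: x) = a *: f x.
Proof. by rewrite -[a *: x]addr0 flin lhom0 addr0. Qed.

Lemma lhomU x y : f (x `v` y) = f x `v` f y.
Proof. by case: fhom. Qed.

Lemma lhomI x y : f (x `^` y) = f x `^` f y.
Proof. by case: fhom. Qed.

End LatticeHomomorphismTheory.

Section DeltaSigma.
Context {R : realType} (C : qb_couple R).

Definition delta_set : set (ambient C) :=
  range (@emb0 R C) `&` range (@emb1 R C).

Definition sigma_set : set (ambient C) :=
  [set emb0 z.1 + emb1 z.2 | z in [set: space0 C * space1 C]].

Let hom0 : lattice_homomorphism (@emb0 R C). Proof. by case: (emb0P C). Qed.
Let hom1 : lattice_homomorphism (@emb1 R C). Proof. by case: (emb1P C). Qed.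

Fact delta_submod : submod_closed [in delta_set].
Proof.
split; first by rewrite inE; split; exists 0; rewrite // lhom0.
move=> a x y /[!inE] -[[x0 _ <-] [x1 _ e1]] [[y0 _ <-] [y1 _ f1]].
split; [exists (a *: x0 + y0)|exists (a *: x1 + y1)] => //.
  by rewrite (lhomD hom0) (lhomZ hom0).
by rewrite (lhomD hom1) (lhomZ hom1) e1 f1.
Qed.

Fact delta_meet :
  {in [in delta_set] &, forall x y, x `^` y \in [in delta_set]}.
Proof.
move=> x y /[!inE] -[[x0 _ <-] [x1 _ e1]] [[y0 _ <-] [y1 _ f1]].
split; [exists (x0 `^` y0)|exists (x1 `^` y1)] => //.
  by rewrite (lhomI hom0).
by rewrite (lhomI hom1) e1 f1.
Qed.

Fact delta_join :
  {in [in delta_set] &, forall x y, x `v` y \in [in delta_set]}.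
Proof.
move=> x y /[!inE] -[[x0 _ <-] [x1 _ e1]] [[y0 _ <-] [y1 _ f1]].
split; [exists (x0 `v` y0)|exists (x1 `v` y1)] => //.
  by rewrite (lhomU hom0).
by rewrite (lhomU hom1) e1 f1.
Qed.

Fact sigma_submod : submod_closed [in sigma_set].
Proof.
split.
  by rewrite inE; exists (0, 0) => //=; rewrite (lhom0 hom0) (lhom0 hom1) addr0.
move=> a x y /[!inE] -[[x0 x1] _ <-] [[y0 y1] _ <-].
exists (a *: x0 + y0, a *: x1 + y1) => //=.
by rewrite (lhomD hom0) (lhomD hom1) (lhomZ hom0) (lhomZ hom1) scalerDr addrACA.
Qed.

(* Riesz decomposition: Sigma is a sublattice because both embeddings are
   interval preserving. *)
Fact sigma_pos x : sigma_set x -> sigma_set (x `v` 0).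
Proof.
move=> [[x0 x1] _ /= <-{x}].
set P := _ `v` 0; set A := emb0 (x0 `v` 0); set B := emb1 (x1 `v` 0).
have P_ge0 : 0 <= P by exact: vler_joinr.
have A_ge0 : 0 <= A by rewrite /A (lhomU hom0) (lhom0 hom0) vler_joinr.
have B_ge0 : 0 <= B by rewrite /B (lhomU hom1) (lhom0 hom1) vler_joinr.
have PAB : P <= A + B.
  rewrite vjoin_le; apply/andP; split; last by rewrite -[0]addr0 vlerD.
  by rewrite vlerD // /A /B ?(lhomU hom0) ?(lhomU hom1) vler_joinl.
have [_ ip0 _ _] := emb0P C; have [_ ip1 _ _] := emb1P C.
have [u _ uE] : (@emb0 R C @` [set y | 0 <= y <= x0 `v` 0]) (P `^` A).
  by rewrite ip0 ?vler_joinr//= vmeet_ge P_ge0 A_ge0 vmeet_ler.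
have [v _ vE] : (@emb1 R C @` [set y | 0 <= y <= x1 `v` 0]) (P - P `^` A).
  rewrite ip1 ?vler_joinr//= vsubr_ge0 vmeet_lel /= -/B.
  by rewrite vlerBlDr addrC -vlerBlDr vmeet_ge !vlerBlDr PAB andbT -{1}[P]addr0
    vlerD2l B_ge0.
by exists (u, v) => //=; rewrite uE vE addrC subrK.
Qed.

Fact sigma_join :
  {in [in sigma_set] &, forall x y, x `v` y \in [in sigma_set]}.
Proof.
have [_ sub] := sigma_submod.
move=> x y xS yS; rewrite vjoin_pos -[x]scale1r addrC -[_ `v` 0]scale1r.
rewrite addrC; apply: (sub) => //; rewrite !scale1r inE; apply: sigma_pos.
by rewrite -in_setE addrC -scaleN1r; exact: (sub).
Qed.

Fact sigma_meet :
  {in [in sigma_set] &, forall x y, x `^` y \in [in sigma_set]}.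
Proof.
have [_ sub] := sigma_submod.
move=> x y xS yS; rewrite vmeet_pos addrC -scaleN1r.
apply: (sub) => //; rewrite inE; apply: sigma_pos.
by rewrite -in_setE addrC -scaleN1r; exact: (sub).
Qed.

Definition Delta := sub_vlattice (VSublattice delta_submod delta_meet delta_join).

Definition Sigma := sub_vlattice (VSublattice sigma_submod sigma_meet sigma_join).

HB.instance Definition _ := VectorLattice.on Delta.
HB.instance Definition _ := VectorLattice.on Sigma.

(* [xget 0] is used here only to invert the injections emb0 and emb1. *)
Definition delta_norm (x : Delta) : R :=
  Num.max (qnorm (xget 0 [set x0 | emb0 x0 = val x]))
          (qnorm (xget 0 [set x1 | emb1 x1 = val x])).

Definition decompositions (x : Sigma) : set (space0 C * space1 C) :=
  [set z | emb0 z.1 + emb1 z.2 = val x].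

Definition sigma_norm (x : Sigma) : R :=
  inf [set qnorm z.1 + qnorm z.2 | z in decompositions x].

Definition Kfun (t : R) (x : Sigma) : R :=
  inf [set qnorm z.1 + t * qnorm z.2 | z in decompositions x].

End DeltaSigma.

Record intermediate (R : realType) (C : qb_couple R)
    (X : qBanachLatticeType R) := Intermediate {
  delta_incl : Delta C -> X ;
  sigma_incl : X -> Sigma C ;
  sigma_incl_inj : injective sigma_incl ;
  incl_compat : forall x, val (sigma_incl (delta_incl x)) = val x ;
  delta_incl_hom : lattice_homomorphism delta_incl ;
  delta_incl_interval : interval_preserving delta_incl ;
  delta_incl_cont : forall x,
    delta_incl @ qnbhs (@delta_norm R C) x --> qnbhs qnorm (delta_incl x) ;
  sigma_incl_hom : lattice_homomorphism sigma_incl ;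
  sigma_incl_interval : interval_preserving sigma_incl ;
  sigma_incl_cont : forall x,
    sigma_incl @ qnbhs qnorm x --> qnbhs (@sigma_norm R C) (sigma_incl x)
}.

Definition p_convex_couple (R : realType) (p : R) (C : qb_couple R) :=
  pq_convex p p (space0 C) /\ pq_convex p p (space1 C).

Section Monotonicity.
Context {R : realType} {C : qb_couple R} {X : qBanachLatticeType R}.
Variable I : intermediate C X.

Definition K_monotone :=
  forall (x : X) (y : Sigma C),
    (forall t : R, 0 < t -> Kfun t y <= Kfun t (sigma_incl I x)) ->
    exists y' : X, sigma_incl I y' = y.

(* The right-hand sides are sums in [0, +oo], hence the extended reals. *)
Definition Kpq_monotone (p q : R) :=
  exists2 c : R, 0 < c & forall (x_ : nat -> X) (x : Sigma C),
    (\sum_(0 <= i <oo) (qnorm (x_ i) `^ q)%:E < +oo)%E ->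
    (forall t : R, 0 < t ->
      ((Kfun t x)%:E <=
        (\sum_(0 <= i <oo) (Kfun t (sigma_incl I (x_ i)) `^ p)%:E)
          `^ p^-1)%E) ->
    exists2 x' : X, sigma_incl I x' = x &
      ((qnorm x')%:E <=
        c%:E * (\sum_(0 <= i <oo) (qnorm (x_ i) `^ q)%:E) `^ q^-1)%E.

Definition finitely_Kpq_monotone (p q : R) :=
  exists2 c : R, 0 < c & forall (n : nat) (x_ : 'I_n -> X) (x : Sigma C),
    (forall t : R, 0 < t ->
      Kfun t x <=
        (\sum_(i < n) Kfun t (sigma_incl I (x_ i)) `^ p) `^ p^-1) ->
    exists2 x' : X, sigma_incl I x' = x &
      qnorm x' <= c * (\sum_(i < n) qnorm (x_ i) `^ q) `^ q^-1.

End Monotonicity.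

(* Main.v *)
Require Import Defs.
From mathcomp Require Import all_boot all_order all_algebra.
From mathcomp Require Import all_classical all_reals all_analysis.
From mathcomp Require Import ring lra.

(** Let [K t x] denote the K-functional.

    The implication from (c) to (a) is padding by zeros. For (a) implies (b),
    families of length one give K-monotonicity. For the convexity of [X], let [y]
    be the lp sum of [x_1, .., x_n] in [X]. If each [x_k] splits as [a_k + b_k],
    then in the ambient lattice [y] is at most a constant times the sum of the lp
    sums of the [a_k] and of the [b_k], and these are bounded in the two spaces of
    the couple by [p]-convexity; near-optimal splittings give
    [K t y `^ p <= c * \sum_k K t (x_k) `^ p], to which (a) applies
    ([Kfunc_lp_sum], [finitely_Kpq_monotone_convex]).

    The substance is that (b) implies (c). If [K t x] is at most the lp sum of the
    [K t (x_i)], one looks for positive [e_i] with [K t (e_i) <= C * K t (x_i)] and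
    [vabs x] below the lp sum of the [e_i] ([K_divisibility]). Granting this,
    K-monotonicity, which automatically holds with a constant
    ([K_monotone_constant]), puts [e_i] into [X] with norm at most [C * qnorm x_i];
    (p,q)-convexity and completeness give their lp sum in [X]
    ([infinite_lp_sum]); and [x] belongs to [X] because [X] is an ideal
    ([emb_solid]).

    K-divisibility is proved as follows ([divide_half]). Split [x] nearly
    optimally at the scales [t = 2 ^ k]. Along a sparse sequence of scales, at
    which [F t], the sum of the [K t (x_i) `^ p], triples and [F t / t `^ p] drops
    to a third, the differences [u_j] of consecutive splittings satisfy
    [K t (u_j) `^ p <= C * F t_j * min (1, t / t_j) `^ p]. The index [i] receives
    [lam_ij `^ (1/p)] times [u_j], where [lam_ij] is proportional to what is left
    of [K t_j (x_i) `^ p] after subtraction of its values, suitably rescaled, at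
    the two neighbouring scales. Sparseness ensures that at least a fixed
    proportion of [F t_j] is left, so that the [lam_ij] can be made to add up to
    at least one over [i]; and the subtractions make the sums over [j] telescope
    ([point_weight_le], [piece_weights]), so that [i] receives an element [e_i]
    with [K t (e_i) <= C * K t (x_i)]. Since Minkowski's inequality is reversed for
    [p <= 1], the lp sum of these shares dominates the sum of the [u_j]
    ([sum_le_lp_sum]).

    All comparisons of lp sums rest on one transfer principle: an inequality
    between continuous homogeneous real functions holds in every Archimedean
    vector lattice ([calculus_ge0]). For lattice-linear functions this is a theorem of the
    alternative for linear forms ([latlin_ge0], [linear_alternative]); continuous
    homogeneous functions are uniform limits of these ([homogeneous_approx]),
    which also provides the functional calculus of a quasi-Banach lattice
    ([hom_calculusP]). *)

Set Implicit Arguments.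
Unset Strict Implicit.
Unset Printing Implicit Defensive.

Import Order.TTheory GRing.Theory Num.Theory.
Import numFieldNormedType.Exports.
Local Open Scope classical_set_scope.
Local Open Scope ring_scope.

(** * Vector lattices *)

Section VectorLattice.
Context {R : realType} {V : vectorLatticeType R}.
Implicit Types (x y z w : V) (a b : R).

Lemma vjoin_lub x y z : x <= z -> y <= z -> x `v` y <= z.
Proof. by move=> xz yz; rewrite vjoin_le xz. Qed.

Lemma vmeet_glb x y z : z <= x -> z <= y -> z <= x `^` y.
Proof. by move=> xz yz; rewrite vmeet_ge xz. Qed.

Lemma vlerN x y : (- x <= - y) = (y <= x).
Proof. by rewrite -(vsubr_ge0 y) -(vsubr_ge0 (- x)) opprK addrC. Qed.

Lemma vlerNl x y : (- x <= y) = (- y <= x).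
Proof. by rewrite -{1}[y]opprK vlerN. Qed.

Lemma vjoinC x y : x `v` y = y `v` x.
Proof.
by apply/le_anti/andP; split; apply: vjoin_lub;
  rewrite ?vler_joinl ?vler_joinr.
Qed.

Lemma vjoin_idl x y : y <= x -> x `v` y = x.
Proof.
by move=> yx; apply/le_anti; rewrite vler_joinl andbT vjoin_lub.
Qed.

Lemma vjoin_idr x y : x <= y -> x `v` y = y.
Proof. by move=> xy; rewrite vjoinC vjoin_idl. Qed.

Lemma vjoin_mono x y z w : x <= z -> y <= w -> x `v` y <= z `v` w.
Proof.
move=> xz yw; apply: vjoin_lub.
  exact: le_trans xz (vler_joinl _ _).
exact: le_trans yw (vler_joinr _ _).
Qed.

Lemma vjoinDr x y z : (x `v` y) + z = (x + z) `v` (y + z).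
Proof.
apply/le_anti/andP; split; last first.
  by apply: vjoin_lub; rewrite vlerD2rE ?vler_joinl ?vler_joinr.
by rewrite -vlerBrDr; apply: vjoin_lub; rewrite vlerBrDr
  ?vler_joinl ?vler_joinr.
Qed.

Lemma vmeetDr x y z : (x `^` y) + z = (x + z) `^` (y + z).
Proof.
apply/le_anti/andP; split.
  by apply: vmeet_glb; rewrite vlerD2rE ?vmeet_lel ?vmeet_ler.
by rewrite -vlerBlDr; apply: vmeet_glb; rewrite vlerBlDr
  ?vmeet_lel ?vmeet_ler.
Qed.

Lemma vmeetN x y : x `^` y = - ((- x) `v` (- y)).
Proof.
apply/le_anti/andP; split.
  rewrite -[x in x <= _]opprK vlerN; apply: vjoin_lub; rewrite vlerN.
    exact: vmeet_lel.
  exact: vmeet_ler.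
apply: vmeet_glb; rewrite vlerNl; first exact: vler_joinl.
exact: vler_joinr.
Qed.

Lemma vscale_ge0 a x : 0 <= a -> 0 <= x -> 0 <= a *: x.
Proof. by move=> a0 x0; rewrite -(scaler0 _ a) vlerZ. Qed.

Lemma vscale_le a b x : 0 <= x -> a <= b -> a *: x <= b *: x.
Proof.
by move=> x0 ab; rewrite -vsubr_ge0 -scalerBl vscale_ge0 // subr_ge0.
Qed.

Lemma vaddr_ge0 x y : 0 <= x -> 0 <= y -> 0 <= x + y.
Proof. by move=> x0 y0; rewrite -[0]addr0 vlerD. Qed.

Lemma vsum_ge0 (J : Type) (s : seq J) (P : pred J) (f : J -> V) :
  (forall j, P j -> 0 <= f j) -> 0 <= \sum_(j <- s | P j) f j.
Proof. by move=> f0; elim/big_rec: _ => // j z Pj z0; apply: vaddr_ge0 => //; exact: f0. Qed.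

Lemma vsum_le (J : Type) (s : seq J) (P : pred J) (f g : J -> V) :
  (forall j, P j -> f j <= g j) ->
  \sum_(j <- s | P j) f j <= \sum_(j <- s | P j) g j.
Proof.
by move=> fg; elim/big_rec2: _ => // j z w Pj zw; apply: vlerD => //; exact: fg.
Qed.

Lemma vjoinZ a x y : 0 <= a -> a *: (x `v` y) = (a *: x) `v` (a *: y).
Proof.
rewrite le_eqVlt => /predU1P[<-|a0]; first by rewrite !scale0r vjoin_idl.
apply/le_anti/andP; split; last first.
  by apply: vjoin_lub; apply: vlerZ (ltW a0) _; rewrite ?vler_joinl ?vler_joinr.
have aK z : a *: (a^-1 *: z) = z by rewrite scalerA divff ?scale1r ?gt_eqF.
have ai0 : 0 <= a^-1 by rewrite invr_ge0 ltW.
rewrite -[leRHS]aK; apply: vlerZ (ltW a0) _; apply: vjoin_lub.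
  rewrite -[leLHS]scale1r -(mulVf (lt0r_neq0 a0)) -scalerA.
  by apply: vlerZ => //; exact: vler_joinl.
rewrite -[leLHS]scale1r -(mulVf (lt0r_neq0 a0)) -scalerA.
by apply: vlerZ => //; exact: vler_joinr.
Qed.

(** Distributivity comes from translation invariance: [u `v` z - u] is the
    positive part of [z - u], which grows when [u] decreases to the meet. *)
Lemma vmeet_joinDl x y z : (x `^` y) `v` z = (x `v` z) `^` (y `v` z).
Proof.
apply/le_anti/andP; split.
  by apply: vmeet_glb; apply: vjoin_mono; rewrite ?vmeet_lel ?vmeet_ler.
set m := x `^` y; set t := _ `^` _.
have key u : m <= u -> u `v` z <= u - m + (m `v` z).
  move=> mu; rewrite (vjoin_pos u) (vjoin_pos m) addrA subrK vlerD2l.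
  by apply: vjoin_mono => //; rewrite vlerD2l vlerN.
have tm u : m <= u -> t <= u `v` z -> t + m - (m `v` z) <= u.
  move=> mu tu; rewrite vlerBlDr; apply: le_trans (vlerD2r _ _ m tu) _.
  rewrite -vlerBrDr; apply: le_trans (key _ mu) _.
  by rewrite [leRHS]addrAC.
have : t + m - (m `v` z) <= m.
  by apply: vmeet_glb; apply: tm; rewrite ?vmeet_lel ?vmeet_ler.
by rewrite vlerBlDr addrC vlerD2l.
Qed.

Lemma vabs_le x y : vabs x <= y <-> - y <= x /\ x <= y.
Proof.
rewrite /vabs vjoin_le; split=> [/andP[xy nxy]|[nyx xy]].
  by rewrite vlerNl.
by rewrite xy vlerNl.
Qed.

Lemma vabs_leP x y : x <= y -> - x <= y -> vabs x <= y.
Proof. by move=> xy nxy; apply/vabs_le; rewrite vlerNl. Qed.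

Lemma vle_abs x : x <= vabs x.
Proof. exact: vler_joinl. Qed.

Lemma vleN_abs x : - x <= vabs x.
Proof. exact: vler_joinr. Qed.

Lemma vabsN x : vabs (- x) = vabs x.
Proof. by rewrite /vabs opprK vjoinC. Qed.

Lemma vabs_ge0 x : 0 <= vabs x.
Proof.
have h : 0 <= vabs x + vabs x.
  by rewrite -(subrr x) vlerD ?vle_abs ?vleN_abs.
have : 0 <= 2^-1 *: (vabs x + vabs x) by apply: vscale_ge0.
by rewrite -mulr2n -(scaler_nat 2 (vabs x)) scalerA mulVf ?pnatr_eq0 // scale1r.
Qed.

Lemma ger0_vabs x : 0 <= x -> vabs x = x.
Proof.
move=> x0; apply: vjoin_idl; apply: (le_trans _ x0).
by rewrite vlerNl oppr0.
Qed.

Lemma vabs_id x : vabs (vabs x) = vabs x.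
Proof. exact/ger0_vabs/vabs_ge0. Qed.

Lemma vabsD x y : vabs (x + y) <= vabs x + vabs y.
Proof.
apply: vabs_leP; first by rewrite vlerD ?vle_abs.
by rewrite opprD vlerD ?vleN_abs.
Qed.

Lemma vabs0 : vabs (0 : V) = 0.
Proof. exact: ger0_vabs. Qed.

Lemma vabs_sum (J : Type) (s : seq J) (P : pred J) (f : J -> V) :
  vabs (\sum_(j <- s | P j) f j) <= \sum_(j <- s | P j) vabs (f j).
Proof.
elim/big_rec2: _ => [|j z w _ zw]; first by rewrite vabs0.
by apply: le_trans (vabsD _ _) _; rewrite vlerD2l.
Qed.

Lemma vabsZ a x : vabs (a *: x) = `|a| *: vabs x.
Proof.
wlog a0 : a x / 0 <= a.
  move=> h; have [/h//|/ltW an] := leP 0 a.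
  by rewrite -[a]opprK normrN scaleNr vabsN h // oppr_ge0.
by rewrite ger0_norm // /vabs -scalerN vjoinZ.
Qed.

Lemma vabs_join x y z w :
  vabs ((x `v` y) - (z `v` w)) <= vabs (x - z) + vabs (y - w).
Proof.
have key (a b c d : V) : (a `v` b) - (c `v` d) <= vabs (a - c) + vabs (b - d).
  rewrite vlerBlDr; apply: vjoin_lub.
    apply: (@le_trans _ _ (vabs (a - c) + c)).
      by rewrite -vlerBlDr vle_abs.
    by rewrite -addrA vlerD2l -[leLHS]add0r vlerD ?vabs_ge0 ?vler_joinl.
  apply: (@le_trans _ _ (vabs (b - d) + d)).
    by rewrite -vlerBlDr vle_abs.
  by rewrite -addrA addrCA vlerD2l -[leLHS]add0r vlerD ?vabs_ge0 ?vler_joinr.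
apply: vabs_leP; first exact: key.
by rewrite opprB -(vabsN (x - z)) -(vabsN (y - w)) !opprB key.
Qed.

Lemma vpos_sub x : x = (x `v` 0) - ((- x) `v` 0).
Proof.
rewrite (vjoin_pos x 0) sub0r -addrA subrr addr0 //.
Qed.

Lemma vpos_le_abs x : x `v` 0 <= vabs x.
Proof. by apply: vjoin_lub; rewrite ?vle_abs ?vabs_ge0. Qed.

Lemma vabs_dist_pos x y z : 0 <= x -> x <= z -> 0 <= y -> y <= z ->
  vabs (x - y) <= z.
Proof.
move=> x0 xz y0 yz; apply: vabs_leP.
  by rewrite vlerBlDr -[leLHS]addr0 vlerD.
by rewrite opprB vlerBlDr -[leLHS]addr0 vlerD.
Qed.

Definition archimedean_lattice :=
  forall x y, (forall e : R, 0 < e -> x <= e *: y) -> x <= 0.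

End VectorLattice.
Arguments archimedean_lattice {R} V.

Section LatticeHomomorphism.
Context {R : realType} {V W : vectorLatticeType R} {f : V -> W}.
Hypothesis fhom : lattice_homomorphism f.

Lemma lhomN x : f (- x) = - f x.
Proof. by rewrite -scaleN1r (lhomZ fhom) scaleN1r. Qed.

Lemma lhomB x y : f (x - y) = f x - f y.
Proof. by rewrite (lhomD fhom) lhomN. Qed.

Lemma lhom_le x y : x <= y -> f x <= f y.
Proof. by move=> xy; rewrite -(vjoin_idr xy) (lhomU fhom) vler_joinl. Qed.

Lemma lhom_ge0 x : 0 <= x -> 0 <= f x.
Proof. by move=> /lhom_le; rewrite (lhom0 fhom). Qed.

Lemma lhom_abs x : f (vabs x) = vabs (f x).
Proof. by rewrite /vabs (lhomU fhom) lhomN. Qed.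

Lemma lhom_sum (J : Type) (s : seq J) (P : pred J) (g : J -> V) :
  f (\sum_(j <- s | P j) g j) = \sum_(j <- s | P j) f (g j).
Proof.
by elim/big_rec2: _ => [|j z w _ <-]; rewrite ?(lhom0 fhom) ?(lhomD fhom).
Qed.

Lemma lhom_le_inj x y : injective f -> f x <= f y -> x <= y.
Proof.
move=> finj fxy; suff <- : x `v` y = y by exact: vler_joinl.
by apply: finj; rewrite (lhomU fhom) vjoin_idr.
Qed.

End LatticeHomomorphism.

(** * Positivity of lattice-linear expressions *)

Section Elimination.
Context {R : realType}.

Lemma real_between (ls us : seq R) :
  (forall l u, l \in ls -> u \in us -> l < u) ->
  exists z, (forall l, l \in ls -> l < z) /\ (forall u, u \in us -> z < u).
Proof.
have below (s : seq R) : exists z, forall u, u \in s -> z < u.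
  elim: s => [|u s [z zs]]; first by exists 0.
  exists (Num.min z (u - 1)) => w; rewrite inE => /predU1P[->|/zs zw].
    by rewrite gt_min; apply/orP; right; lra.
  by rewrite gt_min zw.
have squeeze l (s : seq R) : (forall u, u \in s -> l < u) ->
    exists2 z, l < z & forall u, u \in s -> z < u.
  elim: s => [|u s IH] lus; first by exists (l + 1); rewrite ?ltrDl.
  have [w ws|z lz zs] := IH; first by apply: lus; rewrite inE ws orbT.
  have lu : l < u by apply: lus; rewrite inE eqxx.
  exists (Num.min z ((l + u) / 2)); first by rewrite lt_min lz /=; lra.
  move=> w; rewrite inE => /predU1P[->|/zs zw]; last by rewrite gt_min zw.
  by rewrite gt_min; apply/orP; right; lra.
elim: ls => [|l ls IH] lus; first by have [z zs] := below us; exists z.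
have [l' u l'ls uus|z [lz zu]] := IH.
  by apply: lus; rewrite // inE l'ls orbT.
have [u uus|z' lz' zu'] := squeeze l us.
  by apply: lus; rewrite // inE eqxx.
have [zz'|z'z] := leP z z'.
  exists z'; split=> // l'; rewrite inE => /predU1P[->//|/lz].
  by move=> /lt_le_trans; apply.
exists z; split=> // l'; rewrite inE => /predU1P[->|/lz//].
exact: lt_trans lz' z'z.
Qed.

Context {T : finType} {V : vectorLatticeType R}.

Definition lin_form (a : {ffun T -> R}) (v : T -> R) : R := \sum_t a t * v t.
Definition lin_comb (x : T -> V) (a : {ffun T -> R}) : V := \sum_t a t *: x t.

Let lin_formD (a b : {ffun T -> R}) (r s : R) v :
  lin_form [ffun t => r * a t + s * b t] v = r * lin_form a v + s * lin_form b v.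
Proof.
rewrite /lin_form !mulr_sumr -big_split /=; apply: eq_bigr => t _.
by rewrite ffunE mulrDl !mulrA.
Qed.

Let lin_combD (x : T -> V) (a b : {ffun T -> R}) (r s : R) :
  lin_comb x [ffun t => r * a t + s * b t] = r *: lin_comb x a + s *: lin_comb x b.
Proof.
rewrite /lin_comb !scaler_sumr -big_split /=; apply: eq_bigr => t _.
by rewrite ffunE scalerDl !scalerA.
Qed.

(** Gordan's alternative, in the form in which it passes to vector lattices,
    by Fourier-Motzkin elimination: each variable is removed by replacing two
    forms with coefficients of opposite signs by the convex combination in
    which it cancels. A convex combination stays below any common upper bound
    of the forms, so no positivity is lost in [V]. *)
Lemma linear_alternative (x : T -> V) (L : seq {ffun T -> R}) (y : V) :
  (forall v, exists2 a : {ffun T -> R}, a \in L & 0 <= lin_form a v) ->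
  (forall a : {ffun T -> R}, a \in L -> lin_comb x a <= y) -> 0 <= y.
Proof.
suff main (s : seq T) : forall L : seq {ffun T -> R},
    (forall (a : {ffun T -> R}) t, a \in L -> t \notin s -> a t = 0) ->
    (forall v, exists2 a : {ffun T -> R}, a \in L & 0 <= lin_form a v) ->
    (forall a : {ffun T -> R}, a \in L -> lin_comb x a <= y) -> 0 <= y.
  by apply: (main (enum T)) => a t _; rewrite mem_enum.
elim: s => {L} [|t0 s IH] L supp Lge Ly.
  have [a aL _] := Lge (fun=> 0).
  suff <- : lin_comb x a = 0 by exact: Ly.
  by rewrite /lin_comb big1 // => t _; rewrite (supp a) // scale0r.
pose comb (a b : {ffun T -> R}) : {ffun T -> R} :=
  [ffun t => (- b t0 / (a t0 - b t0)) * a t + (a t0 / (a t0 - b t0)) * b t].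
pose P := [seq a : {ffun T -> R} <- L | 0 < a t0]; pose N := [seq a : {ffun T -> R} <- L | a t0 < 0].
pose Z := [seq a : {ffun T -> R} <- L | a t0 == 0].
apply: (IH (Z ++ [seq comb a b | a <- P, b <- N])).
- move=> a t; rewrite mem_cat => /orP[|/allpairsP[[b c]/=]].
    rewrite mem_filter => /andP[/eqP at0 aL] ts.
    by have [->//|tt0] := eqVneq t t0; rewrite (supp a) // inE negb_or tt0.
  rewrite !mem_filter => -[/andP[b0 bL] /andP[c0 cL] ->] ts; rewrite ffunE.
  have [->|tt0] := eqVneq t t0; last first.
    by rewrite (supp b t) ?(supp c t) ?inE ?negb_or ?tt0 // !mulr0 addr0.
  by field; lra.
- move=> v; apply: contrapT => /forall2NP noge.
  have Zlt (a : {ffun T -> R}) : a \in L -> a t0 = 0 -> lin_form a v < 0.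
    move=> aL /eqP at0; case: (noge a) => [|/negP]; last by rewrite -ltNge.
    by rewrite mem_cat mem_filter at0 aL.
  have PN (a b : {ffun T -> R}) : a \in P -> b \in N -> lin_form (comb a b) v < 0.
    move=> aP bN; case: (noge (comb a b)) => [|/negP]; last by rewrite -ltNge.
    by case; rewrite mem_cat; apply/orP; right; apply/allpairsP; exists (a, b).
  have [|z [lz zu]] := @real_between [seq - lin_form b v / b t0 | b : {ffun T -> R} <- N]
      [seq - lin_form a v / a t0 | a : {ffun T -> R} <- P].
    move=> l u /mapP[b bN ->] /mapP[a aP ->].
    have := PN a b aP bN; rewrite lin_formD.
    move: aP bN; rewrite !mem_filter => /andP[a0 _] /andP[b0 _] h.
    have ab0 : 0 < a t0 - b t0 by lra.
    have {}h : - b t0 * lin_form a v + a t0 * lin_form b v < 0.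
      suff -> : - b t0 * lin_form a v + a t0 * lin_form b v =
        (- b t0 / (a t0 - b t0) * lin_form a v +
         a t0 / (a t0 - b t0) * lin_form b v) * (a t0 - b t0).
        by rewrite pmulr_llt0.
      by field; lra.
    rewrite -subr_gt0.
    have -> : - lin_form a v / a t0 - - lin_form b v / b t0 =
      (- b t0 * lin_form a v + a t0 * lin_form b v) / (a t0 * b t0).
      by field; lra.
    by rewrite nmulr_lgt0 // invr_lt0 pmulr_rlt0.
  pose w t := if t == t0 then v t + z else v t.
  have lw (a : {ffun T -> R}) : lin_form a w = lin_form a v + a t0 * z.
    rewrite /lin_form (bigD1 t0) //= [in RHS](bigD1 t0) //= /w eqxx mulrDr.
    rewrite -!addrA; congr (_ + _); rewrite addrC; congr (_ + _).
    by apply: eq_bigr => t /negPf ->.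
  have [a aL] := Lge w; rewrite lw; apply/negP; rewrite -ltNge.
  have [a0|a0|/esym a0] := ltgtP 0 (a t0).
  - have : z < - lin_form a v / a t0.
      by apply: zu; apply/mapP; exists a; rewrite // mem_filter a0.
    by rewrite ltr_pdivlMr //; lra.
  - have : - lin_form a v / a t0 < z.
      by apply: lz; apply/mapP; exists a; rewrite // mem_filter a0.
    by rewrite ltr_ndivrMr //; lra.
  - by rewrite a0 mul0r addr0 Zlt.
- move=> a; rewrite mem_cat => /orP[|/allpairsP[[b c]/=]].
    by rewrite mem_filter => /andP[_ /Ly].
  rewrite !mem_filter => -[/andP[b0 bL] /andP[c0 cL] ->]; rewrite lin_combD.
  set r := - c t0 / _; set q := b t0 / _.
  have bc : 0 < b t0 - c t0 by lra.
  have -> : y = r *: y + q *: y.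
    rewrite -scalerDl -mulrDl [- _ + _]addrC divff ?gt_eqF //.
    by rewrite scale1r.
  apply: vlerD; apply: vlerZ; rewrite ?Ly //.
    by rewrite divr_ge0 //; lra.
  by rewrite divr_ge0 //; lra.
Qed.

End Elimination.

Section LatticeLinear.
Context {R : realType}.

Section Definitions.
Context {T : Type} {V : vectorLatticeType R}.

(** The graph of the evaluation of lattice-linear expressions at [x], with the
    real function and the lattice element that an expression denotes built in
    parallel. That the element depends on the function only is a consequence of
    [latlin_ge0]. *)
Inductive lattice_linear (x : T -> V) : ((T -> R) -> R) -> V -> Prop :=
| LatLin0 : lattice_linear x (fun=> 0) 0
| LatLinVar t : lattice_linear x (fun v => v t) (x t)
| LatLinAdd (a : R) f g y z : lattice_linear x f y -> lattice_linear x g z ->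
    lattice_linear x (fun v => a * f v + g v) (a *: y + z)
| LatLinMax f g y z : lattice_linear x f y -> lattice_linear x g z ->
    lattice_linear x (fun v => Num.max (f v) (g v)) (y `v` z).

End Definitions.

Section Closure.
Context {T : Type} {V : vectorLatticeType R} {x : T -> V}.
Implicit Types (f g : (T -> R) -> R) (y z : V).
Local Notation LL := (lattice_linear x).

Lemma latlin_eq f g y z : f =1 g -> y = z -> LL f y -> LL g z.
Proof. by move=> /funext -> ->. Qed.

Lemma latlinD f g y z : LL f y -> LL g z -> LL (fun v => f v + g v) (y + z).
Proof.
by move=> Lf Lg; apply: latlin_eq (LatLinAdd 1 Lf Lg) => [v|];
  rewrite ?mul1r ?scale1r.
Qed.

Lemma latlinZ a f y : LL f y -> LL (fun v => a * f v) (a *: y).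
Proof.
by move=> Lf; apply: latlin_eq (LatLinAdd a Lf (LatLin0 x)) => [v|];
  rewrite addr0.
Qed.

Lemma latlinN f y : LL f y -> LL (fun v => - f v) (- y).
Proof.
by move=> Lf; apply: latlin_eq (latlinZ (-1) Lf) => [v|];
  rewrite ?mulN1r ?scaleN1r.
Qed.

Lemma latlinB f g y z : LL f y -> LL g z -> LL (fun v => f v - g v) (y - z).
Proof. by move=> Lf Lg; apply: latlinD => //; exact: latlinN. Qed.

Lemma latlin_abs f y : LL f y -> LL (fun v => `|f v|) (vabs y).
Proof.
move=> Lf; apply: latlin_eq (LatLinMax Lf (latlinN Lf)) => // v.
rewrite /Num.max; case: ltP => h.
  by rewrite ltr0_norm //; lra.
by rewrite ger0_norm //; lra.
Qed.

Lemma latlin_min f g y z : LL f y -> LL g z ->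
  LL (fun v => Num.min (f v) (g v)) (y `^` z).
Proof.
move=> Lf Lg.
apply: latlin_eq (latlinN (LatLinMax (latlinN Lf) (latlinN Lg))) => [v|].
  by rewrite oppr_max !opprK.
by rewrite vmeetN.
Qed.

Lemma latlin_sum (J : Type) (s : seq J) (P : pred J)
    (f : J -> (T -> R) -> R) (y : J -> V) : (forall j, LL (f j) (y j)) ->
  LL (fun v => \sum_(j <- s | P j) f j v) (\sum_(j <- s | P j) y j).
Proof.
move=> Lf; elim: s => [|j s IH].
  by rewrite big_nil; apply: latlin_eq (LatLin0 x) => // v; rewrite big_nil.
rewrite big_cons; case: ifP => Pj; last first.
  by apply: latlin_eq IH => // v; rewrite big_cons Pj.
by apply: latlin_eq (latlinD (Lf j) IH) => // v; rewrite big_cons Pj.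
Qed.

End Closure.

Lemma latlin_subst (S T : Type) (V : vectorLatticeType R) (x : T -> V)
    (y : S -> V) (h : T -> (S -> R) -> R) f z :
  (forall t, lattice_linear y (h t) (x t)) -> lattice_linear x f z ->
  lattice_linear y (fun v => f (fun t => h t v)) z.
Proof.
move=> hx; elim=> [|t|a f1 f2 z1 z2 _ IH1 _ IH2|f1 f2 z1 z2 _ IH1 _ IH2].
- exact: LatLin0.
- exact: hx.
- exact: LatLinAdd.
- exact: LatLinMax.
Qed.

Lemma latlin_hom (T : Type) (V W : vectorLatticeType R) (phi : V -> W)
    (x : T -> V) f z : lattice_homomorphism phi ->
  lattice_linear x f z -> lattice_linear (phi \o x) f (phi z).
Proof.
move=> hphi; elim=> [|t|a f1 f2 z1 z2 _ IH1 _ IH2|f1 f2 z1 z2 _ IH1 _ IH2].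
- by rewrite (lhom0 hphi); exact: LatLin0.
- exact: (LatLinVar (phi \o x)).
- by rewrite (lhomD hphi) (lhomZ hphi); exact: LatLinAdd.
- by rewrite (lhomU hphi); exact: LatLinMax.
Qed.

Section NormalForm.
Context {T : finType} {V : vectorLatticeType R}.
Variable x : T -> V.

Inductive join_of_linear : ((T -> R) -> R) -> V -> Prop :=
| JoinLin a : join_of_linear (lin_form a) (lin_comb x a)
| JoinMax f g y z : join_of_linear f y -> join_of_linear g z ->
    join_of_linear (fun v => Num.max (f v) (g v)) (y `v` z).

Inductive meet_of_joins : ((T -> R) -> R) -> V -> Prop :=
| MeetJoin f y : join_of_linear f y -> meet_of_joins f y
| MeetMin f g y z : meet_of_joins f y -> meet_of_joins g z ->
    meet_of_joins (fun v => Num.min (f v) (g v)) (y `^` z).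

Local Notation JL := join_of_linear.
Local Notation MJ := meet_of_joins.

Let JL_eq f g y z : f =1 g -> y = z -> JL f y -> JL g z.
Proof. by move=> /funext -> ->. Qed.

Let MJ_eq f g y z : f =1 g -> y = z -> MJ f y -> MJ g z.
Proof. by move=> /funext -> ->. Qed.

Let JLD f g y z : JL f y -> JL g z -> JL (fun v => f v + g v) (y + z).
Proof.
move=> Jf; elim: Jf g z => [a|f1 f2 y1 y2 _ IH1 _ IH2] g z Jg; last first.
  apply: JL_eq (JoinMax (IH1 _ _ Jg) (IH2 _ _ Jg)) => [v|].
    by rewrite addr_maxl.
  by rewrite vjoinDr.
elim: Jg => [b|g1 g2 z1 z2 _ IH1 _ IH2].
  apply: JL_eq (JoinLin [ffun t => a t + b t]) => [v|].
    rewrite /lin_form -big_split; apply: eq_bigr => t _.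
    by rewrite ffunE mulrDl.
  rewrite /lin_comb -big_split; apply: eq_bigr => t _.
  by rewrite ffunE scalerDl.
apply: JL_eq (JoinMax IH1 IH2) => [v|]; first by rewrite addr_maxr.
by rewrite [RHS]addrC vjoinDr !(addrC _ (lin_comb _ _)).
Qed.

Let MJD f g y z : MJ f y -> MJ g z -> MJ (fun v => f v + g v) (y + z).
Proof.
move=> Mf; elim: Mf g z => [f1 y1 Jf|f1 f2 y1 y2 _ IH1 _ IH2] g z Mg; last first.
  apply: MJ_eq (MeetMin (IH1 _ _ Mg) (IH2 _ _ Mg)) => [v|].
    by rewrite addr_minl.
  by rewrite vmeetDr.
elim: Mg => [g1 z1 Jg|g1 g2 z1 z2 _ IH1 _ IH2].
  by apply: MeetJoin; exact: JLD.
apply: MJ_eq (MeetMin IH1 IH2) => [v|]; first by rewrite addr_minr.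
by rewrite [RHS]addrC vmeetDr !(addrC _ y1).
Qed.

Let MJ_max f g y z :
  MJ f y -> MJ g z -> MJ (fun v => Num.max (f v) (g v)) (y `v` z).
Proof.
move=> Mf; elim: Mf g z => [f1 y1 Jf|f1 f2 y1 y2 _ IH1 _ IH2] g z Mg; last first.
  apply: MJ_eq (MeetMin (IH1 _ _ Mg) (IH2 _ _ Mg)) => [v|].
    by rewrite max_minl.
  by rewrite vmeet_joinDl.
elim: Mg => [g1 z1 Jg|g1 g2 z1 z2 _ IH1 _ IH2].
  by apply: MeetJoin; exact: JoinMax.
apply: MJ_eq (MeetMin IH1 IH2) => [v|]; first by rewrite max_minr.
by rewrite [RHS]vjoinC vmeet_joinDl !(vjoinC _ y1).
Qed.

Let JLZ a f y : 0 <= a -> JL f y -> JL (fun v => a * f v) (a *: y).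
Proof.
move=> a0; elim=> [b|f1 f2 y1 y2 _ IH1 _ IH2].
  apply: JL_eq (JoinLin [ffun t => a * b t]) => [v|].
    by rewrite /lin_form mulr_sumr; apply: eq_bigr => t _; rewrite ffunE mulrA.
  rewrite /lin_comb scaler_sumr; apply: eq_bigr => t _.
  by rewrite ffunE scalerA.
apply: JL_eq (JoinMax IH1 IH2) => [v|]; first by rewrite maxr_pMr.
by rewrite vjoinZ.
Qed.

Let MJZ a f y : 0 <= a -> MJ f y -> MJ (fun v => a * f v) (a *: y).
Proof.
move=> a0; elim=> [f1 y1 J1|f1 f2 y1 y2 _ IH1 _ IH2].
  by apply: MeetJoin; exact: JLZ.
apply: MJ_eq (MeetMin IH1 IH2) => [v|]; first by rewrite minr_pMr.
by rewrite !vmeetN !scalerN vjoinZ // !scalerN.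
Qed.

Let MJN f y : MJ f y -> MJ (fun v => - f v) (- y).
Proof.
elim=> {f y} [f y|f g y z _ IH1 _ IH2]; last first.
  apply: MJ_eq (MJ_max IH1 IH2) => [v|]; first by rewrite oppr_min.
  by rewrite vmeetN opprK.
elim=> {f y} [a|f g y z _ IH1 _ IH2].
  apply: MeetJoin; apply: JL_eq (JoinLin [ffun t => - a t]) => [v|].
    by rewrite /lin_form -sumrN; apply: eq_bigr => t _; rewrite ffunE mulNr.
  by rewrite /lin_comb -sumrN; apply: eq_bigr => t _; rewrite ffunE scaleNr.
apply: MJ_eq (MeetMin IH1 IH2) => [v|]; first by rewrite oppr_max.
by rewrite vmeetN !opprK.
Qed.

(** By distributivity the meets of joins of linear forms are closed under sums,
    joins and changes of sign. *)
Lemma latlin_normal_form f y : lattice_linear x f y -> meet_of_joins f y.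
Proof.
elim=> [|t|a f1 f2 z1 z2 _ IH1 _ IH2|f1 f2 z1 z2 _ IH1 _ IH2].
- apply: MeetJoin; apply: JL_eq (JoinLin [ffun=> 0]) => [v|].
    by rewrite /lin_form big1 // => t _; rewrite ffunE mul0r.
  by rewrite /lin_comb big1 // => t _; rewrite ffunE scale0r.
- apply: MeetJoin; apply: JL_eq (JoinLin [ffun s => (s == t)%:R]) => [v|].
    rewrite /lin_form (bigD1 t) //= ffunE eqxx mul1r big1 ?addr0 // => s st.
    by rewrite ffunE (negPf st) mul0r.
  rewrite /lin_comb (bigD1 t) //= ffunE eqxx scale1r big1 ?addr0 // => s st.
  by rewrite ffunE (negPf st) scale0r.
- apply: MJD => //; have [a0|/ltW a0] := leP 0 a; first exact: MJZ.
  have an : 0 <= - a by rewrite oppr_ge0.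
  apply: MJ_eq (MJN (MJZ an IH1)) => [v|]; first by rewrite mulNr opprK.
  by rewrite scaleNr opprK.
- exact: MJ_max.
Qed.

(** It suffices to treat joins of linear forms, where this is the alternative for
    linear inequalities. *)
Lemma latlin_ge0 f y : lattice_linear x f y -> (forall v, 0 <= f v) -> 0 <= y.
Proof.
move=> /latlin_normal_form; elim=> {f y} [f y Jf|f g y z _ IH1 _ IH2] f0.
  suff [L Lf Ly] : exists2 L : seq {ffun T -> R},
      (forall v, exists2 a : {ffun T -> R}, a \in L & f v <= lin_form a v) &
      (forall a : {ffun T -> R}, a \in L -> lin_comb x a <= y).
    apply: (linear_alternative _ Ly) => v.
    by have [a aL fa] := Lf v; exists a => //; exact: le_trans (f0 v) fa.
  elim: Jf {f0} => {f y} [a|f g y z _ [L1 Lf1 Ly1] _ [L2 Lf2 Ly2]].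
    exists [:: a] => [v|b]; first by exists a; rewrite ?inE.
    by rewrite inE => /eqP ->.
  exists (L1 ++ L2) => [v|a]; last first.
    rewrite mem_cat => /orP[/Ly1|/Ly2] ay.
      exact: le_trans ay (vler_joinl _ _).
    exact: le_trans ay (vler_joinr _ _).
  have [a aL fa] := Lf1 v; have [b bL gb] := Lf2 v.
  rewrite /Num.max; case: ifP => _.
    by exists b; rewrite // mem_cat bL orbT.
  by exists a; rewrite // mem_cat aL.
by apply: vmeet_glb; [apply: IH1|apply: IH2] => v; have := f0 v;
  rewrite le_min => /andP[].
Qed.

Lemma latlin_le f g y z : lattice_linear x f y -> lattice_linear x g z ->
  (forall v, f v <= g v) -> y <= z.
Proof.
move=> Lf Lg fg; rewrite -vsubr_ge0.
by apply: latlin_ge0 (latlinB Lg Lf) _ => v; rewrite subr_ge0.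
Qed.

End NormalForm.
End LatticeLinear.

(** * Functional calculus in Archimedean vector lattices *)

Section Calculus.
Context {R : realType}.

Lemma dist_max_le (a b c d : R) :
  `|Num.max a b - Num.max c d| <= `|a - c| + `|b - d|.
Proof.
have := ler_norm (a - c); have := ler_norm (b - d).
have := ler_norm (- (a - c)); have := ler_norm (- (b - d)); rewrite !normrN.
move=> h1 h2 h3 h4; rewrite ler_norml.
by rewrite /Num.max; case: ltP => ab; case: ltP => cd; apply/andP; split; lra.
Qed.

(** [y] is the value of [f] at [x] when lattice-linear expressions approximate
    [f] uniformly relative to some gauge [N], and their values approximate [y]
    relative to the value of [N]. This makes sense in the ambient vector lattice
    too, which carries no quasi-norm, and it is transported by lattice
    homomorphisms, so that lp sums formed in different lattices can be compared
    in the ambient one. *)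
Definition calculus (T : Type) (V : vectorLatticeType R) (x : T -> V)
    (f : (T -> R) -> R) (y : V) :=
  exists N e, lattice_linear x N e /\ forall eps : R, 0 < eps ->
    exists g z, [/\ lattice_linear x g z, forall v, `|f v - g v| <= eps * N v &
      vabs (y - z) <= eps *: e].

Section Closure.
Context {T : Type} {V : vectorLatticeType R} {x : T -> V}.
Implicit Types (f g : (T -> R) -> R) (y z : V).

Lemma latlin_calculus f y : lattice_linear x f y -> calculus x f y.
Proof.
move=> Lf; exists (fun=> 0), 0; split=> [|eps _]; first exact: LatLin0.
exists f, y; split=> // [v|]; first by rewrite subrr normr0 mulr0.
by rewrite subrr vabs0 scaler0.
Qed.

Lemma calculus_eq f g y : f =1 g -> calculus x f y -> calculus x g y.
Proof. by move=> /funext ->. Qed.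

Lemma calculus_lin a f g y z : calculus x f y -> calculus x g z ->
  calculus x (fun v => a * f v + g v) (a *: y + z).
Proof.
move=> [N [e [LN Nf]]] [N' [e' [LN' Nf']]].
exists (fun v => `|a| * N v + N' v), (`|a| *: e + e'); split.
  exact: LatLinAdd.
move=> eps eps0; have [h [w [Lh fh yw]]] := Nf _ eps0.
have [h' [w' [Lh' fh' yw']]] := Nf' _ eps0.
exists (fun v => a * h v + h' v), (a *: w + w'); split=> [|v|].
- exact: LatLinAdd.
- rewrite opprD addrACA -mulrBr; apply: le_trans (ler_normD _ _) _.
  by rewrite /= (mulrDr eps) lerD // normrM mulrCA ler_wpM2l.
- rewrite opprD addrACA -scalerBr; apply: le_trans (vabsD _ _) _.
  rewrite (scalerDr eps) vlerD // vabsZ scalerA mulrC -scalerA.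
  exact: vlerZ.
Qed.

Lemma calculus_max f g y z : calculus x f y -> calculus x g z ->
  calculus x (fun v => Num.max (f v) (g v)) (y `v` z).
Proof.
move=> [N [e [LN Nf]]] [N' [e' [LN' Nf']]].
exists (fun v => N v + N' v), (e + e'); split; first exact: latlinD.
move=> eps eps0; have [h [w [Lh fh yw]]] := Nf _ eps0.
have [h' [w' [Lh' fh' yw']]] := Nf' _ eps0.
exists (fun v => Num.max (h v) (h' v)), (w `v` w'); split=> [|v|].
- exact: LatLinMax.
- by apply: le_trans (dist_max_le _ _ _ _) _; rewrite /= mulrDr lerD.
- by apply: le_trans (vabs_join _ _ _ _) _; rewrite scalerDr vlerD.
Qed.

Lemma calculus0 : calculus x (fun=> 0) 0.
Proof. exact/latlin_calculus/LatLin0. Qed.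

Lemma calculusD f g y z : calculus x f y -> calculus x g z ->
  calculus x (fun v => f v + g v) (y + z).
Proof.
move=> cf cg; rewrite -[y]scale1r.
by apply: calculus_eq (calculus_lin 1 cf cg) => v; rewrite mul1r.
Qed.

Lemma calculusZ a f y : calculus x f y ->
  calculus x (fun v => a * f v) (a *: y).
Proof.
move=> cf; rewrite -[a *: y]addr0.
by apply: calculus_eq (calculus_lin a cf calculus0) => v; rewrite addr0.
Qed.

Lemma calculusN f y : calculus x f y -> calculus x (fun v => - f v) (- y).
Proof.
move=> cf; rewrite -scaleN1r.
by apply: calculus_eq (calculusZ (-1) cf) => v; rewrite mulN1r.
Qed.

Lemma calculus_min f g y z : calculus x f y -> calculus x g z ->
  calculus x (fun v => Num.min (f v) (g v)) (y `^` z).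
Proof.
move=> cf cg; rewrite vmeetN.
apply: calculus_eq (calculusN (calculus_max (calculusN cf) (calculusN cg))) => v.
by rewrite oppr_max !opprK.
Qed.

End Closure.

Lemma calculus_subst (S T : Type) (V : vectorLatticeType R) (x : T -> V)
    (y : S -> V) (h : T -> (S -> R) -> R) f z :
  (forall t, lattice_linear y (h t) (x t)) -> calculus x f z ->
  calculus y (fun v => f (fun t => h t v)) z.
Proof.
move=> hx [N [e [LN Nf]]].
exists (fun v => N (fun t => h t v)), e; split; first exact: (latlin_subst hx LN).
move=> eps eps0; have [g [w [Lg fg yw]]] := Nf _ eps0.
exists (fun v => g (fun t => h t v)), w; split=> //.
exact: (latlin_subst hx Lg).
Qed.

Lemma calculus_hom (T : Type) (V W : vectorLatticeType R) (phi : V -> W)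
    (x : T -> V) f z : lattice_homomorphism phi ->
  calculus x f z -> calculus (phi \o x) f (phi z).
Proof.
move=> hphi [N [e [LN Nf]]]; exists N, (phi e); split; first exact: latlin_hom.
move=> eps eps0; have [g [w [Lg fg yw]]] := Nf _ eps0.
exists g, (phi w); split=> //; first exact: latlin_hom.
by rewrite -(lhomB hphi) -(lhom_abs hphi) -(lhomZ hphi); exact: lhom_le.
Qed.

Section Positivity.
Context {T : finType} {V : vectorLatticeType R} {x : T -> V}.
Hypothesis archV : archimedean_lattice V.
Implicit Types (f g : (T -> R) -> R) (y z : V).

(** Inequalities between real functions pass to an Archimedean lattice, because
    an approximation of a nonnegative [f] plus [eps] times the gauge is a
    nonnegative lattice-linear function. *)
Lemma calculus_ge0 f y : calculus x f y -> (forall v, 0 <= f v) -> 0 <= y.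
Proof.
move=> [N [e [LN Nf]]] f0; rewrite -oppr0 vlerNl; apply: (archV (y := 2 *: e)).
move=> eps eps0; have [g [z [Lg fg yz]]] := Nf _ eps0.
have : 0 <= z + eps *: e.
  apply: latlin_ge0 (latlinD Lg (latlinZ eps LN)) _ => v.
  have := le_trans (ler_norm _) (fg v); have := f0 v; lra.
move=> h; rewrite scalerA mulrC -scalerA scaler_nat mulr2n.
have {}h : - z <= eps *: e by rewrite vlerNl -vsubr_ge0 opprK.
have := vlerD (le_trans (vleN_abs _) yz) h.
by rewrite opprB addrAC subrr add0r.
Qed.

Lemma calculus_le f g y z : calculus x f y -> calculus x g z ->
  (forall v, f v <= g v) -> y <= z.
Proof.
move=> cf cg fg; rewrite -vsubr_ge0.
by apply: calculus_ge0 (calculusD cg (calculusN cf)) _ => v; rewrite subr_ge0.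
Qed.

Lemma calculus_uniq f y z : calculus x f y -> calculus x f z -> y = z.
Proof.
by move=> cy cz; apply/le_anti/andP; split; [apply: calculus_le cy cz _|
  apply: calculus_le cz cy _].
Qed.

End Positivity.
End Calculus.

(** * Lattice-linear approximation of homogeneous functions *)

Section Homogeneous.
Context {R : realType}.

Lemma latlin_homogeneous (T : Type) (V : vectorLatticeType R) (x : T -> V) g z :
  lattice_linear x g z ->
  forall (a : R) v, 0 <= a -> g (fun t => a * v t) = a * g v.
Proof.
move=> Lg a v a0; elim: Lg => [|t|b f1 f2 z1 z2 _ IH1 _ IH2|f1 f2 z1 z2 _ IH1 _ IH2].
- by rewrite mulr0.
- by [].
- by rewrite IH1 IH2 mulrDr mulrCA.
- by rewrite IH1 IH2 maxr_pMr.
Qed.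

Context {n : nat} {V : vectorLatticeType R}.
Variable x : 'I_n -> V.

Let N (v : 'I_n -> R) : R := \sum_k `|v k|.
Let ofun (v : 'I_n -> R) : 'rV[R]_n := \row_k v k.

Let N_ge0 v : 0 <= N v. Proof. by apply: sumr_ge0 => k _. Qed.

Let le_N v k : `|v k| <= N v.
Proof. by rewrite /N (bigD1 k) //= lerDl sumr_ge0. Qed.

Let latlin_N : lattice_linear x N (\sum_k vabs (x k)).
Proof. by apply: latlin_sum => k; apply: latlin_abs; exact: LatLinVar. Qed.

Let near_entries (s : 'rV[R]_n) (P : 'rV[R]_n -> Prop) :
  (\forall v \near s, P v) -> exists2 d : R, 0 < d &
    forall v : 'rV[R]_n, (forall k, `|v 0 k - s 0 k| < d) -> P v.
Proof.
move=> /nbhs_ballP[d /= d0 dP]; exists d => // v vd; apply: (dP v); split=> // i j.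
by rewrite /ball /= (ord1 i) distrC.
Qed.

(** Put [N v] for the sum of the [`|v k|]. Around each point [s] of a cube, the
    lattice-linear function [f s * N v + L * \sum_k `|v k - s k * N v|] with a
    steep slope [L] stays above [f - eps] on the sphere [N v = 1] and is close to
    [f] near [s]; finitely many neighbourhoods cover the cube, and the minimum
    of the corresponding functions approximates [f] on the sphere, hence
    everywhere by homogeneity. *)
Lemma homogeneous_approx (f : 'rV[R]_n -> R) (eps : R) : homogeneous_cont f ->
  0 < eps -> exists g z, lattice_linear x g z /\
    forall v, `|f (\row_k v k) - g v| <= eps * \sum_k `|v k|.
Proof.
move=> [fc fh] eps0; have f0 : f 0 = 0 by rewrite -(scale0r 0) fh // mul0r.
have [B B0 fB] : exists2 B : R, 0 < B & forall v, `|f (ofun v)| <= B * N v.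
  have [|d d0 dP] := @near_entries 0 (fun v : 'rV[R]_n => `|f v| < 1).
    have /cvgr_dist_lt/(_ _ ltr01) := fc 0.
    by apply: filterS => v; rewrite f0 sub0r normrN.
  exists (2 / d); first by rewrite divr_gt0.
  move=> v; have := N_ge0 v; rewrite le_eqVlt => /predU1P[N0|Npos].
    have -> : ofun v = 0.
      apply/rowP => k; rewrite !mxE; apply/normr0_eq0/le_anti.
      by rewrite normr_ge0 andbT N0 le_N.
    by rewrite f0 normr0 -N0 mulr0.
  pose c := d / (2 * N v).
  have c0 : 0 < c by rewrite divr_gt0 ?mulr_gt0.
  have : `|f (c *: ofun v)| < 1.
    apply: dP => k; rewrite !mxE subr0 normrM gtr0_norm // mulrC.
    apply: le_lt_trans (ler_wpM2r (ltW c0) (le_N _ _)) _.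
    have -> : N v * c = d / 2 by rewrite /c; field; lra.
    by lra.
  rewrite (fh c _ (ltW c0)) normrM gtr0_norm // => /ltW h.
  rewrite -(ler_pM2l c0); apply: le_trans h _.
  by rewrite le_eqVlt; apply/orP; left; apply/eqP; rewrite /c; field; lra.
have e20 : 0 < eps / 2 by rewrite divr_gt0.
pose near_s (s v : 'rV[R]_n) := `|f v - f s| < eps / 2.
have ds (s : 'rV[R]_n) : exists d : R, 0 < d /\
    forall v : 'rV[R]_n, (forall k, `|v 0 k - s 0 k| < d) -> near_s s v.
  have [|d d0 dP] := @near_entries s (near_s s); last by exists d.
  have /cvgr_dist_lt/(_ _ e20) := fc s.
  by apply: filterS => v; rewrite /near_s distrC.
have [d dP] := choice ds.
(* At distance at least [d s] from [s] this slope beats the oscillation of [f]. *)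
pose L (s : 'rV[R]_n) := (B + `|f s|) / d s.
have L0 s : 0 <= L s by apply: divr_ge0; [rewrite addr_ge0 // ltW|apply/ltW; case: (dP s)].
pose h (s : 'rV[R]_n) (v : 'I_n -> R) := f s * N v + L s * \sum_k `|v k - s 0 k * N v|.
have hLL s : exists z, lattice_linear x (h s) z.
  eexists; apply: LatLinAdd latlin_N _; apply: latlinZ.
  apply: latlin_sum => k; apply: latlin_abs; apply: latlinB (LatLinVar x k) _.
  exact: latlinZ latlin_N.
have h_ge s v : N v = 1 -> f (ofun v) - eps <= h s v.
  move=> Nv; rewrite /h Nv mulr1; under eq_bigr do rewrite mulr1.
  have D0 : 0 <= \sum_k `|v k - s 0 k| by apply: sumr_ge0 => k _.
  have [Dd|dD] := ltP (\sum_k `|v k - s 0 k|) (d s).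
    have : near_s s (ofun v).
      apply: (dP s).2 => k; apply: le_lt_trans Dd.
      by rewrite mxE (bigD1 k) //= lerDl sumr_ge0.
    rewrite /near_s => /(le_lt_trans (ler_norm _)) ?.
    have := mulr_ge0 (L0 s) D0; lra.
  have : B + `|f s| <= L s * \sum_k `|v k - s 0 k|.
    apply: le_trans (ler_wpM2l (L0 s) dD).
    by have [d0 _] := dP s; rewrite /L divfK // lt0r_neq0.
  have := le_trans (ler_norm _) (fB v); rewrite Nv mulr1.
  have := ler_norm (- f s); rewrite normrN; lra.
pose U (s : 'rV[R]_n) := [set v : 'rV[R]_n | near_s s v /\ L s * \sum_k `|v 0 k - s 0 k| < eps / 2].
have Us s : nbhs s (U s).
  apply/nbhs_ballP; have [d0 dsP] := dP s.
  pose r := Num.min (d s) (eps / 2 / (L s * n%:R + 1)).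
  have Ln : 0 < L s * n%:R + 1 by rewrite ltr_wpDl // mulr_ge0 // L0.
  have r0 : 0 < r by rewrite lt_min d0 divr_gt0.
  exists r => //= v vr; have {}vr k : `|v 0 k - s 0 k| < r.
    by have [_ /(_ 0 k)] := vr; rewrite /ball /= distrC.
  split; first by apply: dsP => k; apply: lt_le_trans (vr k) _; rewrite ge_min lexx.
  have : \sum_k `|v 0 k - s 0 k| <= r * n%:R.
    apply: le_trans (ler_sum _ (fun k _ => ltW (vr k))) _.
    by rewrite sumr_const card_ord mulr_natr.
  move=> /(ler_wpM2l (L0 s))/le_lt_trans; apply.
  rewrite mulrCA; apply: (@lt_le_trans _ _ (r * (L s * n%:R + 1))).
    by rewrite ltr_pM2l // ltrDl.
  by rewrite -ler_pdivlMr // ge_min lexx orbT.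
pose K := [set v : 'rV[R]_n | forall k, `[-1, 1]%classic (v ord0 k)].
have Kc : compact K.
  apply: (@rV_compact _ _ (fun=> `[(-1 : R), 1]%classic)) => _.
  exact: segment_compact.
move: Kc; rewrite compact_cover => /(_ _ K (fun s => (U s)^°)) [||D _ KD].
- by move=> s _; exact: open_interior.
- by move=> s Ks; exists s => //; exact: Us.
have hU s v : N v = 1 -> U s (ofun v) -> h s v <= f (ofun v) + eps.
  move=> Nv [/= nsv Lsv]; rewrite /h Nv mulr1.
  under eq_bigr do rewrite mulr1.
  move: Lsv; under eq_bigr do rewrite mxE; move=> Lsv.
  have := le_lt_trans (ler_norm _) nsv; have := ler_norm (- (f (ofun v) - f s)).
  rewrite normrN => /le_lt_trans/(_ nsv) ? ?; lra.
have [g [z [Lg g_ge gh]]] : exists g z, [/\ lattice_linear x g z,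
    forall v, N v = 1 -> f (ofun v) - eps <= g v &
    forall v (s : 'rV[R]_n), s \in finmap.enum_fset D -> g v <= h s v].
  elim: (finmap.enum_fset D) => [|s l [g [z [Lg g_ge gh]]]].
    (* A constant multiple of [N] above [f], so that the minimum starts somewhere. *)
    exists (fun v => B * N v), (B *: \sum_k vabs (x k)); split=> //.
      exact: latlinZ latlin_N.
    by move=> v Nv; have := le_trans (ler_norm _) (fB v); lra.
  have [w Lh] := hLL s; exists (fun v => Num.min (h s v) (g v)), (w `^` z).
  split; first exact: latlin_min.
    by move=> v Nv; rewrite le_min h_ge // g_ge.
  move=> v t; rewrite inE => /predU1P[->|/gh gt]; first by rewrite ge_min lexx.
  by rewrite ge_min gt orbT.
exists g, z; split=> // v; have := N_ge0 v; rewrite le_eqVlt => /predU1P[N0|Npos].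
  have v0 k : v k = 0.
    by apply/normr0_eq0/le_anti; rewrite normr_ge0 andbT N0 le_N.
  rewrite -[\sum_k _]/(N v) -N0 mulr0 -/(ofun v).
  have -> : ofun v = 0 by apply/rowP => k; rewrite !mxE.
  rewrite f0; have := latlin_homogeneous Lg v (lexx 0).
  have -> : (fun t => 0 * v t) = v by apply/funext => k; rewrite v0 mulr0.
  by rewrite mul0r => ->; rewrite subrr normr0.
pose w k := (N v)^-1 * v k.
have vw k : v k = N v * w k by rewrite /w mulrA divff ?gt_eqF // mul1r.
have Nw : N w = 1.
  rewrite /N; under eq_bigr do rewrite normrM gtr0_norm ?invr_gt0 //.
  by rewrite -mulr_sumr mulVf // gt_eqF.
have [s sD Usw] : exists2 s, s \in finmap.enum_fset D & U s (ofun w).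
  have [|s /= sD /interior_subset Us'] := KD (ofun w); last by exists s.
  by move=> k /=; rewrite in_itv /= -ler_norml mxE -Nw le_N.
have fgw : `|f (ofun w) - g w| <= eps.
  rewrite ler_norml; have := g_ge w Nw; have := gh w s sD.
  have := hU s w Nw Usw; by move=> *; apply/andP; split; lra.
have -> : \row_k v k = N v *: ofun w by apply/rowP => k; rewrite !mxE vw.
have -> : g v = N v * g w.
  by rewrite -(latlin_homogeneous Lg) //; congr g; apply/funext.
by rewrite fh // -mulrBr normrM gtr0_norm // mulrC ler_wpM2r.
Qed.

End Homogeneous.

(** * Real powers and lp sums of real numbers *)

Section RealPowers.
Context {R : realType}.
Implicit Types (a b r : R).

Lemma powRK r a : r != 0 -> 0 <= a -> (a `^ r) `^ r^-1 = a.
Proof. by move=> r0 a0; rewrite -powRrM mulfV // powRr1. Qed.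

Lemma powRVK r a : r != 0 -> 0 <= a -> (a `^ r^-1) `^ r = a.
Proof. by move=> r0 a0; rewrite -powRrM mulVf // powRr1. Qed.

Lemma ler_powR2r r a b : 0 <= r -> 0 <= a -> a <= b -> a `^ r <= b `^ r.
Proof.
move=> r0 a0 ab; apply: ge0_ler_powR => //; rewrite nnegrE //.
exact: le_trans ab.
Qed.

Lemma powR_lerE r a b : 0 < r -> 0 <= a -> 0 <= b ->
  (a <= b `^ r^-1) = (a `^ r <= b).
Proof.
move=> r0 a0 b0; apply/idP/idP => h.
  by rewrite -[b](@powRVK r) ?lt0r_neq0 // ler_powR2r // ltW.
rewrite -[a](@powRK r) ?lt0r_neq0 //; apply: ler_powR2r => //.
- by rewrite invr_ge0 ltW.
- exact: powR_ge0.
Qed.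

Lemma powR_lerEV r a b : 0 < r -> 0 <= a -> 0 <= b ->
  (a `^ r^-1 <= b) = (a <= b `^ r).
Proof.
move=> r0 a0 b0; have := @powR_lerE r^-1 a b.
by rewrite invrK invr_gt0 => ->.
Qed.

(** The absolute value is needed at [0]: negative numbers have power [1]. *)
Lemma powR_norm_continuous r : 0 < r -> continuous (fun s : R => `|s| `^ r).
Proof.
move=> r0 s; have [->|s0] := eqVneq s 0.
  apply/cvgrPdist_lt => e e0; rewrite normr0 powR0 ?lt0r_neq0 //.
  have d0 : 0 < e `^ r^-1 by exact: powR_gt0.
  have /cvgr_dist_lt/(_ _ d0) := @cvg_id _ (nbhs (0 : R)).
  apply: filterS => t; rewrite sub0r normrN => td.
  rewrite sub0r normrN ger0_norm ?powR_ge0 //.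
  rewrite -[e](@powRVK r) ?lt0r_neq0 ?(ltW e0) //.
  by apply: gt0_ltr_powR => //; rewrite ?nnegrE ?powR_ge0.
apply: (@continuous_comp R R R (fun t : R => `|t|) (fun t : R => t `^ r) s).
  exact: norm_continuous.
apply/differentiable_continuous/derivable1_diffP.
by apply: derivable_powR; rewrite in_itv /= normr_gt0 s0.
Qed.

Context {p : R}.
Hypotheses (p_gt0 : 0 < p) (p_le1 : p <= 1).

Let p_neq0 : p != 0. Proof. exact: lt0r_neq0. Qed.
Let p_ge0 : 0 <= p. Proof. exact: ltW. Qed.
Let pV_gt0 : 0 < p^-1. Proof. by rewrite invr_gt0. Qed.

Lemma powR_subadd a b : 0 <= a -> 0 <= b -> (a + b) `^ p <= a `^ p + b `^ p.
Proof.
move=> a0 b0; have : 0 <= a + b by exact: addr_ge0.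
rewrite le_eqVlt => /predU1P[<-|ab0].
  by rewrite powR0 // addr_ge0 ?powR_ge0.
have key c : 0 <= c -> c <= a + b -> c / (a + b) * (a + b) `^ p <= c `^ p.
  rewrite le_eqVlt => /predU1P[<-|c0] cab; first by rewrite !mul0r powR_ge0.
  have -> : c `^ p = (c / (a + b)) `^ p * (a + b) `^ p.
    by rewrite -powRM ?divfK ?lt0r_neq0 // ?divr_ge0 // ltW.
  apply: ler_wpM2r; first exact: powR_ge0.
  by apply: ger1_powR; rewrite // divr_gt0 // ler_pdivrMr // mul1r.
have := lerD (key a a0 _) (key b b0 _); rewrite lerDl lerDr => /(_ b0 a0).
by rewrite -mulrDl -mulrDl divff ?lt0r_neq0 // mul1r.
Qed.

Lemma powR_sum_subadd (J : Type) (s : seq J) (P : pred J) (f : J -> R) :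
  (forall j, 0 <= f j) ->
  (\sum_(j <- s | P j) f j) `^ p <= \sum_(j <- s | P j) f j `^ p.
Proof.
move=> f0.
suff [] : 0 <= \sum_(j <- s | P j) f j /\
  (\sum_(j <- s | P j) f j) `^ p <= \sum_(j <- s | P j) f j `^ p by [].
elim/big_rec2: _ => [|j y z _ [z0 zy]]; first by rewrite powR0.
split; first exact: addr_ge0.
by apply: le_trans (powR_subadd _ _) _; rewrite ?lerD2l.
Qed.

Section LpNorm.
Context {T : finType}.
Implicit Types (v w : T -> R).

Definition lp_norm v : R := (\sum_t `|v t| `^ p) `^ p^-1.

Lemma lp_norm_ge0 v : 0 <= lp_norm v.
Proof. exact: powR_ge0. Qed.

Lemma sum_powR_ge0 v : 0 <= \sum_t `|v t| `^ p.
Proof. by apply: sumr_ge0 => t _; exact: powR_ge0. Qed.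

Lemma lp_normp v : lp_norm v `^ p = \sum_t `|v t| `^ p.
Proof. by rewrite powRVK // sum_powR_ge0. Qed.

Lemma lp_norm_le v w : (forall t, `|v t| <= `|w t|) -> lp_norm v <= lp_norm w.
Proof.
move=> vw; apply: ler_powR2r; rewrite ?invr_ge0 ?sum_powR_ge0 //.
by apply: ler_sum => t _; exact: ler_powR2r.
Qed.

Lemma ler_sum_lp_norm v : `|\sum_t v t| <= lp_norm v.
Proof.
rewrite powR_lerE ?sum_powR_ge0 //.
apply: le_trans (powR_sum_subadd _ _ _) => //.
by apply: ler_powR2r => //; exact: ler_norm_sum.
Qed.

Lemma lp_normD_le v w :
  lp_norm (fun t => v t + w t) <= 2 `^ p^-1 * (lp_norm v + lp_norm w).
Proof.
have vw : \sum_t `|v t + w t| `^ p <= \sum_t `|v t| `^ p + \sum_t `|w t| `^ p.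
  rewrite -big_split; apply: ler_sum => t _ /=.
  apply: le_trans (powR_subadd _ _) => //.
  by apply: ler_powR2r => //; exact: ler_normD.
set m := Num.max (lp_norm v) (lp_norm w).
apply: (@le_trans _ _ (2 `^ p^-1 * m)); last first.
  rewrite ler_wpM2l ?powR_ge0 // /m ge_max.
  by apply/andP; split; [rewrite lerDl|rewrite lerDr]; exact: lp_norm_ge0.
have m0 : 0 <= m by rewrite le_max; apply/orP; left; exact: lp_norm_ge0.
rewrite powR_lerEV ?sum_powR_ge0 ?mulr_ge0 ?powR_ge0 //.
rewrite powRM ?powR_ge0 // powRVK //; apply: le_trans vw _.
rewrite (_ : 2 = 1 + 1) // mulrDl mul1r -!lp_normp.
by apply: lerD; (apply: ler_powR2r; [by []|exact: lp_norm_ge0|]);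
  rewrite le_max; apply/orP; [left|right].
Qed.

Let powR_convex (al s u : R) : 0 <= al -> al <= 1 -> 0 <= s -> 0 <= u ->
  (al * s + (1 - al) * u) `^ p^-1 <= al * s `^ p^-1 + (1 - al) * u `^ p^-1.
Proof.
move=> al0 al1 s0 u0.
have pV1 : 1 <= p^-1 by rewrite invf_ge1.
have := @convex_powR R p^-1 pV1 (Itv01 al0 al1) s u.
by rewrite !convRE /=; apply; rewrite inE /= in_itv /= andbT.
Qed.

(** For [p <= 1] Minkowski's inequality reverses on nonnegative vectors,
    because [s |-> s `^ p] is concave. *)
Lemma lp_normD_ge v w : (forall t, 0 <= v t) -> (forall t, 0 <= w t) ->
  lp_norm v + lp_norm w <= lp_norm (fun t => v t + w t).
Proof.
move=> v0 w0.
have [A AE] := ex_intro (fun a => a = lp_norm v) _ erefl.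
have [B BE] := ex_intro (fun b => b = lp_norm w) _ erefl.
rewrite -AE -BE; have := lp_norm_ge0 v; rewrite -AE le_eqVlt => /predU1P[<-|A0].
  by rewrite add0r BE; apply: lp_norm_le => t; rewrite !ger0_norm ?addr_ge0 // lerDr.
have := lp_norm_ge0 w; rewrite -BE le_eqVlt => /predU1P[<-|B0].
  by rewrite addr0 AE; apply: lp_norm_le => t; rewrite !ger0_norm ?addr_ge0 // lerDl.
have AB0 : 0 < A + B by exact: addr_gt0.
rewrite /lp_norm powR_lerE ?sum_powR_ge0 ?(ltW AB0) //.
pose al := A / (A + B).
have al0 : 0 <= al by rewrite divr_ge0 // ltW.
have al1 : al <= 1 by rewrite ler_pdivrMr // mul1r lerDl ltW.
have alE : 1 - al = B / (A + B) by rewrite /al; field; rewrite lt0r_neq0.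
have alE' : al = A / (A + B) by [].
clearbody al.
have key t : (A + B) `^ p * (al * (v t / A) `^ p + (1 - al) * (w t / B) `^ p)
    <= `|v t + w t| `^ p.
  rewrite ger0_norm ?addr_ge0 //.
  have -> : v t + w t = (A + B) * (al * (v t / A) + (1 - al) * (w t / B)).
    by rewrite alE alE'; field; rewrite !lt0r_neq0.
  have : 0 <= v t / A by rewrite divr_ge0 // ltW.
  have : 0 <= w t / B by rewrite divr_ge0 // ltW.
  move: (v t / A) (w t / B) => s u u0 s0.
  have al1' : 0 <= 1 - al by rewrite subr_ge0.
  rewrite [leRHS]powRM ?(ltW AB0) ?addr_ge0 ?mulr_ge0 //.
  rewrite ler_wpM2l ?powR_ge0 // -powR_lerEV ?addr_ge0 ?mulr_ge0 ?powR_ge0 //.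
  by apply: le_trans (powR_convex _ _ _ _) _; rewrite ?powR_ge0 // !powRK.
apply: le_trans (ler_sum _ (fun t _ => key t)).
rewrite -mulr_sumr big_split /= -!mulr_sumr.
have sum1 (u : T -> R) (D : R) : 0 < D -> D = lp_norm u -> (forall t, 0 <= u t) ->
    \sum_t (u t / D) `^ p = 1.
  move=> D0 DE u0.
  under eq_bigr do rewrite powRM ?invr_ge0 ?(ltW D0) ?u0 //.
  rewrite -mulr_suml.
  have -> : \sum_t u t `^ p = D `^ p.
    by rewrite DE lp_normp; apply: eq_bigr => t _; rewrite ger0_norm.
  by rewrite -powRM ?invr_ge0 ?(ltW D0) // divff ?powR1 // lt0r_neq0.
by rewrite (sum1 v A) // (sum1 w B) // !mulr1 addrC subrK mulr1.
Qed.

End LpNorm.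

(** If [b] is small compared with [a] it is absorbed by [eta]; otherwise [a] is
    at most a multiple of [b]. *)
Lemma powRD_eps (eta : R) : 0 < eta -> exists2 c : R, 0 <= c &
  forall a b, 0 <= a -> 0 <= b ->
    (a + b) `^ p^-1 <= (1 + eta) * a `^ p^-1 + c * b `^ p^-1.
Proof.
move=> eta0; pose d := (1 + eta) `^ p - 1.
have d0 : 0 < d.
  rewrite subr_gt0; apply: (@le_lt_trans _ _ (1 `^ p)); first by rewrite powR1.
  apply: gt0_ltr_powR; rewrite ?nnegrE //.
    by rewrite addr_ge0 // ltW.
  by rewrite ltrDl.
exists ((d^-1 + 1) `^ p^-1); first exact: powR_ge0.
move=> a b a0 b0; have eta1 : 0 <= 1 + eta by rewrite addr_ge0 // ltW.
have [bda|dab] := leP b (d * a).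
  apply: le_trans (_ : (1 + eta) * a `^ p^-1 <= _); last first.
    by rewrite lerDl mulr_ge0 ?powR_ge0.
  rewrite powR_lerEV ?addr_ge0 ?mulr_ge0 ?powR_ge0 //.
  rewrite powRM ?powR_ge0 // powRVK //.
  apply: (@le_trans _ _ (a + d * a)); first by rewrite lerD2l.
  by rewrite /d le_eqVlt; apply/orP; left; apply/eqP; ring.
apply: le_trans (_ : (d^-1 + 1) `^ p^-1 * b `^ p^-1 <= _); last first.
  by rewrite lerDr mulr_ge0 ?powR_ge0.
have d10 : 0 <= d^-1 + 1 by rewrite addr_ge0 // invr_ge0 ltW.
rewrite -powRM //; apply: ler_powR2r; rewrite ?invr_ge0 ?addr_ge0 //.
by rewrite mulrDl mul1r lerD2r mulrC ler_pdivlMr // mulrC ltW.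
Qed.

End RealPowers.

(** * The homogeneous calculus of a quasi-Banach lattice *)

Section QuasiBanach.
Context {R : realType} {X : qBanachLatticeType R}.
Implicit Types (x y z : X) (e : R).

Lemma qnorm0 : qnorm (0 : X) = 0.
Proof. by rewrite -(scale0r (0 : X)) qnormZ normr0 mul0r. Qed.

Lemma qnormN x : qnorm (- x) = qnorm x.
Proof. by rewrite -scaleN1r qnormZ normrN1 mul1r. Qed.

Lemma qnorm_le x y : vabs x <= y -> qnorm x <= qnorm y.
Proof. by move=> xy; apply/qnorm_lattice/(le_trans xy)/vle_abs. Qed.

Lemma qnorm_abs x : qnorm (vabs x) = qnorm x.
Proof.
by apply/le_anti; rewrite !qnorm_lattice // vabs_id.
Qed.

Lemma qnormZ_ge0 (a : R) x : 0 <= a -> qnorm (a *: x) = a * qnorm x.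
Proof. by move=> a0; rewrite qnormZ ger0_norm. Qed.

Lemma qnorm_small_eq0 x : (forall e, 0 < e -> qnorm x <= e) -> x = 0.
Proof.
move=> h; apply: qnorm0_eq0; apply/le_anti; rewrite qnorm_ge0 andbT.
by apply/ler_addgt0Pl => e e0; rewrite addr0 h.
Qed.

Lemma qnormD_pos : exists2 K : R, 0 < K &
  forall x y, qnorm (x + y) <= K * (qnorm x + qnorm y).
Proof.
have [K hK] := @qnormD R X; exists (`|K| + 1).
  by rewrite ltr_wpDl.
move=> x y; apply: le_trans (hK x y) _; apply: ler_wpM2r.
  by rewrite addr_ge0 ?qnorm_ge0.
by apply: le_trans (ler_norm K) _; rewrite lerDl.
Qed.

(** The order is closed: the positive part of [x - y] is at most the absolute
    value of [x - w] for every [w] below [y]. *)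
Lemma qbanach_le_closed x y :
  (forall e, 0 < e -> exists2 w, w <= y & qnorm (x - w) <= e) -> x <= y.
Proof.
move=> h; have -> : x = y + (x - y) by rewrite addrC subrK.
rewrite -[leRHS]addr0 vlerD2l.
suff <- : (x - y) `v` 0 = 0 by exact: vler_joinl.
apply: qnorm_small_eq0 => e /h[w wy]; apply: le_trans.
apply: qnorm_lattice; rewrite ger0_vabs ?vler_joinr //.
apply: vjoin_lub; last exact: vabs_ge0.
by apply: le_trans (vle_abs _); rewrite vlerD2l vlerN.
Qed.

Lemma qbanach_archimedean : archimedean_lattice X.
Proof.
move=> x y xy; apply: qbanach_le_closed => e e0.
have q0 : 0 < qnorm y + 1 by rewrite ltr_wpDl ?qnorm_ge0.
pose a := e / (qnorm y + 1); have a0 : 0 < a by rewrite divr_gt0.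
exists (x - a *: y); first by rewrite vlerBlDr add0r xy.
rewrite opprB addrC subrK qnormZ_ge0 ?(ltW a0) // /a mulrAC ler_pdivrMr //.
by rewrite ler_pM2l // lerDl.
Qed.

Lemma qbanach_cvg (u : nat -> X) :
  (forall e, 0 < e -> exists m : nat, forall i j : nat,
    (m <= i)%N -> (m <= j)%N -> qnorm (u i - u j) < e) ->
  exists l, forall e, 0 < e -> exists m : nat, forall i : nat,
    (m <= i)%N -> qnorm (u i - l) < e.
Proof.
move=> /qnorm_complete[l ul]; exists l => e e0.
have /cvgr_dist_lt/(_ _ e0) [m _ hm] := ul; exists m => i mi.
by have := hm i mi; rewrite /= sub0r normrN ger0_norm // qnorm_ge0.
Qed.

Lemma qbanach_cvg_incr (Y : nat -> X) :
  (forall i j : nat, (i <= j)%N -> Y i <= Y j) ->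
  (forall e, 0 < e -> exists m : nat, forall i j : nat,
    (m <= i)%N -> (i <= j)%N -> qnorm (Y j - Y i) < e) ->
  exists y, (forall n, Y n <= y) /\ forall e, 0 < e -> exists m : nat,
    forall n : nat, (m <= n)%N -> qnorm (y - Y n) < e.
Proof.
move=> Yincr Ycauchy; have [y hy] : exists y, forall e, 0 < e ->
    exists m : nat, forall n : nat, (m <= n)%N -> qnorm (Y n - y) < e.
  apply: qbanach_cvg => e /Ycauchy[m hm]; exists m => i j mi mj.
  have [ij|/ltnW ji] := leqP i j; last exact: hm.
  by rewrite -opprB qnormN; exact: hm.
exists y; split=> [n|e /hy[m hm]]; last first.
  by exists m => n mn; rewrite -opprB qnormN; exact: hm.
apply: qbanach_le_closed => e /hy[m hm]; pose k := maxn n m.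
exists (Y n - (Y k - y)); last by rewrite opprB addrC subrK ltW // hm // leq_maxr.
by rewrite vlerBlDr [leRHS]addrC subrK; apply: Yincr; exact: leq_maxl.
Qed.

Context {n : nat}.
Variable x : 'I_n -> X.
Implicit Types f g : 'rV[R]_n -> R.

Definition row_fun f (v : 'I_n -> R) : R := f (\row_k v k).

(** A homogeneous continuous function is a uniform limit, relative to the
    unit [\sum_k vabs (x k)], of lattice-linear expressions; the values of
    these at [x] form a Cauchy sequence. *)
Lemma calculus_exists f : homogeneous_cont f ->
  exists y, calculus x (row_fun f) y.
Proof.
move=> hf; pose N (v : 'I_n -> R) : R := \sum_k `|v k|; pose e := \sum_k vabs (x k).
have LN : lattice_linear x N e.
  by apply: latlin_sum => k; apply: latlin_abs; exact: LatLinVar.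
have ex m : exists gz : (('I_n -> R) -> R) * X,
    lattice_linear x gz.1 gz.2 /\
    forall v, `|row_fun f v - gz.1 v| <= m.+1%:R^-1 * N v.
  have m0 : 0 < m.+1%:R^-1 :> R by rewrite invr_gt0.
  by have [g [z [Lg fg]]] := homogeneous_approx x hf m0; exists (g, z).
have [gz gzP] := choice ex.
have zle i j : (i <= j)%N -> vabs ((gz i).2 - (gz j).2) <= (2 * i.+1%:R^-1) *: e.
  move=> ij; have [Li fi] := gzP i; have [Lj fj] := gzP j.
  apply: latlin_le (latlin_abs (latlinB Li Lj)) (latlinZ _ LN) _ => v.
  have N0 : 0 <= N v by apply: sumr_ge0.
  have ji : j.+1%:R^-1 * N v <= i.+1%:R^-1 * N v.
    by rewrite ler_wpM2r // lef_pV2 ?posrE ?ltr0n // ler_nat.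
  have -> : (gz i).1 v - (gz j).1 v =
    (row_fun f v - (gz j).1 v) - (row_fun f v - (gz i).1 v) by ring.
  apply: le_trans (ler_normB _ _) _; rewrite -mulrA mulr2n !mulrDl !mul1r.
  by apply: lerD; [exact: le_trans (fj v) ji|exact: fi].
have q0 : 0 < qnorm e + 1 by rewrite ltr_wpDl ?qnorm_ge0.
have small (d : R) : 0 < d -> exists i : nat, 2 * i.+1%:R^-1 * qnorm e < d.
  move=> d0; have c0 : 0 < d / (2 * (qnorm e + 1)) by rewrite divr_gt0 ?mulr_gt0.
  have [i _ /(_ i (leqnn i))/= hi] := near_infty_natSinv_lt (PosNum c0).
  exists i; apply: (@le_lt_trans _ _ (i.+1%:R^-1 * (2 * (qnorm e + 1)))).
    rewrite mulrAC [leLHS]mulrC ler_wpM2l ?invr_ge0 // ler_wpM2l //.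
    by rewrite lerDl.
  by rewrite -ltr_pdivlMr ?mulr_gt0.
have znorm i j : (i <= j)%N -> qnorm ((gz i).2 - (gz j).2) <= 2 * i.+1%:R^-1 * qnorm e.
  move=> /zle/qnorm_le/le_trans; apply.
  by rewrite qnormZ_ge0 // mulr_ge0 // invr_ge0.
have [K K0 hK] := qnormD_pos.
have [y yP] : exists l, forall d, 0 < d -> exists m : nat, forall i : nat,
    (m <= i)%N -> qnorm ((gz i).2 - l) < d.
  apply: qbanach_cvg => d d0.
  have [|m hm] := small (d / (2 * K)); first by rewrite divr_gt0 ?mulr_gt0.
  exists m => i j mi mj; rewrite -[_ - _](subrKA (gz m).2).
  apply: le_lt_trans (hK _ _) _; rewrite -opprB qnormN.
  have := znorm _ _ mi; have := znorm _ _ mj => h1 h2.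
  rewrite -ltr_pdivlMl //; have : d / (2 * K) + d / (2 * K) = K^-1 * d.
    by field; rewrite lt0r_neq0.
  by move=> <-; apply: ltrD; [exact: le_lt_trans h2 hm|exact: le_lt_trans h1 hm].
exists y, (fun v => 2 * N v), (2 *: e); split; first exact: latlinZ.
move=> d d0; have [i _ /(_ i (leqnn i))/= hi] := near_infty_natSinv_lt (PosNum d0).
have [Li fi] := gzP i; exists (gz i).1, (gz i).2; split=> //.
  move=> v; apply: le_trans (fi v) _; rewrite mulrA; apply: ler_wpM2r.
    by apply: sumr_ge0.
  by apply: le_trans (ltW hi) _; rewrite ler_peMr ?(ltW d0) // ler1n.
have e0 : 0 <= e by apply: vsum_ge0 => k _; exact: vabs_ge0.
apply: (@le_trans _ _ ((2 * i.+1%:R^-1) *: e)); last first.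
  by rewrite scalerA mulrC; apply: vscale_le => //; rewrite ler_wpM2r // ltW.
apply: vabs_leP; apply: qbanach_le_closed => r /yP[m hm];
  have := zle i (maxn i m) (leq_maxl _ _);
  have := ltW (hm _ (leq_maxr i m)); move: (maxn i m) => j hj zij.
  exists ((gz j).2 - (gz i).2).
    by rewrite -opprB; exact: le_trans (vleN_abs _) zij.
  by rewrite opprB addrA subrK -qnormN opprB.
exists ((gz i).2 - (gz j).2); first exact: le_trans (vle_abs _) zij.
by rewrite opprB addrC opprB addrA subrK.
Qed.

Let calculus_uniqX := @calculus_uniq R _ X x qbanach_archimedean.

Lemma hom_calculus_exists : exists Phi, is_hom_calculus x Phi.
Proof.
pose Phi f := xget 0 [set y | calculus x (row_fun f) y].
have PhiP f y : calculus x (row_fun f) y -> Phi f = y.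
  move=> fy; suff h : calculus x (row_fun f) (Phi f) by exact: calculus_uniqX h fy.
  by rewrite /Phi; case: xgetP => [z _ //|/(_ y) []].
exists Phi; split=> [k|f g /calculus_exists[y fy] /calculus_exists[z gz]].
  apply: PhiP; apply: latlin_calculus; apply: latlin_eq (LatLinVar x k) => // v.
  by rewrite /row_fun mxE.
rewrite (PhiP _ _ fy) (PhiP _ _ gz); split=> [a||]; apply: PhiP.
- exact: calculus_lin.
- exact: calculus_max.
- exact: calculus_min.
Qed.

(** The calculus functions are those built from coordinates: any lattice
    homomorphism [Phi] with the right values on coordinates agrees with
    evaluation on lattice-linear expressions, hence, being monotone, on their
    uniform limits. *)
Lemma is_hom_calculusP Phi f : is_hom_calculus x Phi -> homogeneous_cont f ->
  calculus x (row_fun f) (Phi f).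
Proof.
move=> [Phix Philat] hf.
have hc0 : homogeneous_cont (fun _ : 'rV[R]_n => 0).
  by split=> [v|a v _]; [exact: cst_continuous|rewrite mulr0].
pose col (g : ('I_n -> R) -> R) (v : 'rV[R]_n) := g (fun k => v 0 k).
have Phi_ll (g : ('I_n -> R) -> R) z : lattice_linear x g z -> homogeneous_cont (col g) /\ Phi (col g) = z.
  elim=> [|k|a f1 f2 z1 z2 _ [hc1 <-] _ [hc2 <-]|f1 f2 z1 z2 _ [hc1 <-] _ [hc2 <-]].
  - split=> //; have [/(_ (-1)) + _ _] := Philat _ _ hc0 hc0.
    rewrite scaleN1r addNr => <-; congr Phi.
    by apply/funext => v; rewrite mulr0 addr0.
  - split; last exact: Phix.
    by split=> [v|a v _]; [exact: coord_continuous|rewrite /col mxE].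
  - have [hl _ _] := Philat _ _ hc1 hc2; split; last exact: hl.
    have [c1 m1] := hc1; have [c2 m2] := hc2; split=> [v|b v b0].
      have ca := @continuousM _ _ (fun=> a) _ v (@cst_continuous _ _ _ _) (c1 v).
      exact: (continuousD ca (c2 v)).
    by have := m1 b v b0; have := m2 b v b0; rewrite /col => -> ->; ring.
  - have [_ hm _] := Philat _ _ hc1 hc2; split; last exact: hm.
    have [c1 m1] := hc1; have [c2 m2] := hc2; split=> [v|b v b0].
      by apply: continuous_max; [exact: c1|exact: c2].
    by have := m1 b v b0; have := m2 b v b0; rewrite /col => -> ->; rewrite maxr_pMr.
have Phi_mono g h : homogeneous_cont g -> homogeneous_cont h ->
    (forall v, g v <= h v) -> Phi g <= Phi h.
  move=> hg hh gh; have [_ + _] := Philat _ _ hg hh.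
  have -> : (fun v => Num.max (g v) (h v)) = h.
    by apply/funext => v; apply/max_idPr.
  by move=> ->; exact: vler_joinl.
pose N (v : 'I_n -> R) : R := \sum_k `|v k|; pose e := \sum_k vabs (x k).
have LN : lattice_linear x N e.
  by apply: latlin_sum => k; apply: latlin_abs; exact: LatLinVar.
exists N, e; split=> // eps eps0.
have [g [z [Lg fg]]] := homogeneous_approx x hf eps0; exists g, z; split=> //.
have rowK (v : 'rV[R]_n) : \row_k v 0 k = v by apply/rowP => k; rewrite mxE.
have [hNg PNg] := Phi_ll _ _ (LatLinAdd eps LN Lg).
have [hNf PNf] := Phi_ll _ _ (latlinB Lg (latlinZ eps LN)).
apply: vabs_leP.
  rewrite vlerBlDr -PNg; apply: Phi_mono => // v.
  have := le_trans (ler_norm _) (fg (fun k => v 0 k)); rewrite rowK /col /N; lra.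
rewrite opprB vlerBlDr addrC -vlerBlDr -PNf; apply: Phi_mono => // v.
have := fg (fun k => v 0 k); rewrite -normrN rowK => /(le_trans (ler_norm _)).
rewrite /col /N; lra.
Qed.

(** Existence shows that the value of [hom_calculus] is never the default one. *)
Lemma hom_calculusP f : homogeneous_cont f ->
  calculus x (row_fun f) (hom_calculus x f).
Proof.
move=> hf; rewrite /hom_calculus; have [Phi hPhi] := hom_calculus_exists.
case: xgetP => [y _ [_ [Psi hPsi <-]]|/(_ (Phi f)) []].
  exact: is_hom_calculusP.
by split=> //; exists Phi.
Qed.

Lemma lp_sum_continuous (p : R) : 0 < p ->
  homogeneous_cont (fun v : 'rV[R]_n => (\sum_(k < n) `|v 0 k| `^ p) `^ p^-1).
Proof.
move=> p0; split=> [v|a v a0]; last first.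
  under eq_bigr do rewrite mxE normrM (ger0_norm a0) powRM //.
  rewrite -mulr_sumr powRM ?powR_ge0 ?powRK ?lt0r_neq0 //.
  by apply: sumr_ge0 => k _; exact: powR_ge0.
pose S (v : 'rV[R]_n) := \sum_(k < n) `|v 0 k| `^ p.
have -> : (fun v : 'rV[R]_n => (\sum_(k < n) `|v 0 k| `^ p) `^ p^-1) =
    (fun s : R => `|s| `^ p^-1) \o S.
  apply/funext => w /=; rewrite ger0_norm //.
  by apply: sumr_ge0 => k _; exact: powR_ge0.
apply: continuous_comp; last by apply: powR_norm_continuous; rewrite invr_gt0.
suff Sc : continuous S by exact: Sc.
have cont k : continuous (fun w : 'rV[R]_n => `|w 0 k| `^ p).
  move=> w; apply: (@continuous_comp _ _ _ (fun w : 'rV[R]_n => w 0 k)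
    (fun s : R => `|s| `^ p)); first exact: coord_continuous.
  exact: powR_norm_continuous.
rewrite /S; elim: (index_enum _) => [|k s IH].
  have -> : (fun w : 'rV[R]_n => \sum_(k <- [::]) `|w 0 k| `^ p) = fun=> 0.
    by apply/funext => w; rewrite big_nil.
  exact: cst_continuous.
have -> : (fun w : 'rV[R]_n => \sum_(j <- k :: s) `|w 0 j| `^ p) =
    (fun w : 'rV[R]_n => `|w 0 k| `^ p) + (fun w => \sum_(j <- s) `|w 0 j| `^ p).
  by apply/funext => w; rewrite big_cons.
by move=> w; exact: (continuousD (cont k w) (IH w)).
Qed.

Lemma lp_sumP (p : R) : 0 < p -> calculus x (lp_norm (p := p)) (lp_sum p x).
Proof.
move=> p0; apply: calculus_eq (hom_calculusP (lp_sum_continuous p0)) => v.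
by rewrite /row_fun /lp_norm; congr (_ `^ _); apply: eq_bigr => k _; rewrite mxE.
Qed.

End QuasiBanach.

(** * Normability and series *)

Section RealSeries.
Context {R : realType}.

Lemma bounded_sum_tail (a : nat -> R) (S e : R) : (forall j, 0 <= a j) ->
  (forall n, \sum_(j < n) a j <= S) -> 0 < e ->
  exists m : nat, forall i j : nat, (m <= i)%N -> (i <= j)%N -> \sum_(i <= k < j) a k < e.
Proof.
move=> a0 aS e0; pose A := [set \sum_(j < n) a j | n in [set: nat]].
have supA : has_sup A.
  split; first by exists (\sum_(j < 0) a j), 0%N.
  by exists S => _ [n _ <-].
have [_ [m _ <-] hm] := sup_adherent e0 supA.
exists m => i j mi ij.
have mon (k l : nat) : (k <= l)%N -> \sum_(j < k) a j <= \sum_(j < l) a j.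
  move=> kl; rewrite -!(big_mkord xpredT) (big_cat_nat (n := k) (p := l)) //=.
  by rewrite lerDl sumr_ge0.
have : \sum_(k < j) a k <= sup A by apply: sup_upper_bound => //; exists j.
rewrite -(big_mkord xpredT a) (big_cat_nat (n := i) (p := j)) //= big_mkord.
have := mon _ _ mi; lra.
Qed.

End RealSeries.

Section Normable.
Context {R : realType}.

(** Up to the constant [M], the power [r] of the quasi-norm is subadditive on
    families of any finite length. *)
Definition normable (r M : R) (X : qBanachLatticeType R) :=
  0 < M /\ forall (J : Type) (s : seq J) (u : J -> X),
    qnorm (\sum_(j <- s) u j) `^ r <= M * \sum_(j <- s) qnorm (u j) `^ r.

Context {X : qBanachLatticeType R}.
Implicit Types (x y : X).

(** For [p <= 1] the l1 norm is at most the lp norm, so convexity bounds sums. *)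
Lemma abs_sum_le_lp_sum (p : R) n (x : 'I_n -> X) : 0 < p -> p <= 1 ->
  vabs (\sum_k x k) <= lp_sum p x.
Proof.
move=> p0 p1; have Lx : lattice_linear x (fun v => \sum_k v k) (\sum_k x k).
  by apply: latlin_sum => k; exact: LatLinVar.
apply: (calculus_le qbanach_archimedean
  (latlin_calculus (latlin_abs Lx)) (lp_sumP x p0)) => v.
exact: ler_sum_lp_norm.
Qed.

Lemma pq_convex_power (p q : R) : 0 < q -> pq_convex p q X ->
  exists2 M : R, 0 < M & forall n (x : 'I_n -> X),
    qnorm (lp_sum p x) `^ q <= M * \sum_k qnorm (x k) `^ q.
Proof.
move=> q0 [M hM]; exists (`|M| `^ q + 1); first by rewrite ltr_wpDl ?powR_ge0.
move=> n x; have S0 : 0 <= \sum_k qnorm (x k) `^ q.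
  by apply: sumr_ge0 => k _; exact: powR_ge0.
have : qnorm (lp_sum p x) <= `|M| * (\sum_k qnorm (x k) `^ q) `^ q^-1.
  by apply: le_trans (hM n x) _; rewrite ler_wpM2r ?powR_ge0 // ler_norm.
move=> /(ler_powR2r (ltW q0) (qnorm_ge0 _))/le_trans; apply.
rewrite powRM ?powR_ge0 // powRVK ?lt0r_neq0 //.
by rewrite ler_wpM2r // lerDl.
Qed.

Lemma pq_convex_normable (p q : R) : 0 < q -> 0 < p -> p <= 1 ->
  pq_convex p q X -> exists M, normable q M X.
Proof.
move=> q0 p0 p1 /(pq_convex_power q0)[M M0 hM]; exists M; split=> // J s u.
rewrite big_tnth [in leRHS]big_tnth; apply: le_trans (hM _ _).
apply: ler_powR2r; rewrite ?(ltW q0) ?qnorm_ge0 //.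
by apply: qnorm_le; exact: abs_sum_le_lp_sum.
Qed.

Context {r M : R}.
Hypotheses (r0 : 0 < r) (XM : normable r M X).

Let M0 : 0 < M. Proof. by case: XM. Qed.

Lemma normableD x y : qnorm (x + y) `^ r <= M * (qnorm x `^ r + qnorm y `^ r).
Proof.
have := XM.2 bool [:: true; false] (fun b => if b then x else y).
by rewrite !big_cons !big_nil !addr0.
Qed.

Lemma normableB x y : qnorm (x - y) `^ r <= M * (qnorm x `^ r + qnorm y `^ r).
Proof. by have := normableD x (- y); rewrite qnormN. Qed.

Lemma qnorm_powR_small x (e : R) : 0 < e -> qnorm x `^ r < e `^ r -> qnorm x < e.
Proof.
move=> e0; apply: contraTT; rewrite -!leNgt => h.
by apply: ler_powR2r => //; exact: ltW.
Qed.

(** The tails of the series of the [r]-th powers control the increments of the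
    partial sums, which increase to their limit. *)
Lemma normable_series (u : nat -> X) (S : R) : (forall j, 0 <= u j) ->
  (forall n, \sum_(j < n) qnorm (u j) `^ r <= S) ->
  exists U, [/\ forall n, \sum_(j < n) u j <= U, qnorm U `^ r <= M * (M * S) &
    forall e : R, 0 < e -> exists m : nat, forall n : nat, (m <= n)%N ->
      qnorm (U - \sum_(j < n) u j) < e].
Proof.
move=> u0 uS; have tail := bounded_sum_tail (fun j => powR_ge0 (qnorm (u j)) r) uS.
have cat (i j : nat) : (i <= j)%N ->
    \sum_(k < j) u k = \sum_(k < i) u k + \sum_(i <= k < j) u k.
  by move=> ij; rewrite -!(big_mkord xpredT) (big_cat_nat (n := i)).
have small (e : R) : 0 < e -> exists m : nat, forall i j : nat, (m <= i)%N ->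
    (i <= j)%N -> qnorm (\sum_(j0 < j) u j0 - \sum_(j0 < i) u j0) < e.
  move=> e0; have [|m hm] := tail (e `^ r / M); first by rewrite divr_gt0 ?powR_gt0.
  exists m => i j mi ij; apply: qnorm_powR_small => //.
  rewrite (cat _ _ ij) addrC addKr; apply: le_lt_trans (XM.2 _ _ _) _.
  by rewrite mulrC -ltr_pdivlMr // hm.
have [|U [uU hU]] := @qbanach_cvg_incr _ X (fun n => \sum_(j < n) u j) _ small.
  move=> i j ij; rewrite (cat _ _ ij) -[leLHS]addr0 vlerD2l.
  by apply: vsum_ge0.
exists U; split=> //; apply/ler_addgt0Pl => e e0.
have [|m /(_ m (leqnn m)) hm] := hU ((e / M) `^ r^-1).
  by rewrite powR_gt0 // divr_gt0.
have : qnorm (U - \sum_(j < m) u j) `^ r <= e / M.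
  rewrite -powR_lerE ?qnorm_ge0 ?divr_ge0 ?(ltW e0) ?(ltW M0) //.
  exact: ltW.
rewrite ler_pdivlMr // mulrC => h.
have := normableD (\sum_(j < m) u j) (U - \sum_(j < m) u j).
rewrite addrC subrK => /le_trans; apply; rewrite mulrDr addrC lerD //.
rewrite ler_pM2l //; apply: le_trans (XM.2 _ _ _) _.
by rewrite ler_pM2l.
Qed.

End Normable.

(** * The ambient topological vector lattice *)

Section Ambient.
Context {R : realType} {E : topVectorLatticeType R}.
Hypothesis EH : hausdorff_space E.
Implicit Types x y z w : E.

(** By local solidity [z] lies in every neighbourhood of [0]. *)
Lemma solid_nbhs_eq0 z :
  (forall U : set E, nbhs 0 U -> exists2 w, U w & vabs z <= vabs w) -> z = 0.
Proof.
move=> h; apply/esym/EH => A B A0 Bz.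
have [S S0 [solS SA]] := locally_solid A A0.
have [w Sw zw] := h S S0; exists z; split; last exact: nbhs_singleton.
exact/SA/(solS _ _ zw Sw).
Qed.

Lemma ambient_archimedean : archimedean_lattice E.
Proof.
move=> x y xy; suff <- : x `v` 0 = 0 by exact: vler_joinl.
apply: solid_nbhs_eq0 => U U0.
have := @scale_continuous _ E (0 : R^o, vabs y) U; rewrite /= scale0r => /(_ U0).
move=> [[A B] [/= A0 By] AB].
have [d /= d0 dA] := (nbhs_ballP (0 : R^o) A).1 A0.
exists ((d / 2) *: vabs y).
  apply: (AB (d / 2, vabs y)); split=> /=; last exact: nbhs_singleton.
  by apply: dA; rewrite /ball /= sub0r normrN gtr0_norm ?divr_gt0 //; lra.
have d20 : 0 < d / 2 by rewrite divr_gt0.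
have dy0 : 0 <= (d / 2) *: vabs y by apply: vscale_ge0; [exact: ltW|exact: vabs_ge0].
rewrite (ger0_vabs dy0) (ger0_vabs (vler_joinr _ _)); apply: vjoin_lub => //.
apply: le_trans (xy _ d20) _; apply: vlerZ; [exact: ltW|exact: vle_abs].
Qed.

End Ambient.

(** * The K-functional of a couple *)

Section KFunctional.
Context {R : realType} {C : qb_couple R}.
Local Notation E := (ambient C).
Local Notation i0 := (@emb0 R C).
Local Notation i1 := (@emb1 R C).
Implicit Types (t s : R) (z w : E) (a : space0 C) (b : space1 C).

Lemma emb0_hom : lattice_homomorphism i0. Proof. by case: (emb0P C). Qed.
Lemma emb1_hom : lattice_homomorphism i1. Proof. by case: (emb1P C). Qed.

Let i0D := lhomD emb0_hom.
Let i1D := lhomD emb1_hom.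

(** Smallness in the sum of the two quasi-norms is the only form in which
    convergence enters the ambient lattice. *)
Lemma emb_small_eq0 z : (forall e : R, 0 < e -> exists a b,
    [/\ qnorm a <= e, qnorm b <= e & vabs z <= i0 a + i1 b]) -> z = 0.
Proof.
move=> h; apply: (solid_nbhs_eq0 (@ambient_hausdorff R C)) => U U0.
have := @add_continuous E (0, 0) U; rewrite /= addr0 => /(_ U0).
move=> [[A B] [/= A0 B0] AB].
have [_ _ _ /(_ 0 A)] := emb0P C; rewrite (lhom0 emb0_hom) => /(_ A0) [d /= d0 dA].
have [_ _ _ /(_ 0 B)] := emb1P C; rewrite (lhom0 emb1_hom) => /(_ B0) [d' /= d'0 dB].
pose e := Num.min d d' / 2.
have m0 : 0 < Num.min d d' by rewrite lt_min d0.
have e0 : 0 < e by rewrite divr_gt0.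
have em : e < Num.min d d' by rewrite /e; lra.
have [a [b [ae be zab]]] := h e e0; exists (i0 a + i1 b).
  apply: (AB (i0 a, i1 b)); split => /=.
    apply: dA; rewrite /= subr0; apply: le_lt_trans ae _.
    by apply: lt_le_trans em _; rewrite ge_min lexx.
  apply: dB; rewrite /= subr0; apply: le_lt_trans be _.
  by apply: lt_le_trans em _; rewrite ge_min lexx orbT.
exact: le_trans zab (vle_abs _).
Qed.

(** Riesz decomposition, available because the embeddings are interval
    preserving. *)
Lemma riesz_pos z a b : 0 <= z -> 0 <= a -> 0 <= b -> z <= i0 a + i1 b ->
  exists a' b', [/\ 0 <= a', a' <= a, 0 <= b', b' <= b & z = i0 a' + i1 b'].
Proof.
move=> z0 a0 b0 zab.
have [_ ip0 _ _] := emb0P C; have [_ ip1 _ _] := emb1P C.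
have [a' /= /andP[a'0 a'a] a'E] : (i0 @` [set y | 0 <= y <= a]) (z `^` i0 a).
  rewrite ip0 //=; apply/andP; split; last exact: vmeet_ler.
  by apply: vmeet_glb => //; exact: (lhom_ge0 emb0_hom).
have [b' /= /andP[b'0 b'b] b'E] : (i1 @` [set y | 0 <= y <= b]) (z - z `^` i0 a).
  rewrite ip1 //= vsubr_ge0 vmeet_lel /= vlerBlDr addrC -vlerBlDr.
  apply: vmeet_glb; last by rewrite vlerBlDr.
  by rewrite vlerBlDr -[leLHS]addr0 vlerD2l; exact: (lhom_ge0 emb1_hom).
by exists a', b'; split=> //; rewrite a'E b'E addrC subrK.
Qed.

(** Both parts of [z] are decomposed; since the pieces of the two parts lie in the
    same order interval, their differences obey the same bound. *)
Lemma riesz_abs z a b : vabs z <= i0 a + i1 b ->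
  exists a' b', [/\ vabs a' <= vabs a, vabs b' <= vabs b & z = i0 a' + i1 b'].
Proof.
move=> zab.
have {}zab : vabs z <= i0 (vabs a) + i1 (vabs b).
  apply: le_trans zab _; rewrite vlerD //.
    exact/(lhom_le emb0_hom)/vle_abs.
  exact/(lhom_le emb1_hom)/vle_abs.
have zp : z `v` 0 <= i0 (vabs a) + i1 (vabs b).
  exact: le_trans (vpos_le_abs _) zab.
have zn : (- z) `v` 0 <= i0 (vabs a) + i1 (vabs b).
  by apply: le_trans (vpos_le_abs _) _; rewrite vabsN.
have [a1 [b1 [a10 a1a b10 b1b E1]]] :=
  riesz_pos (vler_joinr _ _) (vabs_ge0 a) (vabs_ge0 b) zp.
have [a2 [b2 [a20 a2a b20 b2b E2]]] :=
  riesz_pos (vler_joinr _ _) (vabs_ge0 a) (vabs_ge0 b) zn.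
exists (a1 - a2), (b1 - b2); split; try exact: vabs_dist_pos.
rewrite (lhomB emb0_hom) (lhomB emb1_hom) {1}[z]vpos_sub E1 E2.
by rewrite opprD addrACA.
Qed.

(** The K-functional as a function on the ambient lattice, where elements of the
    two spaces, of the sum and of intermediate lattices can be compared. *)
Definition Kfunc t z : R := inf [set qnorm y.1 + t * qnorm y.2 |
  y in [set y : space0 C * space1 C | i0 y.1 + i1 y.2 = z]].

Lemma KfunE t (x : Sigma C) : Kfun t x = Kfunc t (val x).
Proof. by []. Qed.

Lemma sigma_val (x : Sigma C) : sigma_set (val x).
Proof. by have := valP x; rewrite inE. Qed.

Lemma sigma_emb a b : sigma_set (i0 a + i1 b).
Proof. by exists (a, b). Qed.

Lemma sigma_emb0 a : sigma_set (i0 a).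
Proof. by have := sigma_emb a 0; rewrite (lhom0 emb1_hom) addr0. Qed.

Lemma sigma_emb1 b : sigma_set (i1 b).
Proof. by have := sigma_emb 0 b; rewrite (lhom0 emb0_hom) add0r. Qed.

Lemma sigma_add z w : sigma_set z -> sigma_set w -> sigma_set (z + w).
Proof.
move=> [[a b] _ <-] [[a' b'] _ <-]; exists (a + a', b + b') => //=.
by rewrite i0D i1D addrACA.
Qed.

Lemma sigma_scale (c : R) z : sigma_set z -> sigma_set (c *: z).
Proof.
move=> [[a b] _ <-]; exists (c *: a, c *: b) => //=.
by rewrite (lhomZ emb0_hom) (lhomZ emb1_hom) scalerDr.
Qed.

Lemma sigma_solid z w : sigma_set w -> vabs z <= vabs w -> sigma_set z.
Proof.
move=> [[a b] _ <-] zw; have [|a' [b' [_ _ ->]]] := @riesz_abs z (vabs a) (vabs b).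
  apply: le_trans zw _; rewrite (lhom_abs emb0_hom) (lhom_abs emb1_hom).
  exact: vabsD.
exact: sigma_emb.
Qed.

Section FixedParameter.
Context {t : R}.
Hypothesis t0 : 0 <= t.

Let Kset z := [set qnorm y.1 + t * qnorm y.2 |
  y in [set y : space0 C * space1 C | i0 y.1 + i1 y.2 = z]].

Let Kset_lb z : lbound (Kset z) 0.
Proof. by move=> _ [y _ <-]; rewrite addr_ge0 ?mulr_ge0 ?qnorm_ge0. Qed.

Let Kset_inf z : sigma_set z -> has_inf (Kset z).
Proof.
move=> [y _ yz]; split; last by exists 0.
by exists (qnorm y.1 + t * qnorm y.2); exists y; [exact: yz|by []].
Qed.

Lemma Kfunc_ge0 z : sigma_set z -> 0 <= Kfunc t z.
Proof. by move=> /Kset_inf[ne _]; apply: (lb_le_inf ne (Kset_lb (z := z))). Qed.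

Lemma Kfunc_le a b : Kfunc t (i0 a + i1 b) <= qnorm a + t * qnorm b.
Proof.
apply: (@ge_inf _ (Kset (i0 a + i1 b))); first by exists 0; exact: Kset_lb.
by exists (a, b).
Qed.

Lemma Kfunc_le_dominated z a b : vabs z <= i0 a + i1 b ->
  Kfunc t z <= qnorm a + t * qnorm b.
Proof.
move=> /riesz_abs[a' [b' [a'a b'b ->]]]; apply: le_trans (Kfunc_le _ _) _.
by rewrite lerD ?ler_wpM2l ?qnorm_lattice.
Qed.

Lemma Kfunc_decomp z c : sigma_set z -> Kfunc t z < c ->
  exists a b, z = i0 a + i1 b /\ qnorm a + t * qnorm b < c.
Proof.
move=> zS Kc; have e0 : 0 < c - Kfunc t z by rewrite subr_gt0.
have [_ [[a b] /= zE <-] h] := inf_adherent e0 (Kset_inf zS).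
exists a, b; split=> //; apply: lt_le_trans h _.
have -> : inf (Kset z) = Kfunc t z by [].
by rewrite addrC subrK.
Qed.

Lemma Kfunc_decomp_pos z c : sigma_set z -> 0 <= z -> Kfunc t z < c ->
  exists a b, [/\ 0 <= a, 0 <= b, z = i0 a + i1 b & qnorm a + t * qnorm b < c].
Proof.
move=> zS z0 /(Kfunc_decomp zS)[a [b [zE ab]]].
have [|a' [b' [a'0 a'a b'0 b'b zE']]] :=
    @riesz_pos z (vabs a) (vabs b) z0 (vabs_ge0 _) (vabs_ge0 _).
  rewrite zE vlerD //.
    exact/(lhom_le emb0_hom)/vle_abs.
  exact/(lhom_le emb1_hom)/vle_abs.
exists a', b'; split=> //; apply: le_lt_trans ab.
by rewrite lerD ?ler_wpM2l // qnorm_lattice // ger0_vabs.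
Qed.

Lemma Kfunc_solid z w : sigma_set w -> vabs z <= vabs w ->
  Kfunc t z <= Kfunc t w.
Proof.
move=> wS zw; apply/ler_addgt0Pl => e e0.
have [|a [b [wE ab]]] := @Kfunc_decomp w (Kfunc t w + e) wS; first by rewrite ltrDl.
rewrite addrC; apply: le_trans (ltW ab); rewrite -(qnorm_abs a) -(qnorm_abs b).
apply: Kfunc_le_dominated; apply: le_trans zw _.
by rewrite wE (lhom_abs emb0_hom) (lhom_abs emb1_hom); exact: vabsD.
Qed.

Lemma Kfunc_abs z : sigma_set z -> Kfunc t (vabs z) = Kfunc t z.
Proof.
move=> zS; apply/le_anti; rewrite !Kfunc_solid ?vabs_id //.
by apply: sigma_solid zS _; rewrite vabs_id.
Qed.

Lemma KfuncZ (c : R) z : sigma_set z -> Kfunc t (c *: z) <= `|c| * Kfunc t z.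
Proof.
move=> zS; apply/ler_addgt0Pl => e e0.
have c0 : 0 < `|c| + 1 by rewrite ltr_wpDl.
have d0 : 0 < e / (`|c| + 1) by rewrite divr_gt0.
have [|a [b [wE ab]]] := @Kfunc_decomp z (Kfunc t z + e / (`|c| + 1)) zS.
  by rewrite ltrDl.
rewrite wE scalerDr -(lhomZ emb0_hom) -(lhomZ emb1_hom).
apply: le_trans (Kfunc_le _ _) _; rewrite !qnormZ mulrCA -mulrDr.
apply: le_trans (ler_wpM2l (normr_ge0 c) (ltW ab)) _.
rewrite -wE mulrDr addrC lerD2r mulrA ler_pdivrMr // mulrC ler_pM2l //.
by rewrite lerDl.
Qed.

Lemma KfuncZ_pos (c : R) z : 0 < c -> sigma_set z ->
  Kfunc t (c *: z) = c * Kfunc t z.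
Proof.
move=> c0 zS; apply/le_anti/andP; split.
  by apply: le_trans (KfuncZ _ zS) _; rewrite gtr0_norm.
rewrite -ler_pdivlMl // -{1}[z]scale1r -(mulVf (lt0r_neq0 c0)) -scalerA.
apply: le_trans (KfuncZ _ (sigma_scale _ zS)) _.
by rewrite gtr0_norm // invr_gt0.
Qed.

Lemma Kfunc0 : Kfunc t 0 = 0.
Proof.
have S0 : sigma_set (0 : E).
  by exists (0, 0) => //=; rewrite (lhom0 emb0_hom) (lhom0 emb1_hom) addr0.
apply/le_anti; rewrite Kfunc_ge0 // andbT.
have := @Kfunc_le 0 0; rewrite (lhom0 emb0_hom) (lhom0 emb1_hom) addr0.
by rewrite !qnorm0 mulr0 addr0.
Qed.

End FixedParameter.

Lemma Kfunc_emb0 t a : 0 <= t -> Kfunc t (i0 a) <= qnorm a.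
Proof.
move=> t0; have := @Kfunc_le t t0 a 0.
by rewrite (lhom0 emb1_hom) qnorm0 mulr0 !addr0.
Qed.

Lemma Kfunc_emb1 t b : 0 <= t -> Kfunc t (i1 b) <= t * qnorm b.
Proof.
move=> t0; have := @Kfunc_le t t0 0 b.
by rewrite (lhom0 emb0_hom) qnorm0 !add0r.
Qed.

Lemma Kfunc_mono s t z : 0 <= s -> s <= t -> sigma_set z ->
  Kfunc s z <= Kfunc t z.
Proof.
move=> s0 st zS; apply/ler_addgt0Pl => e e0.
have [||a [b [zE ab]]] := @Kfunc_decomp t _ z (Kfunc t z + e) zS.
- exact: le_trans st.
- by rewrite ltrDl.
rewrite addrC; apply: le_trans (ltW ab); rewrite zE.
apply: le_trans (Kfunc_le s0 _ _) _.
by rewrite lerD2l ler_wpM2r ?qnorm_ge0.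
Qed.

Lemma Kfunc_quasi s t z : 0 < s -> s <= t -> sigma_set z ->
  Kfunc t z <= (t / s) * Kfunc s z.
Proof.
move=> s0 st zS; apply/ler_addgt0Pl => e e0.
have t0 : 0 < t by exact: lt_le_trans st.
have d0 : 0 < e / (t / s) by rewrite !divr_gt0.
have [||a [b [zE ab]]] := @Kfunc_decomp s _ z (Kfunc s z + e / (t / s)) zS.
- exact: ltW.
- by rewrite ltrDl.
rewrite {1}zE; apply: le_trans (Kfunc_le (ltW t0) _ _) _.
have ts0 : 0 < t / s by rewrite divr_gt0.
have -> : e + t / s * Kfunc s z = (t / s) * (Kfunc s z + e / (t / s)).
  by field; rewrite !lt0r_neq0.
apply: le_trans (ler_wpM2l (ltW ts0) (ltW ab)); rewrite mulrDr mulrA divfK ?lt0r_neq0 //.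
by rewrite lerD2r ler_peMl ?qnorm_ge0 // ler_pdivlMr // mul1r.
Qed.

Lemma Kfunc1_eq0 z : sigma_set z -> Kfunc 1 z <= 0 -> z = 0.
Proof.
move=> zS K0; apply: emb_small_eq0 => e e0.
have [|a [b [zE ab]]] := @Kfunc_decomp 1 ler01 z e zS; first exact: le_lt_trans e0.
move: ab; rewrite mul1r => ab; exists (vabs a), (vabs b); rewrite !qnorm_abs; split.
- by have := qnorm_ge0 b; lra.
- by have := qnorm_ge0 a; lra.
- by rewrite zE (lhom_abs emb0_hom) (lhom_abs emb1_hom); exact: vabsD.
Qed.

(** ** Countable p-subadditivity *)

Context {p M : R}.
Hypotheses (p0 : 0 < p) (p1 : p <= 1).
Hypotheses (M0 : normable p M (space0 C)) (M1 : normable p M (space1 C)).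

Let Mpos : 0 < M. Proof. by case: M0. Qed.

Lemma Kfunc_decomp_pow t z c : 0 <= t -> sigma_set z -> Kfunc t z `^ p < c ->
  exists a b, z = i0 a + i1 b /\ (qnorm a + t * qnorm b) `^ p < c.
Proof.
move=> t0 zS Kc.
have c0 : 0 < c by apply: le_lt_trans Kc; exact: powR_ge0.
have [|a [b [zE ab]]] := @Kfunc_decomp t t0 z (c `^ p^-1) zS.
  rewrite -[ltLHS](@powRK _ p) ?lt0r_neq0 ?Kfunc_ge0 //.
  by apply: gt0_ltr_powR; rewrite ?invr_gt0 ?nnegrE ?powR_ge0 // ltW.
exists a, b; split=> //; rewrite -[c](@powRVK _ p) ?lt0r_neq0 ?(ltW c0) //.
apply: gt0_ltr_powR; rewrite ?nnegrE ?powR_ge0 //.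
by rewrite addr_ge0 ?mulr_ge0 ?qnorm_ge0.
Qed.

(** Apply the hypothesis to near-optimal decompositions of the [z j]. *)
Lemma Kfunc_family (N : R) (J : Type) (l : seq J) (z : J -> E) w t :
  0 < N -> 0 <= t -> (forall j, sigma_set (z j)) ->
  (forall (a : J -> space0 C) (b : J -> space1 C),
    (forall j, z j = i0 (a j) + i1 (b j)) -> exists A B,
    [/\ vabs w <= i0 A + i1 B, qnorm A `^ p <= N * \sum_(j <- l) qnorm (a j) `^ p &
        qnorm B `^ p <= N * \sum_(j <- l) qnorm (b j) `^ p]) ->
  Kfunc t w `^ p <= 2 * N * \sum_(j <- l) Kfunc t (z j) `^ p.
Proof.
move=> N0 t0 zS wab; apply/ler_addgt0Pl => e e0.
have n0 : 0 < 2 * N * (size l)%:R + 1 by rewrite ltr_wpDl ?mulr_ge0 // ltW.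
pose d := e / (2 * N * (size l)%:R + 1); have d0 : 0 < d by rewrite divr_gt0.
have /choice[ab abP] j : exists ab : space0 C * space1 C,
    z j = i0 ab.1 + i1 ab.2 /\
    (qnorm ab.1 + t * qnorm ab.2) `^ p < Kfunc t (z j) `^ p + d.
  have [|a [b abj]] := @Kfunc_decomp_pow t (z j) (Kfunc t (z j) `^ p + d) t0 (zS j).
    by rewrite ltrDl.
  by exists (a, b).
have [A [B [wAB hA hB]]] :=
  wab (fun j => (ab j).1) (fun j => (ab j).2) (fun j => (abP j).1).
have wS : sigma_set w.
  apply: sigma_solid (sigma_emb A B) _.
  exact: le_trans wAB (vle_abs _).
apply: le_trans (ler_powR2r (ltW p0) _ (Kfunc_le_dominated t0 wAB)) _.
  exact: Kfunc_ge0.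
apply: le_trans (powR_subadd p0 p1 _ _) _; rewrite ?mulr_ge0 ?qnorm_ge0 //.
rewrite powRM ?qnorm_ge0 //.
apply: le_trans (lerD hA (ler_wpM2l (powR_ge0 t p) hB)) _.
rewrite mulrCA -mulrDr mulr_sumr -big_split /=.
apply: (@le_trans _ _ (N * \sum_(j <- l) 2 * (Kfunc t (z j) `^ p + d))).
  rewrite ler_pM2l //; apply: ler_sum => j _.
  have [_ /ltW hj] := abP j; rewrite mulrDl mul1r.
  have q0 := qnorm_ge0 (ab j).1; have q1 := qnorm_ge0 (ab j).2.
  apply: lerD; apply: le_trans hj.
    by apply: ler_powR2r; rewrite ?(ltW p0) // lerDl mulr_ge0.
  rewrite -powRM //; apply: ler_powR2r; rewrite ?(ltW p0) ?mulr_ge0 //.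
  by rewrite lerDr.
rewrite -mulr_sumr mulrA (mulrC N) big_split /= mulrDr addrC lerD2r.
rewrite big_const_seq count_predT iter_addr_0 -(mulr_natr d) mulrCA.
rewrite /d mulrAC ler_pdivrMr //; apply: ler_wpM2l; first exact: ltW.
by rewrite lerDl.
Qed.

Lemma Kfunc_sum (J : Type) (l : seq J) (z : J -> E) t : 0 <= t ->
  (forall j, sigma_set (z j)) ->
  Kfunc t (\sum_(j <- l) z j) `^ p <= 2 * M * \sum_(j <- l) Kfunc t (z j) `^ p.
Proof.
move=> t0 zS; apply: Kfunc_family => // a b zE.
exists (\sum_(j <- l) vabs (a j)), (\sum_(j <- l) vabs (b j)); split.
- rewrite (lhom_sum emb0_hom) (lhom_sum emb1_hom) -big_split /=.
  apply: le_trans (vabs_sum _ _ _) _; apply: vsum_le => j _.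
  by rewrite zE (lhom_abs emb0_hom) (lhom_abs emb1_hom); exact: vabsD.
- apply: le_trans (M0.2 _ _ _) _; rewrite ler_pM2l //.
  by apply: ler_sum => j _; rewrite qnorm_abs.
- apply: le_trans (M1.2 _ _ _) _; rewrite ler_pM2l //.
  by apply: ler_sum => j _; rewrite qnorm_abs.
Qed.

(** The remainder of the series is small in the sum of the two spaces, so its
    K-functional tends to zero. *)
Lemma Kfunc_lim t (S : R) z (u : nat -> E) : 0 <= t -> (forall j, sigma_set (u j)) ->
  (forall n, \sum_(j < n) Kfunc t (u j) `^ p <= S) ->
  (forall e : R, 0 < e -> exists n a b, [/\ qnorm a <= e, qnorm b <= e &
     z = \sum_(j < n) u j + (i0 a + i1 b)]) ->
  Kfunc t z `^ p <= 2 * M * (2 * M * S).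
Proof.
move=> t0 uS KS lim; apply/ler_addgt0Pl => e e0.
have M20 : 0 < 2 * M by rewrite mulr_gt0.
pose d := (e / (2 * M)) `^ p^-1 / (1 + t).
have t10 : 0 < 1 + t by rewrite ltr_wpDr.
have d0 : 0 < d by rewrite divr_gt0 ?powR_gt0 ?divr_gt0.
have [n [a [b [ad bd zE]]]] := lim d d0.
pose w (c : bool) := if c then \sum_(j < n) u j else i0 a + i1 b.
have wS c : sigma_set (w c).
  case: c; last exact: sigma_emb.
  rewrite /w; elim/big_rec: _ => [|j y _ yS]; last exact: sigma_add.
  by exists (0, 0) => //=; rewrite (lhom0 emb0_hom) (lhom0 emb1_hom) addr0.
have := @Kfunc_sum bool [:: true; false] w t t0 wS.
rewrite !big_cons !big_nil !addr0 /= -zE => /le_trans; apply.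
rewrite mulrDr addrC lerD //; last first.
  rewrite ler_pM2l //; apply: le_trans (Kfunc_sum (z := fun j : 'I_n => u j) _ t0 (fun j => uS j)) _.
  by rewrite ler_pM2l //; exact: KS.
rewrite -ler_pdivlMl // mulrC.
have -> : e / (2 * M) = ((e / (2 * M)) `^ p^-1) `^ p.
  by rewrite powRVK ?lt0r_neq0 ?divr_ge0 // ltW.
apply: ler_powR2r; rewrite ?(ltW p0) ?Kfunc_ge0 //; first exact: (wS false).
apply: le_trans (Kfunc_le t0 _ _) _.
apply: le_trans (lerD ad (ler_wpM2l t0 bd)) _.
by rewrite -{1}[d]mul1r -mulrDl /d mulrC divfK ?lt0r_neq0.
Qed.

End KFunctional.

Section Swap.
Context {R : realType}.

(** Exchanging the two spaces turns statements on [t >= 1] into statements on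
    [t <= 1]. *)
Definition swap_couple (C : qb_couple R) : qb_couple R :=
  QBCouple (@ambient_hausdorff R C) (emb1P C) (emb0P C).

Context {C : qb_couple R}.

Lemma sigma_swap (z : ambient C) :
  sigma_set z -> sigma_set (C := swap_couple C) z.
Proof. by move=> [[a b] _ <-]; exists (b, a) => //=; rewrite addrC. Qed.

Lemma Kfunc_swap (t : R) (z : ambient C) : 0 < t -> sigma_set z ->
  Kfunc (C := swap_couple C) t z = t * Kfunc t^-1 z.
Proof.
move=> t0 zS; have tV0 : 0 <= t^-1 by rewrite invr_ge0 ltW.
apply/le_anti/andP; split.
  rewrite -ler_pdivrMl //; apply/ler_addgt0Pl => e e0.
  have [|a [b [zE ab]]] := @Kfunc_decomp _ C _ tV0 z (Kfunc t^-1 z + e) zS.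
    by rewrite ltrDl.
  rewrite ler_pdivrMl // addrC.
  apply: le_trans (_ : t * (qnorm a + t^-1 * qnorm b) <= _); last first.
    by rewrite ler_pM2l // ltW.
  rewrite mulrDr mulrA divff ?lt0r_neq0 // mul1r addrC zE [X in Kfunc _ X]addrC.
  exact: (@Kfunc_le _ (swap_couple C) t (ltW t0) b a).
apply/ler_addgt0Pl => e e0.
have [|b [a [zE ab]]] := @Kfunc_decomp _ (swap_couple C) t (ltW t0) z
  (Kfunc (C := swap_couple C) t z + e) (sigma_swap zS); first by rewrite ltrDl.
rewrite addrC; apply: le_trans (ltW ab).
have -> : qnorm b + t * qnorm a = t * (qnorm a + t^-1 * qnorm b).
  by field; rewrite lt0r_neq0.
rewrite ler_pM2l // {1}zE addrC; exact: Kfunc_le.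
Qed.

End Swap.

(** * Intermediate lattices *)

Section Intermediate.
Context {R : realType} {C : qb_couple R} {X : qBanachLatticeType R}.
Variable I : intermediate C X.
Local Notation E := (ambient C).
Local Notation i0 := (@emb0 R C).
Local Notation i1 := (@emb1 R C).

(** Intermediate lattices are studied through their image in the ambient one. *)
Definition emb (x : X) : E := val (sigma_incl I x).

Lemma sigma_lift (z : E) : sigma_set z -> exists x : Sigma C, val x = z.
Proof.
move=> zS; have zS' : z \in [in sigma_set (C := C)] by rewrite inE.
by exists (@SubVLattice _ _ (VSublattice (sigma_submod C) (@sigma_meet R C)
  (@sigma_join R C)) z zS').
Qed.

Lemma emb_sigma x : sigma_set (emb x). Proof. exact: sigma_val. Qed.

Lemma emb_hom : lattice_homomorphism emb.
Proof.
have [hl hj hm] := sigma_incl_hom I; split=> [a x y|x y|x y].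
- by rewrite /emb hl linearP.
- by rewrite /emb hj.
- by rewrite /emb hm.
Qed.

Lemma emb_inj : injective emb.
Proof. by move=> x y /val_inj; exact: sigma_incl_inj. Qed.

Lemma emb_interval (w : E) (y : X) : 0 <= y -> 0 <= w -> w <= emb y ->
  exists x : X, [/\ 0 <= x, x <= y & emb x = w].
Proof.
move=> y0 w0 wy.
have [|s sw] := @sigma_lift w.
  apply: sigma_solid (emb_sigma y) _.
  by rewrite (ger0_vabs w0); exact: le_trans wy (vle_abs _).
have [x /= /andP[x0 xy] xs] : (sigma_incl I @` [set x | 0 <= x <= y]) s.
  rewrite sigma_incl_interval //= -!Order.le_val.
  by change (is_true (0 <= val s <= emb y)); rewrite sw w0.
by exists x; split=> //; rewrite /emb xs.
Qed.

(** The image is an ideal because the inclusion is interval preserving. *)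
Lemma emb_solid (z : E) (y : X) : vabs z <= emb y ->
  exists2 x : X, emb x = z & vabs x <= y.
Proof.
move=> zy; have y0 : 0 <= y.
  apply: (lhom_le_inj emb_hom emb_inj); rewrite (lhom0 emb_hom).
  exact: le_trans (vabs_ge0 _) zy.
have [||x1 [x10 x1y E1]] := @emb_interval (z `v` 0) y y0.
- exact: vler_joinr.
- exact: le_trans (vpos_le_abs _) zy.
have [||x2 [x20 x2y E2]] := @emb_interval ((- z) `v` 0) y y0.
- exact: vler_joinr.
- by apply: le_trans (vpos_le_abs _) _; rewrite vabsN.
exists (x1 - x2); last exact: vabs_dist_pos.
by rewrite (lhomB emb_hom) E1 E2 -vpos_sub.
Qed.

(** Continuity at [0] gives a bound by homogeneity. *)
Lemma emb_bounded : exists2 c : R, 0 < c &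
  forall x t, 0 <= t -> Kfunc t (emb x) <= Num.max 1 t * (c * qnorm x).
Proof.
have sn (s : Sigma C) : sigma_norm s = Kfunc 1 (val s).
  rewrite /sigma_norm /Kfunc; congr (inf _); apply: eq_imagel => y _.
  by rewrite mul1r.
have := @sigma_incl_cont _ _ _ I 0 [set s | Kfunc 1 (val s) < 1].
rewrite (lhom0 (sigma_incl_hom I)) => -[|d /= d0 dP].
  by exists 1 => //= s /=; rewrite subr0 sn.
have K1 x : Kfunc 1 (emb x) <= 2 / d * qnorm x.
  have [x0|x0] := eqVneq (qnorm x) 0.
    rewrite x0 mulr0 (qnorm0_eq0 _ x0) (lhom0 emb_hom).
    by rewrite Kfunc0.
  have xp : 0 < qnorm x by rewrite lt_def x0 qnorm_ge0.
  pose a := d / 2 / qnorm x; have a0 : 0 < a by rewrite !divr_gt0.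
  have := dP (a *: x); rewrite /= subr0 qnormZ_ge0 ?(ltW a0) // divfK // => h.
  have {}h : Kfunc 1 (emb (a *: x)) < 1 by apply: h; lra.
  have -> : x = a^-1 *: (a *: x) by rewrite scalerA mulVf ?scale1r ?lt0r_neq0.
  rewrite (lhomZ emb_hom); apply: le_trans (KfuncZ ler01 _ (emb_sigma _)) _.
  rewrite ger0_norm ?invr_ge0 ?(ltW a0) // scalerA mulVf ?lt0r_neq0 // scale1r.
  have -> : 2 / d * qnorm x = a^-1 * 1.
    by rewrite mulr1 /a; field; rewrite !lt0r_neq0.
  by rewrite ler_pM2l ?invr_gt0 // ltW.
exists (2 / d) => [|x t t0]; first by rewrite divr_gt0.
have [t1|t1] := leP t 1.
  by rewrite mul1r; apply: le_trans (K1 x); exact: Kfunc_mono t0 t1 (emb_sigma x).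
apply: le_trans (Kfunc_quasi ltr01 (ltW t1) (emb_sigma x)) _.
by rewrite divr1 ler_wpM2l.
Qed.

Context {p : R}.
Hypotheses (p0 : 0 < p) (p1 : p <= 1).

Lemma lp_sum_ge0 (Y : qBanachLatticeType R) n (x : 'I_n -> Y) :
  0 <= lp_sum p x.
Proof.
apply: (calculus_ge0 qbanach_archimedean (lp_sumP x p0)) => v.
exact: lp_norm_ge0.
Qed.

Lemma ambient_arch : archimedean_lattice E.
Proof. exact/ambient_archimedean/ambient_hausdorff. Qed.

(** The real inequality between the lp norm of [a + b] and a multiple of the sum
    of those of [a] and [b] is transferred to the ambient lattice. *)
Lemma emb_lp_sum_le n (x : 'I_n -> X) (a : 'I_n -> space0 C) (b : 'I_n -> space1 C) :
  (forall k, emb (x k) = i0 (a k) + i1 (b k)) ->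
  vabs (emb (lp_sum p x)) <=
    i0 (2 `^ p^-1 *: lp_sum p a) + i1 (2 `^ p^-1 *: lp_sum p b).
Proof.
move=> xab; rewrite ger0_vabs; last first.
  exact/(lhom_ge0 emb_hom)/lp_sum_ge0.
rewrite (lhomZ (@emb0_hom R C)) (lhomZ (@emb1_hom R C)) -scalerDr.
pose u (s : 'I_n + 'I_n) := match s with inl k => i0 (a k) | inr k => i1 (b k) end.
have cx := calculus_hom emb_hom (lp_sumP x p0).
have ca := calculus_hom (@emb0_hom R C) (lp_sumP a p0).
have cb := calculus_hom (@emb1_hom R C) (lp_sumP b p0).
have {}cx := calculus_subst (y := u) (h := fun k v => v (inl k) + v (inr k))
  (fun k => latlin_eq (fun=> erefl) (esym (xab k))
     (latlinD (LatLinVar u (inl k)) (LatLinVar u (inr k)))) cx.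
have {}ca := calculus_subst (y := u) (h := fun k v => v (inl k))
  (fun k => LatLinVar u (inl k)) ca.
have {}cb := calculus_subst (y := u) (h := fun k v => v (inr k))
  (fun k => LatLinVar u (inr k)) cb.
apply: (calculus_le ambient_arch cx (calculusZ _ (calculusD ca cb))) => v.
exact: lp_normD_le.
Qed.

(** Here convexity of the couple is used with lp sums, not just with sums: the
    lp sums of the two halves of near-optimal splittings are bounded in the two
    spaces. *)
Lemma Kfunc_lp_sum : p_convex_couple p C -> exists2 c : R, 0 < c &
  forall n (x : 'I_n -> X) t, 0 <= t ->
    Kfunc t (emb (lp_sum p x)) `^ p <= c * \sum_k Kfunc t (emb (x k)) `^ p.
Proof.
move=> [/(pq_convex_power p0)[M M0 hM] /(pq_convex_power p0)[M' M'0 hM']].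
have N0 : 0 < 2 * (M + M') by rewrite mulr_gt0 ?addr_gt0.
exists (2 * (2 * (M + M'))); first by rewrite mulr_gt0.
move=> n x t t0; apply: (Kfunc_family p0 p1) => //; first by move=> k; exact: emb_sigma.
move=> a b xab; do 2!eexists; split; first exact: emb_lp_sum_le xab.
  rewrite qnormZ_ge0 ?powR_ge0 // powRM ?powR_ge0 ?qnorm_ge0 //.
  rewrite powRVK ?lt0r_neq0 // -mulrA ler_pM2l //; apply: le_trans (hM _ _) _.
  rewrite ler_wpM2r //; last by rewrite lerDl ltW.
  by apply: sumr_ge0 => k _; exact: powR_ge0.
rewrite qnormZ_ge0 ?powR_ge0 // powRM ?powR_ge0 ?qnorm_ge0 //.
rewrite powRVK ?lt0r_neq0 // -mulrA ler_pM2l //; apply: le_trans (hM' _ _) _.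
rewrite ler_wpM2r //; last by rewrite lerDr ltW.
by apply: sumr_ge0 => k _; exact: powR_ge0.
Qed.

End Intermediate.

(** * Infinite lp sums and uniform constants *)

Section InfiniteLpSum.
Context {R : realType} {X : qBanachLatticeType R} {p q : R}.
Hypotheses (p0 : 0 < p) (p1 : p <= 1) (q0 : 0 < q).

Lemma lp_sum_reindex (m n : nat) (x : 'I_n -> X) (y : 'I_m -> X)
    (h : 'I_n -> ('I_m -> R) -> R) :
  (forall k, lattice_linear y (h k) (x k)) ->
  calculus y (fun v => lp_norm (p := p) (fun k => h k v)) (lp_sum p x).
Proof. by move=> hk; exact: (calculus_subst hk (lp_sumP x p0)). Qed.

Variable x : nat -> X.

Let Y n := lp_sum p (fun k : 'I_n => x k).

Let Y_widen n m (nm : (n <= m)%N) : calculus (fun k : 'I_m => x k)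
  (fun v => lp_norm (p := p) (fun k => v (widen_ord nm k))) (Y n).
Proof. by apply: lp_sum_reindex => k; exact: (LatLinVar _ (widen_ord nm k)). Qed.

Let widen_sum n m (nm : (n <= m)%N) (v : 'I_m -> R) :
  \sum_k `|v (widen_ord nm k)| `^ p = \sum_(k < m | (k < n)%N) `|v k| `^ p.
Proof. by rewrite (big_ord_narrow nm). Qed.

Lemma lp_sum_prefix_le n m : (n <= m)%N -> Y n <= Y m.
Proof.
move=> nm; apply: (calculus_le qbanach_archimedean (Y_widen nm) (lp_sumP _ p0)) => v.
apply: ler_powR2r; [by rewrite invr_ge0 ltW|exact: sum_powR_ge0|].
rewrite widen_sum [leRHS](bigID (fun k : 'I_m => (k < n)%N)) /= lerDl.
by apply: sumr_ge0 => k _; exact: powR_ge0.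
Qed.

Let tailv n m (k : 'I_m) : X := if (n <= k)%N then x k else 0.

(** The elementary inequality for [a + b] is transferred with [a] the part of the
    sum below [n] and [b] the part above. *)
Lemma lp_sum_prefix_diff (eta c : R) n m :
  (forall a b, 0 <= a -> 0 <= b ->
    (a + b) `^ p^-1 <= (1 + eta) * a `^ p^-1 + c * b `^ p^-1) ->
  (n <= m)%N -> Y m - Y n <= eta *: Y n + c *: lp_sum p (@tailv n m).
Proof.
move=> hc nm; rewrite vlerBlDr addrAC -[X in _ + X + _]scale1r -scalerDl.
pose h (k : 'I_m) (v : 'I_m -> R) := if (n <= k)%N then v k else 0.
have ct : calculus (fun k : 'I_m => x k)
    (fun v => lp_norm (p := p) (fun k => h k v)) (lp_sum p (@tailv n m)).
  apply: lp_sum_reindex => k; rewrite /h /tailv; case: leqP => _.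
    exact: (LatLinVar (fun k : 'I_m => x k) k).
  exact: LatLin0.
apply: (calculus_le qbanach_archimedean (lp_sumP _ p0)
  (calculus_lin _ (Y_widen nm) (calculusZ _ ct))) => v.
rewrite addrC [in leRHS]addrC (addrC eta) [leRHS]addrC /lp_norm.
have -> : \sum_k `|h k v| `^ p = \sum_(k < m | ~~ (k < n)%N) `|v k| `^ p.
  rewrite [RHS]big_mkcond; apply: eq_bigr => k _; rewrite /h -leqNgt.
  by case: leqP => _ //; rewrite normr0 powR0 // lt0r_neq0.
rewrite widen_sum [in leLHS](bigID (fun k : 'I_m => (k < n)%N)) /=.
by rewrite [leRHS]addrC; apply: hc; apply: sumr_ge0 => k _; exact: powR_ge0.
Qed.

Context {M N : R}.
Hypotheses (M0 : 0 < M) (hM : forall n (u : 'I_n -> X),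
  qnorm (lp_sum p u) `^ q <= M * \sum_k qnorm (u k) `^ q).
Hypothesis XN : normable q N X.

(** The finite lp sums increase, and they are Cauchy because adding a vector of
    small lp norm changes an lp norm little. *)
Lemma infinite_lp_sum (S : R) : (forall n, \sum_(i < n) qnorm (x i) `^ q <= S) ->
  exists y, (forall n, Y n <= y) /\ qnorm y `^ q <= N * (M * S).
Proof.
move=> xS; have N0 : 0 < N by case: XN.
have S0 : 0 <= S by have := xS 0%N; rewrite big_ord0.
have YS n : qnorm (Y n) `^ q <= M * S.
  by apply: le_trans (hM _) _; rewrite ler_pM2l //; exact: xS.
have Y0 n : 0 <= Y n by exact: lp_sum_ge0.
have tail := bounded_sum_tail (fun j => powR_ge0 (qnorm (x j)) q) xS.
have [|y [Yy hy]] := @qbanach_cvg_incr _ X Y lp_sum_prefix_le.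
  move=> e e0; have [D D0 DE] : exists2 D : R, 0 < D & N * (D + D) = e `^ q.
    exists (e `^ q / (2 * N)); first by rewrite divr_gt0 ?powR_gt0 ?mulr_gt0.
    by field; rewrite lt0r_neq0.
  have MS0 : 0 < M * S + 1 by rewrite ltr_wpDl ?mulr_ge0 // ltW.
  have [eta eta0 etaE] : exists2 eta : R, 0 < eta & eta `^ q = D / (M * S + 1).
    exists ((D / (M * S + 1)) `^ q^-1); first by rewrite powR_gt0 // divr_gt0.
    by rewrite powRVK ?lt0r_neq0 // divr_ge0 // ltW.
  have [c c0 hc] := powRD_eps p0 eta0.
  have cM0 : 0 < (c `^ q + 1) * M by rewrite mulr_gt0 // ltr_wpDl ?powR_ge0.
  have [|m hm] := tail (D / ((c `^ q + 1) * M)); first by rewrite divr_gt0.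
  exists m => i j mi ij; apply: (qnorm_powR_small q0 e0).
  have dY : vabs (Y j - Y i) <= eta *: Y i + c *: lp_sum p (@tailv i j).
    rewrite ger0_vabs; first exact: lp_sum_prefix_diff.
    by rewrite vsubr_ge0; exact: lp_sum_prefix_le.
  apply: le_lt_trans (ler_powR2r (ltW q0) (qnorm_ge0 _) (qnorm_le dY)) _.
  apply: le_lt_trans (normableD XN _ _) _.
  rewrite !qnormZ_ge0 ?(ltW eta0) // !powRM ?qnorm_ge0 ?(ltW eta0) //.
  have h1 : eta `^ q * qnorm (Y i) `^ q <= D.
    rewrite etaE mulrAC ler_pdivrMr // ler_pM2l //.
    by apply: le_trans (YS i) _; rewrite lerDl.
  have h2 : c `^ q * qnorm (lp_sum p (@tailv i j)) `^ q < D.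
    have ti : qnorm (lp_sum p (@tailv i j)) `^ q <= M * \sum_(i <= k < j) qnorm (x k) `^ q.
      apply: le_trans (hM _) _; rewrite ler_pM2l // big_geq_mkord [leRHS]big_mkcond /=.
      apply: ler_sum => k _; rewrite /tailv; case: leqP => // _.
      by rewrite qnorm0 powR0 // lt0r_neq0.
    have := hm i j mi ij; rewrite ltr_pdivlMr // mulrC.
    apply: le_lt_trans; rewrite -mulrA.
    apply: le_trans (ler_wpM2l (powR_ge0 _ _) ti) _.
    rewrite ler_wpM2r ?lerDl // mulr_ge0 ?(ltW M0) //.
    by apply: sumr_ge0 => k _; exact: powR_ge0.
  by rewrite -DE ltr_pM2l //; exact: ler_ltD h1 h2.
exists y; split=> //; apply/ler_addgt0Pl => e e0.
have [|m /(_ m (leqnn m)) hm] := hy ((e / N) `^ q^-1).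
  by rewrite powR_gt0 // divr_gt0.
have h : qnorm (y - Y m) `^ q <= e / N.
  by rewrite -powR_lerE ?qnorm_ge0 ?divr_ge0 ?(ltW e0) ?(ltW N0) // ltW.
rewrite ler_pdivlMr // mulrC in h.
have := normableD XN (Y m) (y - Y m).
rewrite addrC subrK => /le_trans; apply; rewrite mulrDr addrC lerD //.
by rewrite ler_pM2l.
Qed.

End InfiniteLpSum.

Section UniformConstant.
Context {R : realType} {C : qb_couple R} {X : qBanachLatticeType R}.
Variable I : intermediate C X.
Local Notation E := (ambient C).
Context {p q M N : R}.
Hypotheses (p0 : 0 < p) (p1 : p <= 1) (q0 : 0 < q).
Hypotheses (M0 : normable p M (space0 C)) (M1 : normable p M (space1 C)).
Hypotheses (XN : normable q N X) (KX : K_monotone I).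

Lemma K_monotone_emb (x : X) (z : E) : sigma_set z ->
  (forall t, 0 < t -> Kfunc t z <= Kfunc t (emb I x)) -> exists y, emb I y = z.
Proof.
move=> /sigma_lift[s sz] h; have [|y ys] := KX (x := x) (y := s).
  by move=> t t0; rewrite !KfunE sz; exact: h.
by exists y; rewrite /emb ys.
Qed.

Let half_sum n : \sum_(j < n) (2^-1 : R) ^+ j <= 2.
Proof.
have -> : \sum_(j < n) (2^-1 : R) ^+ j = 2 - 2 * 2^-1 ^+ n.
  elim: n => [|n IH]; first by rewrite big_ord0 expr0; ring.
  by rewrite big_ord_recr /= IH exprS; field.
by rewrite lerBlDr lerDl mulr_ge0 // exprn_ge0 // invr_ge0.
Qed.

Let root (r : R) n := ((2^-1 : R) ^+ n) `^ r^-1.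
Let root_gt0 r n : 0 < root r n.
Proof. by rewrite powR_gt0 // exprn_gt0 // invr_gt0. Qed.
Let rootX r n : 0 < r -> root r n `^ r = 2^-1 ^+ n.
Proof.
by move=> r0; rewrite /root powRVK ?lt0r_neq0 // exprn_ge0 // invr_ge0.
Qed.

(** If no constant worked, there would be [x n] of summable norm and [z n]
    dominated by them in K-functional but of huge norm; the sums of the [x n] and
    of multiples of the [z n] would contradict K-monotonicity. *)
Lemma K_monotone_constant : exists2 c : R, 0 < c & forall (x : X) (z : E),
  sigma_set z -> (forall t, 0 < t -> Kfunc t z <= Kfunc t (emb I x)) ->
  exists2 y, emb I y = z & qnorm y <= c * qnorm x.
Proof.
apply: contrapT => /forall2NP noc.
pose c n : R := n.+1%:R / (root p n * root q n).
have c0 n : 0 < c n by rewrite divr_gt0 ?mulr_gt0.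
have /choice[xy xyP] n : exists xy : X * X,
    (forall t, 0 < t -> Kfunc t (emb I xy.2) <= Kfunc t (emb I xy.1)) /\
    c n * qnorm xy.1 < qnorm xy.2.
  have [|/existsNP[x /existsNP[z /not_implyP[zS /not_implyP[zx h]]]]] := noc (c n).
    by move=> /negP; rewrite c0.
  have [y yz] := K_monotone_emb zS zx; exists (x, y); split=> /=; first by rewrite yz.
  by rewrite ltNge; apply/negP => yx; apply: h; exists y.
pose x n := (xy n).1; pose y n := (xy n).2.
have xpos n : 0 < qnorm (x n).
  rewrite lt_def qnorm_ge0 andbT; apply/eqP => xn0; have [h1 h2] := xyP n.
  have y0 : y n = 0.
    apply: (emb_inj (I := I)); rewrite (lhom0 (emb_hom I)).
    apply: Kfunc1_eq0; first exact: emb_sigma.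
    by apply: le_trans (h1 1 ltr01) _; rewrite -/(x n) (qnorm0_eq0 _ xn0)
      (lhom0 (emb_hom I)) Kfunc0.
  by move: h2; rewrite -/(x n) -/(y n) xn0 y0 qnorm0 mulr0 ltxx.
pose s n := root q n / qnorm (x n); have s0 n : 0 < s n by rewrite divr_gt0.
pose u n := s n *: vabs (x n).
have u0 n : 0 <= u n by apply: vscale_ge0; [exact: ltW|exact: vabs_ge0].
have uq n : qnorm (u n) `^ q = 2^-1 ^+ n.
  by rewrite /u qnormZ_ge0 ?(ltW (s0 n)) // qnorm_abs /s divfK ?rootX // lt0r_neq0.
have [|U [uU _ _]] := normable_series q0 XN (S := 2) u0.
  by move=> n; under eq_bigr do rewrite uq; exact: half_sum.
have {}uU n : u n <= U.
  apply: le_trans (uU n.+1); rewrite big_ord_recr /= -[leLHS]add0r vlerD2rE.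
  by apply: vsum_ge0.
have rs0 n : 0 < root p n * s n by exact: mulr_gt0 (root_gt0 p n) (s0 n).
pose w n := (root p n * s n) *: vabs (emb I (y n)).
have yS n : sigma_set (vabs (emb I (y n))).
  by apply: sigma_solid (emb_sigma I (y n)) _; rewrite vabs_id.
have wS n : sigma_set (w n) by apply: sigma_scale.
have wK n t : 0 < t -> Kfunc t (w n) <= root p n * Kfunc t (emb I U).
  move=> t0; rewrite /w KfuncZ_pos ?(ltW t0) ?rs0 // -mulrA ler_pM2l //.
  rewrite Kfunc_abs ?(ltW t0) //; last exact: emb_sigma.
  apply: le_trans (ler_wpM2l (ltW (s0 n)) ((xyP n).1 t t0)) _.
  rewrite -/(x n) -KfuncZ_pos ?(ltW t0) //; last exact: emb_sigma.
  apply: Kfunc_solid; [exact: ltW|exact: emb_sigma|].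
  rewrite -(lhomZ (emb_hom I)) -!(lhom_abs (emb_hom I)).
  apply: (lhom_le (emb_hom I)); rewrite vabsZ gtr0_norm //.
  exact: le_trans (uU n) (vle_abs _).
pose D := Kfunc 1 (emb I U) + 1.
have D0 : 0 < D by rewrite ltr_wpDl // Kfunc_ge0 //; exact: emb_sigma.
have /choice[ab abP] n : exists ab : space0 C * space1 C,
    [/\ 0 <= ab.1, 0 <= ab.2, w n = emb0 ab.1 + emb1 ab.2 &
        qnorm ab.1 + 1 * qnorm ab.2 < root p n * D].
  have w0 : 0 <= w n by apply: vscale_ge0; [exact/ltW/rs0|exact: vabs_ge0].
  have Kw : Kfunc 1 (w n) < root p n * D.
    by apply: le_lt_trans (wK n 1 ltr01) _; rewrite ltr_pM2l // ltrDl.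
  have [a [b [a0 b0 wE abD]]] := Kfunc_decomp_pos ler01 (wS n) w0 Kw.
  by exists (a, b).
have sumD (f : nat -> R) : (forall n, 0 <= f n) -> (forall n, f n <= root p n * D) ->
    forall n, \sum_(j < n) f j `^ p <= 2 * D `^ p.
  move=> f0 fD n; apply: le_trans (_ : \sum_(j < n) (2^-1 ^+ j * D `^ p) <= _).
    apply: ler_sum => j _; rewrite -(rootX j p0) -powRM ?(ltW (root_gt0 _ _)) ?(ltW D0) //.
    by apply: ler_powR2r => //; exact: ltW.
  by rewrite -mulr_suml ler_wpM2r ?powR_ge0 // half_sum.
have [|A [aA _ Alim]] := normable_series p0 M0 (S := 2 * D `^ p)
    (u := fun n => (ab n).1) (fun n => let: And4 h _ _ _ := abP n in h).
  apply: (sumD (fun j => qnorm (ab j).1)) => n; first exact: qnorm_ge0.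
  by have [_ _ _] := abP n; have := qnorm_ge0 (ab n).2; lra.
have [|B [bB _ Blim]] := normable_series p0 M1 (S := 2 * D `^ p)
    (u := fun n => (ab n).2) (fun n => let: And4 _ h _ _ := abP n in h).
  apply: (sumD (fun j => qnorm (ab j).2)) => n; first exact: qnorm_ge0.
  by have [_ _ _] := abP n; have := qnorm_ge0 (ab n).1; lra.
pose z := emb0 A + emb1 B.
have wz n : w n <= z.
  have [a0 b0 -> _] := abP n; rewrite vlerD //.
    apply/(lhom_le emb0_hom)/(le_trans _ (aA n.+1)).
    rewrite big_ord_recr /= -[leLHS]add0r vlerD2rE.
    by apply: vsum_ge0 => j _; case: (abP j).
  apply/(lhom_le emb1_hom)/(le_trans _ (bB n.+1)).
  rewrite big_ord_recr /= -[leLHS]add0r vlerD2rE.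
  by apply: vsum_ge0 => j _; case: (abP j).
have Mpos : 0 < M by case: M0.
have zK t : 0 < t ->
    Kfunc t z `^ p <= 2 * M * (2 * M * (2 * Kfunc t (emb I U) `^ p)).
  move=> t0; apply: (Kfunc_lim p0 p1 M0 M1 (ltW t0) wS) => [n|e e0].
    apply: le_trans (_ : \sum_(j < n) (2^-1 ^+ j * Kfunc t (emb I U) `^ p) <= _).
      apply: ler_sum => j _; rewrite -(rootX j p0) -powRM; last 2 first.
      - exact/ltW/root_gt0.
      - by apply: Kfunc_ge0; [exact: ltW|exact: emb_sigma].
      by apply: ler_powR2r; [exact: ltW|apply: Kfunc_ge0 => //; exact: ltW|exact: wK].
    by rewrite -mulr_suml ler_wpM2r ?powR_ge0 // half_sum.
  have [m hm] := Alim e e0; have [k hk] := Blim e e0; pose n := maxn m k.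
  exists n, (A - \sum_(j < n) (ab j).1), (B - \sum_(j < n) (ab j).2); split.
  - by apply/ltW/hm; exact: leq_maxl.
  - by apply/ltW/hk; exact: leq_maxr.
  have -> : \sum_(j < n) w j =
      emb0 (\sum_(j < n) (ab j).1) + emb1 (\sum_(j < n) (ab j).2).
    rewrite (lhom_sum emb0_hom) (lhom_sum emb1_hom) -big_split.
    by apply: eq_bigr => j _; case: (abP j).
  rewrite (lhomB emb0_hom) (lhomB emb1_hom) [X in _ + X]addrACA -/z.
  by rewrite -opprD addrCA subrr addr0.
pose d := (2 * M * (2 * M * 2)) `^ p^-1.
have d0 : 0 < d by rewrite powR_gt0 // !mulr_gt0.
have dp : d `^ p = 2 * M * (2 * M * 2).
  by rewrite powRVK ?lt0r_neq0 // ltW // !mulr_gt0.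
have zS : sigma_set z by exact: sigma_emb.
have [|t t0|v vz] := @K_monotone_emb U (d^-1 *: z).
- exact: sigma_scale.
- rewrite KfuncZ_pos ?invr_gt0 ?(ltW t0) // ler_pdivrMl //.
  have KU := Kfunc_ge0 (ltW t0) (emb_sigma I U).
  rewrite -[leLHS](@powRK _ p) ?lt0r_neq0 ?Kfunc_ge0 ?(ltW t0) //.
  rewrite powR_lerEV ?powR_ge0 ?mulr_ge0 ?(ltW d0) // powRM ?(ltW d0) // dp.
  by rewrite -!mulrA; have := zK t t0; rewrite -!mulrA.
have big n : n.+1%:R < d * qnorm v.
  have [_] := xyP n; rewrite -/(x n) -/(y n) => cy.
  have g0 := rs0 n.
  have : (root p n * s n) *: vabs (y n) <= d *: v.
    apply: (lhom_le_inj (emb_hom I) (@emb_inj _ _ _ I)).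
    rewrite !(lhomZ (emb_hom I)) (lhom_abs (emb_hom I)) vz scalerA.
    by rewrite divff ?lt0r_neq0 // scale1r; exact: wz.
  move=> h; have : qnorm ((root p n * s n) *: vabs (y n)) <= qnorm (d *: v).
    apply: qnorm_le; rewrite ger0_vabs //.
    by apply: vscale_ge0; [exact: ltW|exact: vabs_ge0].
  rewrite !qnormZ_ge0 ?(ltW g0) ?(ltW d0) // qnorm_abs; apply: lt_le_trans.
  rewrite -(ltr_pM2l g0) in cy; apply: le_lt_trans cy.
  rewrite le_eqVlt; apply/orP; left; apply/eqP; rewrite /c /s.
  by field; rewrite !lt0r_neq0.
have := big (Num.trunc (d * qnorm v)); apply/negP; rewrite -leNgt ltW //.
by rewrite truncnS_gt.
Qed.

End UniformConstant.

(** * Dividing a quasi-concave sum along a sparse sequence *)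

Lemma sum_incr (R : realType) (f : nat -> nat -> R) (F : nat -> R) :
  (forall i (k l : nat), (k <= l)%N -> f i k <= f i l) ->
  (forall n k, \sum_(i < n) f i k <= F k) ->
  (forall k e, 0 < e -> exists n, F k - e <= \sum_(i < n) f i k) ->
  forall k l : nat, (k <= l)%N -> F k <= F l.
Proof.
move=> f_incr F_ge F_lim k l kl.
apply/ler_addgt0Pl => e e0; have [n hn] := F_lim k e e0.
have : \sum_(i < n) f i k <= \sum_(i < n) f i l.
  by apply: ler_sum => i _; exact: f_incr.
have := F_ge n l; lra.
Qed.

Section SparseDivision.
Context {R : realType} {theta : R} {f : nat -> nat -> R} {F : nat -> R}.
Hypotheses (theta_gt1 : 1 < theta) (theta_le2 : theta <= 2).
Hypothesis f_ge0 : forall i k, 0 <= f i k.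
Hypothesis f_incr : forall i (k l : nat), (k <= l)%N -> f i k <= f i l.
Hypothesis f_decr : forall i (k l : nat), (k <= l)%N ->
  f i l / theta ^+ l <= f i k / theta ^+ k.
Hypothesis F_ge : forall n k, \sum_(i < n) f i k <= F k.
Hypothesis F_lim : forall k e, 0 < e -> exists n, F k - e <= \sum_(i < n) f i k.
Hypothesis F0_gt0 : 0 < F 0.

Local Notation th k := (theta ^+ k).
Local Notation rho g k := (g k / theta ^+ k).

Let th_gt0 k : 0 < th k. Proof. exact: exprn_gt0 (lt_trans ltr01 theta_gt1). Qed.

Let F_incr k l : (k <= l)%N -> F k <= F l.
Proof. exact: (sum_incr f_incr F_ge F_lim). Qed.

Let F_gt0 k : 0 < F k.
Proof. by apply: lt_le_trans F0_gt0 _; exact: F_incr. Qed.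

Let F_decr k l : (k <= l)%N -> rho F l <= rho F k.
Proof.
move=> kl; rewrite ler_pdivrMr //; apply/ler_addgt0Pl => e e0.
have [n hn] := F_lim l e0; rewrite -lerBlDl; apply: le_trans hn _.
apply: (@le_trans _ _ (\sum_(i < n) f i k / th k * th l)).
  by apply: ler_sum => i _; rewrite -ler_pdivrMr //; exact: f_decr.
by rewrite -!mulr_suml !ler_wpM2r ?invr_ge0 ?(ltW (th_gt0 _)).
Qed.

Let F_step k : F k.+1 <= 2 * F k.
Proof.
have := F_decr (leqnSn k); rewrite ler_pdivrMr // => /le_trans; apply.
rewrite exprS mulrCA divfK ?lt0r_neq0 //.
by rewrite ler_wpM2r // ltW.
Qed.

Let rho_step k : rho F k <= 2 * rho F k.+1.
Proof.
have th0 : 0 < theta by exact: lt_trans ltr01 theta_gt1.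
have -> : 2 * rho F k.+1 = 2 / theta * (F k.+1 / th k).
  by rewrite exprS; field; rewrite !lt0r_neq0.
rewrite -[leLHS]mul1r; apply: ler_pM => //.
- by rewrite divr_ge0 ?(ltW (F_gt0 _)) ?(ltW (th_gt0 _)).
- by rewrite ler_pdivlMr ?mul1r.
- by rewrite ler_wpM2r ?invr_ge0 ?(ltW (th_gt0 _)) // F_incr.
Qed.

(** The next point of the sparse sequence is the first one at which [F] has
    tripled and [F k / theta ^+ k] has dropped to a third; minimality makes one
    of these two changes bounded. If there is none, one of the two functions
    stays comparable to its value at [s] for ever. *)
Lemma sparse_next s :
  (exists s', [/\ (s < s')%N, 3 * F s <= F s', 3 * rho F s' <= rho F s &
    F s' <= 6 * F s \/ rho F s <= 6 * rho F s']) \/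
  ((forall k, F k <= 3 * F s) \/ (forall k, rho F s <= 3 * rho F k)).
Proof.
pose good k := [&& (s < k)%N, 3 * F s <= F k & 3 * rho F k <= rho F s].
have [exg|nog] := pselect (exists k, good k).
  left; case: (ex_minnP exg) => -[//|m] /and3P[sm h1 h2] hmin.
  exists m.+1; split=> //; move: sm; rewrite ltnS leq_eqVlt => /predU1P[->|sm].
    by left; apply: le_trans (F_step m) _; have := F_gt0 m; lra.
  have : ~~ good m by apply/negP => /hmin; rewrite ltnn.
  rewrite /good sm /= negb_and -!ltNge => /orP[h|h].
    by left; apply: le_trans (F_step m) _; lra.
  by right; have := rho_step m; lra.
right; apply: contrapT => /not_orP[/existsNP[k1 /negP h1] /existsNP[k2 /negP h2]].
apply: nog; exists (maxn s.+1 (maxn k1 k2)); rewrite -!ltNge in h1 h2.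
apply/and3P; split; first exact: leq_maxl.
  apply: le_trans (ltW h1) (F_incr _); rewrite leq_max; apply/orP; right.
  exact: leq_maxl.
apply: le_trans (ltW h2); rewrite ler_pM2l //; apply: F_decr.
by rewrite leq_max; apply/orP; right; exact: leq_maxr.
Qed.

(** [None] marks the end of the sequence. *)
Definition sparse_rel (s : nat) (o : option nat) : Prop :=
  match o with
  | Some s' => [/\ (s < s')%N, 3 * F s <= F s', 3 * rho F s' <= rho F s &
      F s' <= 6 * F s \/ rho F s <= 6 * rho F s']
  | None => (forall k, F k <= 3 * F s) \/ (forall k, rho F s <= 3 * rho F k)
  end.

Lemma sparse_seq : exists st : nat -> option nat, st 0%N = Some 0%N /\
  forall j, match st j with
            | Some s => sparse_rel s (st j.+1)
            | None => st j.+1 = None end.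
Proof.
have /choice[nx nxP] s : exists o, sparse_rel s o.
  by have [[s' h]|h] := sparse_next s; [exists (Some s')|exists None].
exists (fix st j := if j is j'.+1 then obind nx (st j') else Some 0%N).
split=> // j; case: (_ j) => //= s; exact: nxP.
Qed.

Context {st : nat -> option nat}.
Hypothesis st0 : st 0 = Some 0%N.
Hypothesis stP : forall j, match st j with
  | Some s => sparse_rel s (st j.+1) | None => st j.+1 = None end.

Definition prev_value i j : R :=
  if j is j'.+1 then (if st j' is Some a then f i a else 0) else 0.

Definition next_value i j s : R :=
  if st j.+1 is Some b then th s * rho (f i) b else 0.

(** The part of [f i] that lives near the point [s]: what remains of the value
    at [s] after the neighbouring points have had their share. *)
Definition local_part i j : R :=
  if st j is Some s then Num.max 0 (f i s - prev_value i j - next_value i j s)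
  else 0.

(** For [theta = 2 `^ p] and [t = 2 ^ k] the minimum is [min (1, t / t_j) `^ p]. *)
Definition bump_at j k : R :=
  if st j is Some s then F s * Num.min 1 (th k / th s) else 0.

(** The factor 4 makes the weights of a point add up to at least one: each
    neighbour takes at most a third of [F s]. *)
Definition point_weight i j : R :=
  if st j is Some s then 4 * local_part i j / F s else 0.

Let local_part_ge0 i j : 0 <= local_part i j.
Proof. by rewrite /local_part; case: (st j) => // s; rewrite le_max lexx. Qed.

Lemma point_weight_ge0 i j : 0 <= point_weight i j.
Proof.
rewrite /point_weight; case: (st j) => // s.
by rewrite divr_ge0 ?mulr_ge0 // ltW.
Qed.

Lemma bump_at_ge0 j k : 0 <= bump_at j k.
Proof.
rewrite /bump_at; case: (st j) => // s.
by rewrite mulr_ge0 ?(ltW (F_gt0 _)) // le_min ler01 divr_ge0 // ltW.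
Qed.

Lemma point_weight_sum j s : st j = Some s ->
  exists n, 1 <= \sum_(i < n) point_weight i j.
Proof.
move=> sj; have e0 : 0 < F s / 12 by rewrite divr_gt0.
have [n hn] := F_lim s e0; exists n.
rewrite /point_weight sj -mulr_suml -mulr_sumr ler_pdivlMr // mul1r.
have hprev : \sum_(i < n) prev_value i j <= F s / 3.
  rewrite /prev_value; case: j sj => [|j] sj.
    by rewrite big1 // divr_ge0 // ltW.
  have := stP j; case sj' : (st j) => [a|]; last by rewrite sj.
  rewrite sj /= => -[_ h _ _]; rewrite ler_pdivlMr // mulrC.
  by apply: le_trans h; rewrite ler_pM2l //; exact: F_ge.
have hnext : \sum_(i < n) next_value i j s <= F s / 3.
  rewrite /next_value; have := stP j; rewrite sj.
  case: (st j.+1) => [b|_]; last by rewrite big1 // divr_ge0 // ltW.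
  move=> [_ _ h _]; rewrite -mulr_sumr -mulr_suml.
  rewrite -ler_pdivlMl //; apply: (@le_trans _ _ (rho F b)).
    by rewrite ler_wpM2r ?F_ge // invr_ge0 ltW.
  by rewrite mulrA ler_pdivlMr // mulrC (mulrC _^-1).
have : \sum_(i < n) (f i s - prev_value i j - next_value i j s) <=
    \sum_(i < n) local_part i j.
  by apply: ler_sum => i _; rewrite /local_part sj le_max lexx orbT.
rewrite !sumrB; lra.
Qed.

Let lower i k j : R :=
  if j is j'.+1 then (if st j' is Some s then f i (minn s k) else f i k) else 0.

Let upper i k j : R :=
  if st j is Some s then th k * rho (f i) (maxn s k) else 0.

Let lower_incr i k j : lower i k j <= lower i k j.+1.
Proof.
rewrite /lower; case: j => [|j]; first by case: (st 0).
have := stP j; case: (st j) => [s|->//].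
case: (st j.+1) => [s' [ss' _ _ _]|_]; apply: f_incr; last exact: geq_minr.
by rewrite leq_min geq_minr andbT (leq_trans (geq_minl _ _)) // ltnW.
Qed.

Let upper_decr i k j : upper i k j.+1 <= upper i k j.
Proof.
rewrite /upper; have := stP j; case: (st j) => [s|->//].
have h m : 0 <= th k * rho (f i) m.
  by rewrite mulr_ge0 ?divr_ge0 ?(ltW (th_gt0 _)).
case: (st j.+1) => [s' [ss' _ _ _]|_] //; rewrite ler_pM2l //.
apply: f_decr; rewrite geq_max leq_maxr andbT leq_max.
by rewrite (ltnW ss').
Qed.

Let lower_prev i k j s : st j = Some s -> lower i k j <= prev_value i j.
Proof.
rewrite /lower /prev_value; case: j => // j sj.
have := stP j; case: (st j) => [a|]; last by rewrite sj.
by rewrite sj => -[/ltnW as_ _ _ _]; apply: f_incr; exact: geq_minl.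
Qed.

(** Below [k] the local parts telescope in [f i], above [k] they telescope in
    [f i k / theta ^+ k]. *)
Lemma point_weight_le i k n :
  \sum_(j < n) point_weight i j * bump_at j k <= 8 * f i k.
Proof.
have term j : point_weight i j * bump_at j k <=
    4 * ((lower i k j.+1 - lower i k j) - (upper i k j.+1 - upper i k j)).
  have := lower_incr i k j; have := upper_decr i k j => ud li.
  rewrite /point_weight /bump_at /local_part; case sj: (st j) => [s|]; last first.
    by rewrite mul0r mulr_ge0 // subr_ge0; lra.
  set c := Num.max _ _; have Fs := F_gt0 s.
  rewrite (_ : 4 * c / F s * _ = 4 * (c * Num.min 1 (th k / th s))); last first.
    by field; rewrite lt0r_neq0.
  rewrite ler_pM2l //; have m0 : 0 <= Num.min 1 (th k / th s).
    by rewrite le_min ler01 divr_ge0 // ltW.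
  have [sk|ks] := leqP s k.
    have -> : Num.min 1 (th k / th s) = 1.
      by apply/min_idPl; rewrite ler_pdivlMr // mul1r ler_eXn2l.
    rewrite mulr1 ge_max; apply/andP; split; first by lra.
    have nv : 0 <= next_value i j s.
      rewrite /next_value; case: (st j.+1) => // b.
      by rewrite mulr_ge0 ?divr_ge0 ?(ltW (th_gt0 _)).
    have -> : lower i k j.+1 = f i s by rewrite /= sj; congr f; exact/minn_idPl.
    have := lower_prev i k sj; lra.
  apply: (@le_trans _ _ (c * (th k / th s))).
    apply: ler_wpM2l; last by rewrite ge_min lexx orbT.
    by rewrite /c le_max lexx.
  have mks : 0 < th k / th s by rewrite divr_gt0.
  rewrite -ler_pdivlMr // ge_max; apply/andP; split.
    by rewrite divr_ge0 ?(ltW mks) //; lra.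
  have pv : 0 <= prev_value i j.
    by rewrite /prev_value; case: (j) => // j'; case: (st j').
  rewrite ler_pdivlMr //.
  have -> : upper i k j = f i s * (th k / th s).
    by rewrite /upper sj (maxn_idPl (ltnW ks)) mulrCA.
  have -> : upper i k j.+1 = next_value i j s * (th k / th s).
    rewrite /upper /next_value; have := stP j; rewrite sj.
    case: (st j.+1) => [b [sb _ _ _]|_]; last by rewrite mul0r.
    rewrite (maxn_idPl (ltnW (ltn_trans ks sb))).
    by field; rewrite !lt0r_neq0.
  rewrite !mulrBl; have := mulr_ge0 pv (ltW mks); lra.
apply: le_trans (ler_sum _ (fun (j : 'I_n) _ => term j)) _.
rewrite -mulr_sumr sumrB -!(big_mkord xpredT (fun j => _ j.+1 - _ j)).
rewrite !telescope_sumr // {2}/lower subr0.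
have ln : lower i k n <= f i k.
  rewrite /lower; case: (n) => [//|m]; case: (st m) => // s.
  by apply: f_incr; exact: geq_minr.
have un : 0 <= upper i k n.
  rewrite /upper; case: (st n) => // s.
  by rewrite mulr_ge0 ?divr_ge0 ?(ltW (th_gt0 _)).
have -> : upper i k 0 = f i k.
  by rewrite /upper st0 max0n mulrC divfK ?lt0r_neq0.
lra.
Qed.

(** The share of [f i] at infinity, for a last piece that is not localized at any
    point. *)
Definition final_value i : R := inf [set rho (f i) k | k in [set: nat]].

Let final_has_inf i : has_inf [set rho (f i) k | k in [set: nat]].
Proof.
split; first by exists (rho (f i) 0); exists 0%N.
by exists 0 => _ [k _ <-]; rewrite divr_ge0 // ltW.
Qed.

Let final_le i k : final_value i <= rho (f i) k.
Proof. by apply: ge_inf; [case: (final_has_inf i)|exists k]. Qed.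

Let final_ge0 i : 0 <= final_value i.
Proof.
apply: lb_le_inf; first by case: (final_has_inf i).
by move=> _ [k _ <-]; rewrite divr_ge0 // ltW.
Qed.

(** The limits of [f i k / theta ^+ k] do not lose mass, because the tail of
    the series decreases in [k]. *)
Lemma final_value_sum s : (forall k, rho F s <= 3 * rho F k) ->
  exists n, rho F s / 4 <= \sum_(i < n) final_value i.
Proof.
move=> hs; pose D := rho F s; have D0 : 0 < D by rewrite divr_gt0.
have e0 : 0 < D / 24 * th s by rewrite mulr_gt0 // divr_gt0.
have [n hn] := F_lim s e0; exists n; pose S l m := \sum_(i < m) rho (f i) l.
have Sn : D - D / 24 <= S s n.
  by rewrite /S -mulr_suml ler_pdivlMr // mulrBl divfK // lt0r_neq0.
have n0 : 0 < n.+1%:R :> R by [].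
have d0 : 0 < D / 24 / n.+1%:R by rewrite !divr_gt0.
have /choice[l hl] i : exists l, rho (f i) l < final_value i + D / 24 / n.+1%:R.
  by have [_ [l _ <-] h] := inf_adherent d0 (final_has_inf i); exists l.
pose L := maxn s (\max_(i < n) l i); have sL : (s <= L)%N := leq_maxl _ _.
have SL : D / 3 - D / 24 <= S L n.
  have := hs L; rewrite -/D => DL; suff : rho F L <= S L n + D / 24 by lra.
  rewrite ler_pdivrMr //; apply/ler_addgt0Pl => e e0'.
  have [m hm] := F_lim L e0'; rewrite -lerBlDl; apply: le_trans hm _.
  have -> : \sum_(i < m) f i L = S L m * th L.
    by rewrite /S -mulr_suml divfK // lt0r_neq0.
  rewrite ler_pM2r //; have h0 l' i : 0 <= rho (f i) l' by rewrite divr_ge0 // ltW.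
  have [mn|nm] := leqP m n.
    apply: (@le_trans _ _ (S L n)); last by rewrite lerDl ltW // divr_gt0.
    rewrite /S -!(big_mkord xpredT (fun i => rho (f i) L)).
    by rewrite (big_cat_nat (n := m) (p := n)) //= lerDl sumr_ge0.
  have cat l' : S l' m = S l' n + \sum_(n <= i < m) rho (f i) l'.
    rewrite /S -!(big_mkord xpredT (fun i => rho (f i) l')).
    by rewrite (big_cat_nat (n := n) (p := m)) // ltnW.
  rewrite cat lerD2l; apply: (@le_trans _ _ (\sum_(n <= i < m) rho (f i) s)).
    by apply: ler_sum => i _; exact: f_decr.
  have : S s m <= D by rewrite /S -mulr_suml ler_wpM2r ?F_ge // invr_ge0 ltW.
  by rewrite cat; lra.
have : S L n <= \sum_(i < n) (final_value i + D / 24 / n.+1%:R).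
  apply: ler_sum => i _; apply: le_trans (ltW (hl i)); apply: f_decr.
  by rewrite /L leq_max; apply/orP; right; exact: (leq_bigmax i).
rewrite big_split /= sumr_const card_ord.
have : D / 24 / n.+1%:R *+ n <= D / 24.
  rewrite -mulr_natr mulrAC ler_pdivrMr // ler_wpM2l ?ler_nat //.
  by rewrite ltW // divr_gt0.
move: SL; rewrite -[rho F s]/D.
move: (_ *+ n) (S L n) (\sum_(i < n) final_value i) => T SLn Sf; lra.
Qed.

(** What near-optimal splittings at consecutive points give for the K-functional of
    their difference; after the last point, the bound for what remains. *)
Definition piece_bound j k : R :=
  match st j, st j.+1 with
  | Some s, Some s' => Num.min (F s') (th k * rho F s)
  | Some s, None => Num.min (F (maxn s k)) (th k * rho F s)
  | None, _ => 0
  end.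

Let is_last j : nat := if st j is Some _ then (st j.+1 == None) else 0%N.

Let sum_is_last n : (\sum_(j < n) is_last j = (st n == None))%N.
Proof.
elim: n => [|n IH]; first by rewrite big_ord0 st0.
rewrite big_ord_recr /= IH /is_last; have := stP n.
by case: (st n) => // ->.
Qed.

Let min_bump (c a b : R) j k s : 0 <= c -> st j = Some s ->
  a <= c * F s -> b <= c * (th k * rho F s) ->
  Num.min a b <= c * bump_at j k.
Proof.
move=> c0 sj h1 h2; rewrite /bump_at sj mulrA minr_pMr ?mulr_ge0 ?(ltW (F_gt0 _)) //.
rewrite mulr1 le_min !ge_min h1 /=; apply/orP; right; apply: le_trans h2 _.
by rewrite -mulrA (mulrCA (th k)).
Qed.

(** A piece between consecutive points is charged to the endpoint at which its
    bound is comparable to the bump; the last one to its starting point, or to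
    the limits of [f i k / theta ^+ k]. *)
Lemma piece_weights : exists lam : nat -> nat -> R,
  [/\ forall i j, 0 <= lam i j,
      forall j, exists n, 1 <= \sum_(i < n) lam i j &
      forall i k n, \sum_(j < n) lam i j * piece_bound j k <= 100 * f i k].
Proof.
have /choice[lam lamP] j : exists w : nat -> R,
    [/\ forall i, 0 <= w i, exists n, 1 <= \sum_(i < n) w i &
      forall i k, w i * piece_bound j k <=
        6 * (point_weight i j * bump_at j k) +
        6 * (point_weight i j.+1 * bump_at j.+1 k) + (is_last j)%:R * (4 * f i k)].
  have pb i j' k : 0 <= 6 * (point_weight i j' * bump_at j' k).
    by rewrite !mulr_ge0 ?point_weight_ge0 ?bump_at_ge0.
  have lf i k : 0 <= (is_last j)%:R * (4 * f i k) by rewrite !mulr_ge0.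
  have charge j' : (st j' != None) ->
      (forall k, piece_bound j k <= 6 * bump_at j' k) -> (j' = j \/ j' = j.+1) ->
      exists w : nat -> R, [/\ forall i, 0 <= w i,
        exists n, 1 <= \sum_(i < n) w i &
        forall i k, w i * piece_bound j k <=
        6 * (point_weight i j * bump_at j k) +
        6 * (point_weight i j.+1 * bump_at j.+1 k) + (is_last j)%:R * (4 * f i k)].
    move=> sj' hb jj'; exists (point_weight ^~ j'); split=> [i||i k].
    - exact: point_weight_ge0.
    - by case sj: (st j') sj' => [s|//] _; exact: point_weight_sum sj.
    have := ler_wpM2l (point_weight_ge0 i j') (hb k); rewrite mulrCA.
    have := pb i j k; have := pb i j.+1 k; have := lf i k.
    by case: jj' => ->; lra.
  have some_or_none (o : option nat) : (exists s, o = Some s) \/ o = None.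
    by case: o => [s|]; [left; exists s|right].
  have stj := stP j; have [[s sj]|sj] := some_or_none (st j); last first.
    exists (fun=> 1); split=> [//||i k]; first by exists 1%N; rewrite big_ord1.
    by rewrite /piece_bound sj mulr0 !addr_ge0.
  have [[s' sj1]|sj1] := some_or_none (st j.+1); rewrite sj sj1 /= in stj.
    move: stj => [ss' h1 h2 [h|h]].
      apply: (charge j); rewrite ?sj //; last by left.
      move=> k; rewrite /piece_bound sj sj1; apply: (min_bump _ sj) => //.
      have : 0 <= th k * rho F s by rewrite mulr_ge0 ?divr_ge0 ?(ltW (F_gt0 _)) ?(ltW (th_gt0 _)).
      by lra.
    apply: (charge j.+1); rewrite ?sj1 //; last by right.
    move=> k; rewrite /piece_bound sj sj1; apply: (min_bump _ sj1) => //.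
      by have := F_gt0 s'; lra.
    by rewrite (mulrCA 6) ler_pM2l.
  case: stj => h.
    apply: (charge j); rewrite ?sj //; last by left.
    move=> k; rewrite /piece_bound sj sj1; apply: (min_bump _ sj) => //.
      by have := h (maxn s k); have := F_gt0 s; lra.
    have : 0 <= th k * rho F s by rewrite mulr_ge0 ?divr_ge0 ?(ltW (F_gt0 _)) ?(ltW (th_gt0 _)).
    by lra.
  have r0 : 0 < rho F s by rewrite divr_gt0.
  have w0 i : 0 <= 4 * final_value i / rho F s.
    by apply: divr_ge0; [apply: mulr_ge0 => //; exact: final_ge0|exact: ltW].
  exists (fun i => 4 * final_value i / rho F s); split=> [i||i k].
  - exact: w0.
  - have [n hn] := final_value_sum h; exists n.
    by rewrite -mulr_suml -mulr_sumr ler_pdivlMr // mul1r; lra.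
  have -> : (is_last j)%:R * (4 * f i k) = 4 * f i k by rewrite /is_last sj sj1 mul1r.
  suff : 4 * final_value i / rho F s * piece_bound j k <= 4 * f i k.
    by have := pb i j k; have := pb i j.+1 k; lra.
  apply: (@le_trans _ _ (4 * final_value i / rho F s * (th k * rho F s))).
    apply: ler_wpM2l; first exact: w0.
    by rewrite /piece_bound sj sj1 ge_min lexx orbT.
  rewrite mulrCA divfK ?lt0r_neq0 // mulrCA ler_pM2l // mulrC.
  by rewrite -ler_pdivlMr.
exists (fun i j => lam j i); split=> [i j|j|i k n].
- by case: (lamP j).
- by have [_ h _] := lamP j; exact: h.
have le j : lam j i * piece_bound j k <= _ := (let: And3 _ _ h := lamP j in h) i k.
apply: le_trans (ler_sum _ (fun (j : 'I_n) _ => le j)) _.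
rewrite !big_split /= -!mulr_sumr -mulr_suml -natr_sum sum_is_last.
have h1 := point_weight_le i k n; have h2 := point_weight_le i k n.+1.
rewrite big_ord_recl /= in h2.
have p00 : 0 <= point_weight i 0 * bump_at 0 k.
  by rewrite mulr_ge0 ?point_weight_ge0 ?bump_at_ge0.
have l1 : (st n == None)%:R * (4 * f i k) <= 4 * f i k.
  by case: (_ == _); rewrite ?mul1r // mul0r mulr_ge0.
have h3 : \sum_(j < n) point_weight i j.+1 * bump_at j.+1 k <= 8 * f i k.
  apply: le_trans h2; rewrite -[leLHS]add0r lerD //.
have := f_ge0 i k; lra.
Qed.

End SparseDivision.

(** * Dividing a positive element *)

Section SumBelowLp.
Context {R : realType} {Y : qBanachLatticeType R} {p : R}.
Hypotheses (p0 : 0 < p) (p1 : p <= 1).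

Let pV_gt0 : 0 < p^-1. Proof. by rewrite invr_gt0. Qed.

Let real_sum_le (J T : finType) (lam : T -> J -> R) (v : J -> R) :
  (forall i j, 0 <= lam i j) -> (forall j, 1 <= \sum_i lam i j) ->
  (forall j, 0 <= v j) ->
  \sum_j v j <= lp_norm (p := p) (fun i => \sum_j lam i j `^ p^-1 * v j).
Proof.
move=> lam0 lam1 v0.
have t0 j i : 0 <= lam i j `^ p^-1 * v j by rewrite mulr_ge0 ?powR_ge0.
have one j : v j <= lp_norm (p := p) (fun i => lam i j `^ p^-1 * v j).
  rewrite powR_lerE ?sum_powR_ge0 //.
  have -> : \sum_i `|lam i j `^ p^-1 * v j| `^ p = (\sum_i lam i j) * v j `^ p.
    rewrite mulr_suml; apply: eq_bigr => i _.
    by rewrite ger0_norm // powRM ?powR_ge0 // powRVK ?lt0r_neq0.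
  by rewrite ler_peMl ?powR_ge0.
elim: (index_enum J) => [|j s IH]; first by rewrite big_nil lp_norm_ge0.
rewrite big_cons; apply: le_trans (lerD (one j) IH) _.
apply: le_trans (lp_normD_ge p0 p1 _ _) _ => [i|i|].
- exact: t0.
- by apply: sumr_ge0.
by apply: lp_norm_le => // i; rewrite big_cons.
Qed.

(** Reverse Minkowski, applied to the vectors of the shares
    [lam i j `^ p^-1 *: u j] of one [u j], whose lp norm is at least [u j]. *)
Lemma sum_le_lp_sum (m n : nat) (u : 'I_m -> Y) (lam : 'I_n -> 'I_m -> R)
    (B : 'I_n -> Y) :
  (forall j, 0 <= u j) -> (forall i j, 0 <= lam i j) ->
  (forall j, 1 <= \sum_i lam i j) ->
  (forall i, \sum_j lam i j `^ p^-1 *: u j <= B i) ->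
  \sum_j u j <= lp_sum p B.
Proof.
move=> u0 lam0 lam1 uB.
pose y (s : 'I_m + 'I_n) := match s with
  | inl j => u j | inr i => B i - \sum_j lam i j `^ p^-1 *: u j end.
have y0 s : 0 <= y s by case: s => [j|i] //=; rewrite vsubr_ge0.
have Ly s : lattice_linear y (fun v => `|v s|) (y s).
  by rewrite -[X in lattice_linear _ _ X]ger0_vabs //; apply/latlin_abs/LatLinVar.
pose h (i : 'I_n) (v : 'I_m + 'I_n -> R) :=
  \sum_j lam i j `^ p^-1 * `|v (inl j)| + `|v (inr i)|.
have Lh i : lattice_linear y (h i) (B i).
  have -> : B i = \sum_j lam i j `^ p^-1 *: y (inl j) + y (inr i).
    by rewrite /= addrC subrK.
  apply: latlinD; last exact: Ly.
  by apply: latlin_sum => j; apply: latlinZ; exact: Ly.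
have Lu : lattice_linear y (fun v => \sum_j `|v (inl j)|) (\sum_j u j).
  by apply: latlin_sum => j; exact: (Ly (inl j)).
apply: (calculus_le qbanach_archimedean (latlin_calculus Lu)
  (calculus_subst Lh (lp_sumP B p0))) => v.
have := real_sum_le lam0 lam1 (fun j => normr_ge0 (v (inl j))).
move=> /le_trans; apply; apply: lp_norm_le => [|i]; first exact: p0.
have s0 : 0 <= \sum_j lam i j `^ p^-1 * `|v (inl j)|.
  by apply: sumr_ge0 => j _; rewrite mulr_ge0 ?powR_ge0.
by rewrite (ger0_norm s0) ger0_norm ?lerDl // addr_ge0.
Qed.

End SumBelowLp.

Section Division.
Context {R : realType} {C : qb_couple R} {p M : R}.
Local Notation E := (ambient C).
Local Notation i0 := (@emb0 R C).
Local Notation i1 := (@emb1 R C).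
Hypotheses (p0 : 0 < p) (p1 : p <= 1).
Hypotheses (M0 : normable p M (space0 C)) (M1 : normable p M (space1 C)).
Local Notation theta := (2 `^ p).
Local Notation rho F k := (F k / theta ^+ k).

Context {f : nat -> nat -> R} {F : nat -> R}.
Hypothesis f_ge0 : forall i k, 0 <= f i k.
Hypothesis f_incr : forall i (k l : nat), (k <= l)%N -> f i k <= f i l.
Hypothesis f_decr : forall i (k l : nat), (k <= l)%N ->
  f i l / theta ^+ l <= f i k / theta ^+ k.
Hypothesis F_ge : forall n k, \sum_(i < n) f i k <= F k.
Hypothesis F_lim : forall k e, 0 < e -> exists n, F k - e <= \sum_(i < n) f i k.
Hypothesis F0_gt0 : 0 < F 0%N.

Let Mpos : 0 < M. Proof. by case: M0. Qed.

Lemma theta_gt1 : 1 < theta :> R.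
Proof.
apply: (@le_lt_trans _ _ (1 `^ p)); first by rewrite powR1.
by apply: gt0_ltr_powR; rewrite ?nnegrE //; lra.
Qed.

Lemma theta_le2 : theta <= 2 :> R.
Proof. by apply: ler1_powR => //; lra. Qed.

Lemma theta_expr k : ((2 : R) ^+ k) `^ p = theta ^+ k.
Proof.
elim: k => [|k IH]; first by rewrite !expr0 powR1.
by rewrite !exprS powRM ?exprn_ge0 // IH.
Qed.

Let th_gt0 k : 0 < theta ^+ k :> R.
Proof. by rewrite exprn_gt0 // powR_gt0. Qed.

Variables (x : E) (a0 : space0 C) (b0 : space1 C).
Hypotheses (x_ge0 : 0 <= x) (a0_ge0 : 0 <= a0) (b0_ge0 : 0 <= b0).
Hypothesis x_split : x = i0 a0 + i1 b0.
Hypothesis a0F : qnorm a0 `^ p <= 2 * F 0%N.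
Hypothesis b0F : qnorm b0 `^ p <= 2 * F 0%N.
Hypothesis xF : forall k : nat, Kfunc (2 ^+ k) x `^ p <= F k.

Definition division_constant : R :=
  2 * M * (2 * M * ((4 * M + 2) * 100)) + M * (M * ((4 * M + 2) * 100)).

Let xS : sigma_set x. Proof. by rewrite x_split; exact: sigma_emb. Qed.

Let F_incr k l : (k <= l)%N -> F k <= F l.
Proof. exact: (sum_incr f_incr F_ge F_lim). Qed.

Let F_gt0 k : 0 < F k.
Proof. by apply: lt_le_trans F0_gt0 _; exact: F_incr. Qed.

Let splittings : exists ab : nat -> space0 C * space1 C, ab 0%N = (a0, b0) /\
  forall k, [/\ 0 <= (ab k).1, 0 <= (ab k).2, x = i0 (ab k).1 + i1 (ab k).2,
    qnorm (ab k).1 `^ p <= 2 * F k & qnorm (ab k).2 `^ p <= 2 * rho F k].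
Proof.
have /choice[ab abP] k : exists ab : space0 C * space1 C,
    [/\ 0 <= ab.1, 0 <= ab.2, x = i0 ab.1 + i1 ab.2,
    qnorm ab.1 `^ p <= 2 * F k & qnorm ab.2 `^ p <= 2 * rho F k].
  have t0 : 0 < (2 : R) ^+ k by rewrite exprn_gt0.
  have F2 : 0 < 2 * F k by rewrite mulr_gt0.
  have [|a [b [a_ge0 b_ge0 xE ab]]] :=
      @Kfunc_decomp_pos _ C (2 ^+ k) (ltW t0) x ((2 * F k) `^ p^-1) xS x_ge0.
    rewrite -[ltLHS](@powRK _ p) ?lt0r_neq0 ?Kfunc_ge0 ?(ltW t0) //.
    apply: gt0_ltr_powR; rewrite ?invr_gt0 ?nnegrE ?powR_ge0 ?(ltW F2) //.
    by apply: le_lt_trans (xF k) _; have := F_gt0 k; lra.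
  have qa := qnorm_ge0 a; have qb := mulr_ge0 (ltW t0) (qnorm_ge0 b).
  exists (a, b); split=> //=.
    by rewrite -powR_lerE ?(ltW F2) //; apply: le_trans (ltW ab); rewrite lerDl.
  rewrite mulrA ler_pdivlMr // -theta_expr -powRM ?qnorm_ge0 ?(ltW t0) //.
  rewrite mulrC -powR_lerE ?(ltW F2) //.
  by apply: le_trans (ltW ab); rewrite lerDr.
exists (fun k => if k is 0%N then (a0, b0) else ab k); split=> // -[|k].
  by split=> //=; rewrite expr0 divr1.
exact: abP.
Qed.

(** The part [b0] of [x] is cut along a sparse sequence of scales: at each scale
    [x] has a near-optimal splitting, and the pieces are the differences of the
    second components at consecutive scales, which are also differences of first
    components. Each piece is given to the indices [i] in proportion to the local
    part of [f i], and the shares of [i] are summed to [B i]. The pieces telescope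
    to [b0] and, Minkowski's inequality being reversed, the lp sum of the [B i]
    dominates their sum. *)
Lemma divide_half : exists B : nat -> space1 C,
  [/\ forall i, 0 <= B i,
      forall i k, Kfunc (2 ^+ k) (i1 (B i)) `^ p <= division_constant * f i k,
      forall i, qnorm (B i) `^ p <= division_constant * f i 0%N &
      forall e : R, 0 < e -> exists n r, qnorm r <= e /\
        b0 <= lp_sum p (fun i : 'I_n => B i) + r].
Proof.
have [ab [ab0 abP]] := splittings.
have [st [st0 stP]] :=
  sparse_seq theta_gt1 theta_le2 f_incr f_decr F_ge F_lim F0_gt0.
have [lam [lam0 lam1 lamF]] :=
  piece_weights theta_gt1 f_ge0 f_incr f_decr F_ge F_lim F0_gt0 st0 stP.
pose be j := if st j is Some s then (ab s).2 else 0.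
pose u j := vabs (be j - be j.+1).
have u0 j : 0 <= u j by exact: vabs_ge0.
have rho_ge0 k : 0 <= rho F k by rewrite divr_ge0 // ltW.
have M4 : 0 <= 4 * M by rewrite mulr_ge0 // ltW.
have beF j s : st j = Some s -> qnorm (be j) `^ p <= 2 * rho F s /\
    qnorm (be j.+1) `^ p <= 2 * rho F s.
  move=> sj; split; first by rewrite /be sj; case: (abP s).
  have := stP j; rewrite sj /be; case: (st j.+1) => [s'|_]; last first.
    by rewrite qnorm0 powR0 ?lt0r_neq0 // mulr_ge0.
  move=> [_ _ h _]; have [_ _ _ _ h'] := abP s'; apply: le_trans h' _.
  by rewrite ler_pM2l //; have := rho_ge0 s'; lra.
have uF j s : st j = Some s -> qnorm (u j) `^ p <= 4 * M * rho F s.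
  move=> sj; have [h h'] := beF j s sj; rewrite qnorm_abs.
  apply: le_trans (normableB M1 _ _) _.
  rewrite (mulrC 4) -mulrA ler_pM2l //; lra.
have uN j : st j = None -> u j = 0.
  by move=> sj; have := stP j; rewrite /u /be sj => ->; rewrite subrr vabs0.
have pbN j k : st j = None -> piece_bound (theta := theta) (F := F) (st := st) j k = 0.
  by move=> sj; rewrite /piece_bound sj.
(* The common value [x] of all splittings turns differences in the second
   space into differences in the first one. *)
have swap s s' : i1 (ab s).2 = i0 ((ab s').1 - (ab s).1) + i1 (ab s').2.
  have [_ _ xs _ _] := abP s; have [_ _ xs' _ _] := abP s'.
  rewrite (lhomB emb0_hom) addrAC -xs' {1}xs.
  by rewrite addrAC subrr add0r.
have aF s s' : (s <= s')%N -> qnorm ((ab s').1 - (ab s).1) `^ p <= 4 * M * F s'.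
  move=> ss'; apply: le_trans (normableB M0 _ _) _.
  have [_ _ _ h _] := abP s; have [_ _ _ h' _] := abP s'.
  rewrite (mulrC 4) -mulrA ler_pM2l //; have := F_incr ss'; lra.
have uK j k : Kfunc (2 ^+ k) (i1 (u j)) `^ p <=
    (4 * M + 2) * piece_bound (theta := theta) (F := F) (st := st) j k.
  have t0 : 0 <= (2 : R) ^+ k by rewrite exprn_ge0.
  case sj: (st j) => [s|]; last first.
    by rewrite pbN // uN // (lhom0 emb1_hom) Kfunc0 // powR0 ?lt0r_neq0 // mulr0.
  have M42 : 0 <= 4 * M + 2 by rewrite addr_ge0.
  have K0 : 0 <= Kfunc (2 ^+ k) (i1 (u j)).
    by apply: Kfunc_ge0 => //; exact: sigma_emb1.
  have part1 : Kfunc (2 ^+ k) (i1 (u j)) `^ p <=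
      (4 * M + 2) * (theta ^+ k * rho F s).
    apply: le_trans (ler_powR2r (ltW p0) K0 (Kfunc_emb1 _ t0)) _.
    rewrite powRM ?qnorm_ge0 // theta_expr mulrCA ler_pM2l //.
    apply: le_trans (uF j s sj) _; rewrite ler_wpM2r // lerDl //.
  have := stP j; rewrite sj /piece_bound sj; case sj1: (st j.+1) => [s'|].
    move=> [ss' _ _ _]; rewrite minr_pMr // le_min part1 andbT.
    have uE : i1 (u j) = vabs (i0 ((ab s').1 - (ab s).1)).
      rewrite (lhom_abs emb1_hom) (lhomB emb1_hom) /be sj sj1 (swap s s').
      by rewrite addrK.
    rewrite uE -(lhom_abs emb0_hom).
    apply: le_trans (ler_powR2r (ltW p0) _ (Kfunc_emb0 _ t0)) _.
      by rewrite (lhom_abs emb0_hom) -uE.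
    rewrite qnorm_abs; apply: le_trans (aF s s' (ltnW ss')) _.
    by rewrite ler_wpM2r ?(ltW (F_gt0 _)) // lerDl.
  move=> _; rewrite minr_pMr // le_min part1 andbT.
  pose m := maxn s k; have sm : (s <= m)%N := leq_maxl _ _.
  have km : (2 : R) ^+ k <= 2 ^+ m by rewrite ler_eXn2l ?ltr1n // leq_maxr.
  have uE : i1 (u j) = i0 ((ab m).1 - (ab s).1) + i1 (ab m).2.
    rewrite -swap /u /be sj sj1 subr0 ger0_vabs //.
    by case: (abP s).
  have tm0 : 0 <= (2 : R) ^+ m by rewrite exprn_ge0.
  have uS : sigma_set (i1 (u j)) by rewrite uE; exact: sigma_emb.
  apply: le_trans (ler_powR2r (ltW p0) K0 (Kfunc_mono t0 km uS)) _.
  apply: le_trans (ler_powR2r (ltW p0) (Kfunc_ge0 tm0 uS) _) _.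
    by rewrite uE; exact: Kfunc_le.
  apply: le_trans (powR_subadd p0 p1 _ _) _; rewrite ?mulr_ge0 ?qnorm_ge0 //.
  rewrite mulrDl lerD //; first exact: aF.
  rewrite powRM ?qnorm_ge0 // theta_expr mulrC -ler_pdivlMr // -mulrA.
  by case: (abP m).
have uB j : qnorm (u j) `^ p <=
    (4 * M + 2) * piece_bound (theta := theta) (F := F) (st := st) j 0.
  case sj: (st j) => [s|]; last first.
    by rewrite pbN // uN // qnorm0 powR0 ?lt0r_neq0 // mulr0.
  apply: le_trans (uF j s sj) _; apply: ler_pM => //; first by rewrite lerDl.
  have rF : rho F s <= F s.
    rewrite ler_pdivrMr // ler_peMr ?(ltW (F_gt0 _)) // exprn_ege1 //.
    exact: ltW theta_gt1.
  have := stP j; rewrite sj /piece_bound sj expr0 mul1r.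
  case: (st j.+1) => [s'|]; rewrite le_min lexx andbT.
    by move=> [/ltnW/F_incr Fs' _ _ _]; exact: le_trans rF Fs'.
  by rewrite maxn0.
pose v i j := lam i j `^ p^-1 *: u j.
have v0 i j : 0 <= v i j by rewrite vscale_ge0 ?powR_ge0.
have c0 : 0 <= 4 * M + 2 by rewrite addr_ge0.
have sum_bound (g : nat -> nat -> R) i k : (forall j, g j k <=
     lam i j * ((4 * M + 2) * piece_bound (theta := theta) (F := F) (st := st) j k)) ->
    forall n, \sum_(j < n) g j k <= (4 * M + 2) * 100 * f i k.
  move=> hg n; apply: le_trans (ler_sum _ (fun (j : 'I_n) _ => hg j)) _.
  under eq_bigr do rewrite mulrCA.
  rewrite -mulr_sumr -[leRHS]mulrA; apply: ler_wpM2l => //; exact: lamF.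
have vB i j : qnorm (v i j) `^ p <=
    lam i j * ((4 * M + 2) * piece_bound (theta := theta) (F := F) (st := st) j 0).
  rewrite qnormZ_ge0 ?powR_ge0 // powRM ?powR_ge0 ?qnorm_ge0 // powRVK ?lt0r_neq0 //.
  by rewrite ler_wpM2l.
have vS i j : sigma_set (i1 (v i j)).
  exact: sigma_emb1.
have vK i j k : Kfunc (2 ^+ k) (i1 (v i j)) `^ p <=
    lam i j * ((4 * M + 2) * piece_bound (theta := theta) (F := F) (st := st) j k).
  have t0 : 0 <= (2 : R) ^+ k by rewrite exprn_ge0.
  have uS : sigma_set (i1 (u j)).
    exact: sigma_emb1.
  rewrite (lhomZ emb1_hom).
  apply: le_trans (ler_powR2r (ltW p0) _ (KfuncZ t0 _ uS)) _.
    by rewrite -(lhomZ emb1_hom); exact: (Kfunc_ge0 t0 (vS i j)).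
  rewrite ger0_norm ?powR_ge0 // powRM ?powR_ge0 ?Kfunc_ge0 // powRVK ?lt0r_neq0 //.
  by rewrite ler_wpM2l.
have /choice[B BP] i : exists B : space1 C,
    [/\ forall n, \sum_(j < n) v i j <= B,
        qnorm B `^ p <= M * (M * ((4 * M + 2) * 100 * f i 0%N)) &
        forall e : R, 0 < e -> exists m : nat, forall n : nat, (m <= n)%N ->
          qnorm (B - \sum_(j < n) v i j) < e].
  apply: (normable_series p0 M1 (v0 i)).
  exact: (sum_bound (fun j _ => qnorm (v i j) `^ p) i 0%N (vB i)).
have cc : 0 <= M * (M * ((4 * M + 2) * 100)).
  by apply: mulr_ge0; [exact: ltW|apply: mulr_ge0; [exact: ltW|exact: mulr_ge0]].
have cc' : 0 <= 2 * M * (2 * M * ((4 * M + 2) * 100)).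
  have -> : 2 * M * (2 * M * ((4 * M + 2) * 100)) =
    4 * (M * (M * ((4 * M + 2) * 100))) by ring.
  exact: mulr_ge0.
exists B; split.
- by move=> i; have [/(_ 0%N)] := BP i; rewrite big_ord0.
- move=> i k; have t0 : 0 <= (2 : R) ^+ k by rewrite exprn_ge0.
  apply: (@le_trans _ _ (2 * M * (2 * M * ((4 * M + 2) * 100 * f i k)))).
    apply: (Kfunc_lim p0 p1 M0 M1 t0 (vS i)).
      exact: (sum_bound (fun j k => Kfunc (2 ^+ k) (i1 (v i j)) `^ p) i k
        (fun j => vK i j k)).
    move=> e e0; have [_ _ /(_ e e0)[m hm]] := BP i.
    exists m, 0, (B i - \sum_(j < m) v i j); split.
    + by rewrite qnorm0 ltW.
    + by apply/ltW/hm.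
    by rewrite (lhom0 emb0_hom) add0r (lhomB emb1_hom) (lhom_sum emb1_hom) addrC subrK.
  have -> : 2 * M * (2 * M * ((4 * M + 2) * 100 * f i k)) =
      2 * M * (2 * M * ((4 * M + 2) * 100)) * f i k by ring.
  by rewrite ler_wpM2r // /division_constant lerDl.
- move=> i; have [_ h _] := BP i; apply: le_trans h _.
  have -> : M * (M * ((4 * M + 2) * 100 * f i 0%N)) =
      M * (M * ((4 * M + 2) * 100)) * f i 0%N by ring.
  by rewrite ler_wpM2r // /division_constant lerDr.
move=> e e0.
have beJ J : be J = 0 \/ qnorm (be J) `^ p <= 2 * F 0%N / 3 ^+ J.
  rewrite /be; case sJ : (st J) => [s|]; last by left.
  right; have [_ _ _ _ h] := abP s; apply: le_trans h _.
  rewrite -mulrA ler_pM2l //; elim: J s sJ => [|J IH] s.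
    by rewrite st0 => -[<-]; rewrite !expr0.
  have := stP J; case sJ : (st J) => [s'|] h' sJ1; last by rewrite h' in sJ1.
  move: h'; rewrite sJ1 => -[_ _ h _].
  rewrite exprS invfM mulrCA -ler_pdivrMl ?invr_gt0 // invrK.
  exact: le_trans h (IH s' sJ).
have [J hJ] : exists J, qnorm (be J) <= e.
  have ep : 0 < e `^ p by exact: powR_gt0.
  have F2 : 0 < 2 * F 0%N by rewrite mulr_gt0.
  (* [3 ^ J] outgrows [2 * F 0 / e `^ p]. *)
  pose J := Num.trunc (2 * F 0%N / e `^ p); exists J.+1.
  have [->|h] := beJ J.+1; first by rewrite qnorm0 ltW.
  have : qnorm (be J.+1) `^ p <= e `^ p.
    apply: le_trans h _; rewrite ler_pdivrMr ?exprn_gt0 // [leRHS]mulrC -ler_pdivrMr //.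
    apply: (@le_trans _ _ J.+1%:R); first by rewrite ltW // /J truncnS_gt.
    by rewrite -natrX ler_nat ltnW // ltn_expl.
  by rewrite -powR_lerE ?powR_ge0 ?qnorm_ge0 // powRK // ?ltW // lt0r_neq0.
have telescope : b0 <= \sum_(j < J) u j + be J.
  elim: J {hJ} => [|J IH].
    by rewrite big_ord0 add0r /be st0 ab0.
  apply: le_trans IH _; rewrite big_ord_recr /= -addrA vlerD2l.
  by rewrite -vlerBlDr; exact: vle_abs.
have [n hn] : exists n, forall j : 'I_J, 1 <= \sum_(i < n) lam i j.
  have /choice[N hN] := lam1; exists (\max_(j < J) N j) => j.
  apply: le_trans (hN j) _; have := leq_bigmax (F := fun j : 'I_J => N j) j.
  move: (\max_(j < J) N j)%N => m Nm.
  rewrite -!(big_mkord xpredT (fun i => lam i j)).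
  by rewrite (big_cat_nat (n := N j) (p := m)) //= lerDl sumr_ge0.
exists n, (be J); split=> //; apply: le_trans telescope _; rewrite vlerD2rE.
apply: (sum_le_lp_sum p0 p1 (lam := fun (i : 'I_n) (j : 'I_J) => lam i j)) => //.
by move=> i; have [h _ _] := BP i; exact: h.
Qed.

End Division.

(** * K-divisibility *)

Section KDivisibility.
Context {R : realType} {p M : R}.
Hypotheses (p0 : 0 < p) (p1 : p <= 1) (Mpos : 0 < M).

Let c := @division_constant R M.

Let c0 : 0 <= c.
Proof.
have M0 : 0 <= M by exact: ltW.
have d0 : 0 <= (4 * M + 2) * 100 by apply: mulr_ge0 => //; apply: addr_ge0 => //; exact: mulr_ge0.
have M20 : 0 <= 2 * M by exact: mulr_ge0.
by apply: addr_ge0; apply: mulr_ge0 => //; exact: mulr_ge0.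
Qed.

Lemma dyadic_scale (t : R) : 1 <= t -> exists k : nat, 2 ^+ k <= t < 2 ^+ k.+1.
Proof.
move=> t1; have ex : exists k : nat, t < 2 ^+ k.
  exists (Num.trunc t).+1; apply: lt_le_trans (truncnS_gt t) _.
  by rewrite -natrX ler_nat ltnW // ltn_expl.
case: (ex_minnP ex) => -[|k] tk kmin.
  by move: tk; rewrite expr0 ltNge t1.
exists k; rewrite tk andbT leNgt; apply/negP => /kmin.
by rewrite ltnn.
Qed.

(** Control at the scales [2 ^+ k] gives control at every [t], because
    K-functionals change at most by a factor of two between them. *)
Lemma divide_half_scales (C : qb_couple R) (g : nat -> ambient C)
    (G : R -> R) (x : ambient C) (a0 : space0 C) (b0 : space1 C) :
  normable p M (space0 C) -> normable p M (space1 C) ->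
  (forall i, sigma_set (g i)) ->
  (forall t : R, 0 < t -> forall n, \sum_(i < n) Kfunc t (g i) `^ p <= G t) ->
  (forall t : R, 0 < t -> forall e : R, 0 < e ->
    exists n, G t - e <= \sum_(i < n) Kfunc t (g i) `^ p) ->
  (forall t : R, 0 < t -> Kfunc t x `^ p <= G t) -> 0 < G 1 ->
  0 <= x -> 0 <= a0 -> 0 <= b0 -> x = emb0 a0 + emb1 b0 ->
  qnorm a0 `^ p <= 2 * G 1 -> qnorm b0 `^ p <= 2 * G 1 ->
  exists B : nat -> space1 C, [/\ forall i, 0 <= B i,
    forall i (t : R), 0 < t -> Kfunc t (emb1 (B i)) `^ p <= 2 * c * Kfunc t (g i) `^ p &
    forall e : R, 0 < e -> exists n r, qnorm r <= e /\
      b0 <= lp_sum p (fun i : 'I_n => B i) + r].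
Proof.
move=> M0 M1 gS G_ge G_lim xG G1 x0 a00 b00 xE a0G b0G.
have t0 k : 0 < (2 : R) ^+ k by rewrite exprn_gt0.
pose f i k := Kfunc (2 ^+ k) (g i) `^ p.
have f_ge0 i k : 0 <= f i k by exact: powR_ge0.
have K0 i (t : R) : 0 < t -> 0 <= Kfunc t (g i) by move=> /ltW/Kfunc_ge0; apply.
have f_incr i (k l : nat) : (k <= l)%N -> f i k <= f i l.
  move=> kl; apply: ler_powR2r; rewrite ?(ltW p0) ?K0 //.
  by apply: Kfunc_mono; rewrite ?(ltW (t0 k)) // ler_eXn2l ?ltr1n.
have f_decr i (k l : nat) : (k <= l)%N ->
    f i l / (2 `^ p) ^+ l <= f i k / (2 `^ p) ^+ k.
  move=> kl; have th m : 0 < ((2 : R) `^ p) ^+ m by rewrite exprn_gt0 // powR_gt0.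
  rewrite ler_pdivrMr // mulrAC ler_pdivlMr // -!theta_expr -!powRM ?K0 ?(ltW (t0 _)) //.
  apply: ler_powR2r; rewrite ?(ltW p0) ?mulr_ge0 ?K0 ?(ltW (t0 _)) //.
  have kl2 : (2 : R) ^+ k <= 2 ^+ l by rewrite ler_eXn2l ?ltr1n.
  rewrite -ler_pdivlMr //; apply: le_trans (Kfunc_quasi (t0 k) kl2 (gS i)) _.
  by rewrite le_eqVlt; apply/orP; left; apply/eqP; field; rewrite lt0r_neq0.
have G20 : G (2 ^+ 0) = G 1 by rewrite expr0.
have [|||B [B0 BK BN Be]] := @divide_half _ C p M p0 p1 M0 M1 f
  (fun k => G (2 ^+ k)) f_ge0 f_incr f_decr (fun n k => G_ge _ (t0 k) n)
  (fun k => G_lim _ (t0 k)) _ x a0 b0 x0 a00 b00 xE _ _ (fun k => xG _ (t0 k));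
  rewrite ?G20 //.
exists B; split=> // i t tt0.
have BS : sigma_set (emb1 (B i)).
  exact: sigma_emb1.
have c00 : 0 <= c := c0.
have pt0 : 0 <= Kfunc t (g i) `^ p := powR_ge0 _ _.
have [t1|t1] := ltP t 1.
  apply: (@le_trans _ _ (c * Kfunc t (g i) `^ p)); last by rewrite -mulrA mulr_natl mulr2n lerDl mulr_ge0.
  apply: le_trans (ler_powR2r (ltW p0) (Kfunc_ge0 (ltW tt0) BS) (Kfunc_emb1 _ (ltW tt0))) _.
  rewrite powRM ?qnorm_ge0 ?(ltW tt0) //.
  apply: le_trans (ler_wpM2l (powR_ge0 _ _) (BN i)) _; rewrite mulrCA.
  apply: ler_wpM2l => //; rewrite /f expr0 -powRM ?(ltW tt0) ?K0 //.
  apply: ler_powR2r; rewrite ?(ltW p0) ?mulr_ge0 ?(ltW tt0) ?K0 //.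
  have := Kfunc_quasi tt0 (ltW t1) (gS i); rewrite mul1r => h.
  by rewrite -ler_pdivlMl.
have [k /andP[kt tk]] := dyadic_scale t1.
have step : Kfunc (2 ^+ k.+1) (g i) <= 2 * Kfunc t (g i).
  have kk : (2 : R) ^+ k <= 2 ^+ k.+1 by rewrite ler_eXn2l ?ltr1n.
  apply: le_trans (Kfunc_quasi (t0 k) kk (gS i)) _.
  rewrite exprS mulfK ?lt0r_neq0 // ler_pM2l //.
  exact: Kfunc_mono (ltW (t0 k)) kt (gS i).
apply: le_trans (ler_powR2r (ltW p0) (Kfunc_ge0 (ltW tt0) BS)
  (Kfunc_mono (ltW tt0) (ltW tk) BS)) _.
apply: le_trans (BK i k.+1) _; rewrite (mulrC 2) -mulrA; apply: ler_wpM2l => //.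
apply: le_trans (ler_powR2r (ltW p0) (K0 _ _ (t0 _)) step) _.
by rewrite powRM ?K0 // ler_wpM2r // theta_le2.
Qed.

(** A splitting of [x] at [t = 1] has one half for the scales above [1] and one
    for those below; the second is treated in the swapped couple. *)
Lemma K_divisibility (C : qb_couple R) (g : nat -> ambient C)
    (G : R -> R) (x : ambient C) :
  normable p M (space0 C) -> normable p M (space1 C) ->
  (forall i, sigma_set (g i)) -> sigma_set x -> 0 <= x ->
  (forall t : R, 0 < t -> forall n, \sum_(i < n) Kfunc t (g i) `^ p <= G t) ->
  (forall t : R, 0 < t -> forall e : R, 0 < e ->
    exists n, G t - e <= \sum_(i < n) Kfunc t (g i) `^ p) ->
  (forall t : R, 0 < t -> Kfunc t x `^ p <= G t) ->
  exists (A : nat -> space0 C) (B : nat -> space1 C),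
  [/\ forall i, 0 <= A i, forall i, 0 <= B i,
    forall i (t : R), 0 < t ->
      Kfunc t (emb0 (A i) + emb1 (B i)) `^ p <= 8 * M * c * Kfunc t (g i) `^ p &
    forall e : R, 0 < e -> exists n r s, [/\ qnorm r <= e, qnorm s <= e &
      x <= emb0 (lp_sum p (fun i : 'I_n => A i)) +
           emb1 (lp_sum p (fun i : 'I_n => B i)) + (emb0 r + emb1 s)]].
Proof.
move=> M0 M1 gS xS x0 G_ge G_lim xG.
have h0 := @emb0_hom R C; have h1 := @emb1_hom R C; have c00 : 0 <= c := c0.
(* The sparse sequence starts from a positive value of [G]. *)
have : 0 <= G 1 by apply: le_trans (xG 1 ltr01); exact: powR_ge0.
rewrite le_eqVlt => /predU1P[G10|G1].
  have K1 : Kfunc 1 x = 0.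
    apply: (@powR_eq0_eq0 _ _ p); apply/le_anti; rewrite powR_ge0 andbT G10.
    exact: xG.
  have -> : x = 0 by apply: Kfunc1_eq0; rewrite ?K1.
  exists (fun=> 0), (fun=> 0); split=> // [i t tt0|e e0].
    rewrite (lhom0 h0) (lhom0 h1) addr0 Kfunc0 ?(ltW tt0) // powR0 ?lt0r_neq0 //.
    by apply: mulr_ge0; [apply: mulr_ge0 => //; exact/mulr_ge0/ltW|exact: powR_ge0].
  exists 0%N, 0, 0; rewrite !qnorm0 (ltW e0) (lhom0 h0) (lhom0 h1) !addr0.
  split=> //; apply: vaddr_ge0; [apply: (lhom_ge0 h0)|apply: (lhom_ge0 h1)];
    exact: lp_sum_ge0.
have G2 : 0 < 2 * G 1 by rewrite mulr_gt0.
have [|a [b [a0 b0 xE ab]]] :=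
    @Kfunc_decomp_pos _ C 1 ler01 x ((2 * G 1) `^ p^-1) xS x0.
  rewrite -[ltLHS](@powRK _ p) ?lt0r_neq0 ?Kfunc_ge0 //.
  apply: gt0_ltr_powR; rewrite ?invr_gt0 ?nnegrE ?powR_ge0 ?(ltW G2) //.
  by apply: le_lt_trans (xG 1 ltr01) _; lra.
rewrite mul1r in ab.
have aG : qnorm a `^ p <= 2 * G 1.
  rewrite -powR_lerE ?qnorm_ge0 ?(ltW G2) //; apply: le_trans (ltW ab).
  by rewrite lerDl qnorm_ge0.
have bG : qnorm b `^ p <= 2 * G 1.
  rewrite -powR_lerE ?qnorm_ge0 ?(ltW G2) //; apply: le_trans (ltW ab).
  by rewrite lerDr qnorm_ge0.
have [B [B0 BK Be]] := divide_half_scales M0 M1 gS G_ge G_lim xG G1 x0 a0 b0 xE aG bG.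
have swapE t i : 0 < t -> Kfunc (C := swap_couple C) t (g i) `^ p =
    t `^ p * Kfunc t^-1 (g i) `^ p.
  move=> t0; rewrite Kfunc_swap // powRM ?(ltW t0) // Kfunc_ge0 //.
  by rewrite invr_ge0 ltW.
pose G' t := t `^ p * G t^-1.
have gS' i : sigma_set (C := swap_couple C) (g i) by exact: (sigma_swap (gS i)).
have G_ge' t : 0 < t -> forall n,
    \sum_(i < n) Kfunc (C := swap_couple C) t (g i) `^ p <= G' t.
  move=> t0 n; under eq_bigr do rewrite swapE //.
  by rewrite -mulr_sumr ler_wpM2l ?powR_ge0 // G_ge // invr_gt0.
have G_lim' t : 0 < t -> forall e : R, 0 < e -> exists n,
    G' t - e <= \sum_(i < n) Kfunc (C := swap_couple C) t (g i) `^ p.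
  move=> t0 e e0; have tp0 : 0 < t `^ p by exact: powR_gt0.
  have t10 : 0 < t^-1 by rewrite invr_gt0.
  have [n hn] := G_lim t^-1 t10 (e / t `^ p) (divr_gt0 e0 tp0).
  exists n; under eq_bigr do rewrite swapE //.
  rewrite -mulr_sumr -ler_pdivrMl // /G' mulrBr mulKf ?lt0r_neq0 //.
  by rewrite (mulrC _ e).
have xG' t : 0 < t -> Kfunc (C := swap_couple C) t x `^ p <= G' t.
  move=> t0; have t10 : 0 < t^-1 by rewrite invr_gt0.
  rewrite Kfunc_swap // powRM ?(ltW t0) ?Kfunc_ge0 ?(ltW t10) //.
  by rewrite ler_wpM2l ?powR_ge0 // xG.
have G'1 : G' 1 = G 1 by rewrite /G' invr1 powR1 mul1r.
have xE' : x = emb0 (q := swap_couple C) b + emb1 (q := swap_couple C) a.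
  by rewrite xE addrC.
have [|||A [A0 AK Ae]] := @divide_half_scales (swap_couple C) g G' x b a M1 M0
  gS' G_ge' G_lim' xG' _ x0 b0 a0 xE' _ _; rewrite ?G'1 //.
exists A, B; split=> // [i t t0|e e0].
  have tV0 : 0 < t^-1 by rewrite invr_gt0.
  have AS : sigma_set (emb0 (A i)).
    exact: sigma_emb0.
  have BS : sigma_set (emb1 (B i)).
    exact: sigma_emb1.
  have KA : Kfunc t (emb0 (A i)) `^ p <= 2 * c * Kfunc t (g i) `^ p.
    have tp0 : 0 < t^-1 `^ p by exact: powR_gt0.
    have := AK i t^-1 tV0; rewrite swapE // invrK mulrCA.
    rewrite -[emb1 (A i)]/(emb0 (A i)) Kfunc_swap // invrK.
    by rewrite powRM ?(ltW tV0) ?Kfunc_ge0 ?(ltW t0) // ler_pM2l.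
  pose w (b' : bool) := if b' then emb0 (A i) else emb1 (B i).
  have wS b' : sigma_set (w b') by case: b'.
  have := Kfunc_sum p0 p1 M0 M1 [:: true; false] (ltW t0) wS.
  rewrite !big_cons !big_nil !addr0 /= => /le_trans; apply.
  have -> : 8 * M * c * Kfunc t (g i) `^ p =
    2 * M * (2 * c * Kfunc t (g i) `^ p + 2 * c * Kfunc t (g i) `^ p) by ring.
  by rewrite ler_pM2l ?mulr_gt0 // lerD // BK.
have [n [s [se hs]]] := Be e e0; have [m [r [re hr]]] := Ae e e0.
exists (maxn m n), r, s; split=> //; rewrite xE addrACA.
rewrite -(lhomD h0) -(lhomD h1); apply: vlerD.
  apply/(lhom_le h0)/(le_trans hr); rewrite vlerD2rE.
  exact: (lp_sum_prefix_le p0 A (leq_maxl m n)).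
apply/(lhom_le h1)/(le_trans hs); rewrite vlerD2rE.
exact: (lp_sum_prefix_le p0 B (leq_maxr m n)).
Qed.

End KDivisibility.

(** * The equivalence *)

Section Equivalence.
Context {R : realType} {p q : R}.
Hypotheses (q_gt0 : 0 < q) (le_qp : q <= p) (p_le1 : p <= 1).
Context {C : qb_couple R}.
Hypothesis C_convex : p_convex_couple p C.
Context {X : qBanachLatticeType R} {I : intermediate C X}.

Let p_gt0 : 0 < p. Proof. exact: lt_le_trans le_qp. Qed.

Lemma finitely_Kpq_monotone_single : finitely_Kpq_monotone I p q ->
  K_monotone I.
Proof.
move=> [c c0 hc] x y xy; have [t t0|x' <- _] := hc 1%N (fun=> x) y.
  rewrite big_ord1 powRK ?lt0r_neq0 //; first exact: xy.
  by rewrite KfunE Kfunc_ge0 ?(ltW t0) //; exact: sigma_val.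
by exists x'.
Qed.

(** Apply finite monotonicity to the lp sum itself, scaled by the constant of
    [Kfunc_lp_sum]. *)
Lemma finitely_Kpq_monotone_convex : finitely_Kpq_monotone I p q ->
  pq_convex p q X.
Proof.
move=> [c c0 hc]; have [d d0 hd] := Kfunc_lp_sum I p_gt0 p_le1 C_convex.
pose D := d `^ p^-1; have D0 : 0 < D by exact: powR_gt0.
exists (D * c) => n x; have [t t0|x' xE hx] := hc n x (sigma_incl I (D^-1 *: lp_sum p x)).
  have S0 : 0 <= \sum_i Kfunc t (emb I (x i)) `^ p.
    by apply: sumr_ge0 => i _; exact: powR_ge0.
  rewrite KfunE -/(emb I _) (lhomZ (emb_hom I)).
  rewrite KfuncZ_pos ?invr_gt0 ?(ltW t0) //; last exact: emb_sigma.
  rewrite ler_pdivrMl // /D.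
  rewrite -[\sum_(i < n) _]/(\sum_i Kfunc t (emb I (x i)) `^ p).
  rewrite -powRM ?(ltW d0) // powR_lerE ?mulr_ge0 ?(ltW d0) //.
    exact: hd (ltW t0).
  by apply: (Kfunc_ge0 (ltW t0)); exact: emb_sigma.
move: hx; have -> := sigma_incl_inj xE.
by rewrite qnormZ_ge0 ?invr_ge0 ?(ltW D0) // ler_pdivrMl // mulrA.
Qed.

Lemma Kpq_monotone_finitely : Kpq_monotone I p q -> finitely_Kpq_monotone I p q.
Proof.
move=> [c c0 hc]; exists c => // n x_ x xK.
pose y (i : nat) : X := oapp x_ 0 (insub i).
have pad (h : X -> R) : h 0 = 0 -> (forall z, 0 <= h z) ->
    (\sum_(0 <= i <oo) (h (y i))%:E = (\sum_(i < n) h (x_ i))%:E)%E.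
  move=> h0 hge; rewrite (nneseries_split 0 n); last by move=> k _; rewrite lee_fin.
  rewrite add0n eseries0; last first.
    by move=> k nk _; rewrite /y insubF ?h0 // ltnNge nk.
  rewrite adde0 big_mkord -sumEFin; apply: eq_bigr => i _.
  by rewrite /y insubT /= ?ltn_ord // => ni; congr (h (x_ _))%:E; exact: val_inj.

have [||x' xE hx] := hc y x.
- by rewrite (pad (fun z => qnorm z `^ q)) ?ltry // ?qnorm0 ?powR0 ?lt0r_neq0 // => z;
    exact: powR_ge0.
- move=> t t0; rewrite (pad (fun z => Kfun t (sigma_incl I z) `^ p)) //.
  + by rewrite poweR_EFin lee_fin xK.
  + rewrite KfunE -/(emb I 0) (lhom0 (emb_hom I)) Kfunc0 ?(ltW t0) //.
    by rewrite powR0 // lt0r_neq0.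
  + by move=> z; exact: powR_ge0.
exists x' => //; move: hx.
rewrite (pad (fun z => qnorm z `^ q)) => [||z]; last exact: powR_ge0.
  by rewrite poweR_EFin -EFinM lee_fin.
by rewrite qnorm0 powR0 // lt0r_neq0.
Qed.

(** The reverse Minkowski inequality, transferred to the ambient lattice. *)
Lemma emb_lp_sum_ge n (x : 'I_n -> X) (a : 'I_n -> space0 C) (b : 'I_n -> space1 C) :
  (forall k, 0 <= a k) -> (forall k, 0 <= b k) ->
  (forall k, emb I (x k) = emb0 (a k) + emb1 (b k)) ->
  emb0 (lp_sum p a) + emb1 (lp_sum p b) <= emb I (lp_sum p x).
Proof.
move=> a0 b0 xab; have h0 := @emb0_hom R C; have h1 := @emb1_hom R C.
pose u (s : 'I_n + 'I_n) := match s with inl k => emb0 (a k) | inr k => emb1 (b k) end.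
have u0 s : 0 <= u s by case: s => k; [exact: (lhom_ge0 h0)|exact: (lhom_ge0 h1)].
have Lu s : lattice_linear u (fun v => `|v s|) (u s).
  by rewrite -[X in lattice_linear _ _ X]ger0_vabs //; apply/latlin_abs/LatLinVar.
have cx := calculus_subst
  (fun k => latlin_eq (fun=> erefl) (esym (xab k)) (latlinD (Lu (inl k)) (Lu (inr k))))
  (calculus_hom (emb_hom I) (lp_sumP x p_gt0)).
have ca := calculus_subst (fun k => Lu (inl k)) (calculus_hom h0 (lp_sumP a p_gt0)).
have cb := calculus_subst (fun k => Lu (inr k)) (calculus_hom h1 (lp_sumP b p_gt0)).
apply: (calculus_le (@ambient_arch R C) (calculusD ca cb) cx) => v.
exact: lp_normD_ge.
Qed.

Section Converse.
Hypotheses (KX : K_monotone I) (X_convex : pq_convex p q X).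

(** K-divisibility splits [z] along the [x_ i]; K-monotonicity brings the pieces
    into [X], convexity sums them there, and [z] lies below the sum. *)
Lemma real_Kpq_monotone : exists2 c : R, 0 < c &
  forall (x_ : nat -> X) (z : ambient C) (S : R) (G : R -> R), sigma_set z ->
  (forall n, \sum_(i < n) qnorm (x_ i) `^ q <= S) ->
  (forall t, 0 < t -> forall n, \sum_(i < n) Kfunc t (emb I (x_ i)) `^ p <= G t) ->
  (forall t, 0 < t -> forall e : R, 0 < e ->
    exists n, G t - e <= \sum_(i < n) Kfunc t (emb I (x_ i)) `^ p) ->
  (forall t, 0 < t -> Kfunc t z `^ p <= G t) ->
  exists2 x', emb I x' = z & qnorm x' <= c * S `^ q^-1.
Proof.
have [cv0 cv1] := C_convex.
have [M0 XM0] := pq_convex_normable p_gt0 p_gt0 p_le1 cv0.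
have [M1 XM1] := pq_convex_normable p_gt0 p_gt0 p_le1 cv1.
have weaken Y (m m' : R) : normable p m Y -> m <= m' -> normable p m' Y.
  move=> [m0 hm] mm'; split=> [|J s u]; first exact: lt_le_trans mm'.
  apply: le_trans (hm _ _ _) _; rewrite ler_wpM2r //.
  by apply: sumr_ge0 => j _; exact: powR_ge0.
pose M := Num.max M0 M1.
have {}XM0 : normable p M (space0 C) by apply: weaken XM0 _; rewrite le_max lexx.
have {}XM1 : normable p M (space1 C) by apply: weaken XM1 _; rewrite le_max lexx orbT.
have Mpos : 0 < M by case: XM0.
have [N XN] := pq_convex_normable q_gt0 p_gt0 p_le1 X_convex.
have [L L0 hL] := pq_convex_power q_gt0 X_convex.
have [c1 c10 hc1] := K_monotone_constant p_gt0 p_le1 q_gt0 XM0 XM1 XN KX.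
have Npos : 0 < N by case: XN.
have c20 : 0 < 8 * M * @division_constant R M.
  by rewrite /division_constant !(mulr_gt0, addr_gt0).
have [d d0 dE] : exists2 d : R, 0 < d & d `^ p = 8 * M * @division_constant R M.
  exists ((8 * M * @division_constant R M) `^ p^-1); first exact: powR_gt0.
  by rewrite powRVK ?lt0r_neq0 // ltW.
have K0 : 0 < N * (L * (d * c1) `^ q) by rewrite !mulr_gt0 // powR_gt0 // mulr_gt0.
exists ((N * (L * (d * c1) `^ q)) `^ q^-1); first exact: powR_gt0.
move=> x_ z S G zS xS G_ge G_lim zG.
have S0 : 0 <= S by have := xS 0%N; rewrite big_ord0.
have azS : sigma_set (vabs z) by apply: sigma_solid zS _; rewrite vabs_id.
have azG t : 0 < t -> Kfunc t (vabs z) `^ p <= G t.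
  by move=> t0; rewrite Kfunc_abs ?(ltW t0) //; exact: zG.
have [A [B [A0 B0 ABK zAB]]] := K_divisibility p_gt0 p_le1 Mpos XM0 XM1
  (fun i => emb_sigma I (x_ i)) azS (vabs_ge0 z) G_ge G_lim azG.
pose g i := emb0 (A i) + emb1 (B i).
have gS i : sigma_set (g i) by exact: sigma_emb.
have /choice[y yP] i : exists y, emb I y = g i /\ qnorm y <= d * c1 * qnorm (x_ i).
  have [|t t0|w wE wn] := hc1 (x_ i) (d^-1 *: g i).
  - exact: sigma_scale.
  - rewrite KfuncZ_pos ?invr_gt0 ?(ltW t0) // ler_pdivrMl //.
    have Kx := Kfunc_ge0 (ltW t0) (emb_sigma I (x_ i)).
    have Kg := Kfunc_ge0 (ltW t0) (gS i).
    rewrite -[leLHS](@powRK _ p) ?lt0r_neq0 //.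
    rewrite powR_lerEV ?powR_ge0 ?mulr_ge0 ?(ltW d0) // powRM ?(ltW d0) // dE.
    exact: ABK.
  exists (d *: w); rewrite (lhomZ (emb_hom I)) wE scalerA divff ?lt0r_neq0 // scale1r.
  by split=> //; rewrite qnormZ_ge0 ?(ltW d0) // -mulrA ler_pM2l.
have yS n : \sum_(i < n) qnorm (y i) `^ q <= (d * c1) `^ q * S.
  apply: le_trans (_ : \sum_(i < n) (d * c1) `^ q * qnorm (x_ i) `^ q <= _).
    apply: ler_sum => i _; rewrite -powRM ?qnorm_ge0 ?mulr_ge0 ?(ltW d0) ?(ltW c10) //.
    by apply: ler_powR2r; rewrite ?(ltW q_gt0) ?qnorm_ge0 //; case: (yP i).
  by rewrite -mulr_sumr ler_wpM2l ?powR_ge0.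
have [Y [yY Yn]] := infinite_lp_sum p_gt0 q_gt0 L0 hL XN yS.
have zY : vabs z <= emb I Y.
  have h0 := @emb0_hom R C; have h1 := @emb1_hom R C.
  rewrite -[leRHS]add0r -vlerBlDr.
  suff <- : (vabs z - emb I Y) `v` 0 = 0 by exact: vler_joinl.
  apply: emb_small_eq0 => e e0; have [n [r [s [re se zn]]]] := zAB e e0.
  exists (vabs r), (vabs s); rewrite !qnorm_abs; split=> //.
  have rs0 : 0 <= emb0 (vabs r) + emb1 (vabs s).
    by rewrite vaddr_ge0 // ?(lhom_ge0 h0) ?(lhom_ge0 h1) // vabs_ge0.
  rewrite (ger0_vabs (vler_joinr _ _)); apply: vjoin_lub => //.
  rewrite vlerBlDr; apply: le_trans zn _; rewrite [leRHS]addrC; apply: vlerD.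
    apply: (@le_trans _ _ (emb I (lp_sum p (fun i : 'I_n => y i)))).
      by apply: emb_lp_sum_ge => // k; case: (yP k).
    exact/(lhom_le (emb_hom I))/yY.
  by apply: vlerD; [apply: (lhom_le h0)|apply: (lhom_le h1)]; exact: vle_abs.
have [x' x'z x'Y] := emb_solid zY; exists x' => //.
apply: le_trans (qnorm_le x'Y) _; rewrite -powRM ?(ltW K0) //.
rewrite (powR_lerE q_gt0 (qnorm_ge0 _) (mulr_ge0 (ltW K0) S0)).
by rewrite -!mulrA in Yn *.
Qed.

(** The two infinite sums are finite: that of the [qnorm (x_ i) `^ q] by
    hypothesis, that of the [Kfun t (x_ i) `^ p] because the inclusion is
    bounded and [q <= p]. *)
Lemma convex_Kpq_monotone : Kpq_monotone I p q.
Proof.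
have [c c0 hc] := real_Kpq_monotone; exists c => // x_ x xfin xK.
have q0 z : 0 <= qnorm z `^ q :> R by exact: powR_ge0.
pose S := fine (\sum_(0 <= i <oo) (qnorm (x_ i) `^ q)%:E)%E.
have SE : (\sum_(0 <= i <oo) (qnorm (x_ i) `^ q)%:E)%E = S%:E.
  by rewrite fineK // ge0_fin_numE // nneseries_ge0 // => n _ _; rewrite lee_fin.
have xS n : \sum_(i < n) qnorm (x_ i) `^ q <= S.
  rewrite -lee_fin -SE -sumEFin -(big_mkord xpredT (fun i => (qnorm (x_ i) `^ q)%:E)).
  by apply: nneseries_lim_ge => k _ _; rewrite lee_fin.
have xSi i : qnorm (x_ i) `^ q <= S.
  apply: le_trans (xS i.+1); rewrite big_ord_recr /= lerDr.
  by apply: sumr_ge0.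
have S0 : 0 <= S by have := xS 0%N; rewrite big_ord0.
have [b b0 hb] := emb_bounded I.
have xp i : qnorm (x_ i) `^ p <= S `^ ((p - q) / q) * qnorm (x_ i) `^ q.
  have [->|xn0] := eqVneq (qnorm (x_ i)) 0.
    by rewrite !powR0 ?lt0r_neq0 // mulr0.
  have -> : qnorm (x_ i) `^ p = (qnorm (x_ i) `^ q) `^ ((p - q) / q) * qnorm (x_ i) `^ q.
    rewrite -powRrM mulrCA divff ?lt0r_neq0 // mulr1.
    by rewrite -powRD ?subrK // xn0 implybT.
  rewrite ler_wpM2r //; apply: ler_powR2r => //.
  by rewrite divr_ge0 ?subr_ge0 // ltW.
pose A t := [set \sum_(i < n) Kfunc t (emb I (x_ i)) `^ p | n in [set: nat]].
have supA t : 0 < t -> has_sup (A t).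
  move=> t0; split; first by exists (\sum_(i < 0) Kfunc t (emb I (x_ i)) `^ p); exists 0%N.
  exists ((Num.max 1 t * b) `^ p * (S `^ ((p - q) / q) * S)) => _ [n _ <-].
  have m0 : 0 <= Num.max 1 t by rewrite le_max ler01.
  apply: le_trans (_ : \sum_(i < n) (Num.max 1 t * b) `^ p *
     (S `^ ((p - q) / q) * qnorm (x_ i) `^ q) <= _).
    apply: ler_sum => i _; apply: le_trans (ler_wpM2l (powR_ge0 _ _) (xp i)).
    rewrite -powRM ?qnorm_ge0 ?mulr_ge0 ?(ltW b0) // -mulrA.
    apply: ler_powR2r; rewrite ?(ltW p_gt0) ?hb ?(ltW t0) //.
    by apply: (Kfunc_ge0 (ltW t0)); exact: emb_sigma.
  by rewrite -!mulr_sumr !ler_wpM2l ?powR_ge0.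
pose G t := sup (A t).
have G_ge t : 0 < t -> forall n, \sum_(i < n) Kfunc t (emb I (x_ i)) `^ p <= G t.
  by move=> t0 n; apply: sup_upper_bound; [exact: supA|exists n].
have [||x' x'E x'n] := hc x_ (val x) S G (sigma_val x) xS G_ge _ _.
- move=> t t0 e e0; have [_ [n _ <-] hn] := sup_adherent e0 (supA t t0).
  by exists n; exact: ltW.
- move=> t t0; have xK0 := Kfunc_ge0 (ltW t0) (sigma_val x).
  have G0 : 0 <= G t by have := G_ge t t0 0%N; rewrite big_ord0.
  rewrite -powR_lerE // -lee_fin -poweR_EFin; apply: le_trans (xK t t0) _.
  apply: gt0_ler_poweR; rewrite ?invr_ge0 ?(ltW p_gt0) ?in_itv /= ?leey ?andbT //.
  + by apply: nneseries_ge0 => n _ _; rewrite lee_fin powR_ge0.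
  apply: lime_le.
    by apply: is_cvg_nneseries => n _ _; rewrite lee_fin powR_ge0.
  apply: nearW => n; rewrite big_mkord sumEFin lee_fin.
  exact: G_ge.
exists x'; first by apply: val_inj.
by rewrite SE poweR_EFin -EFinM lee_fin.
Qed.

End Converse.

End Equivalence.

Theorem proposition6p11 (R : realType) (p q : R)
    (q_gt0 : 0 < q) (le_qp : q <= p) (p_le1 : p <= 1)
    (C : qb_couple R) (C_convex : p_convex_couple p C)
    (X : qBanachLatticeType R) (I : intermediate C X) :
  (finitely_Kpq_monotone I p q <-> K_monotone I /\ pq_convex p q X) /\
  (K_monotone I /\ pq_convex p q X <-> Kpq_monotone I p q).
Proof.
have ab : finitely_Kpq_monotone I p q -> K_monotone I /\ pq_convex p q X.
  move=> h; split; first exact: finitely_Kpq_monotone_single h.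
  exact: finitely_Kpq_monotone_convex h.
have bc : K_monotone I /\ pq_convex p q X -> Kpq_monotone I p q.
  by move=> [KX cX]; exact: convex_Kpq_monotone.
have ca : Kpq_monotone I p q -> finitely_Kpq_monotone I p q.
  exact: Kpq_monotone_finitely.
by split; split; tauto.
Qed.
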